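(* Let $G$ be an undirected graphical model for discrete variables. Then the following five statements are equivalent: (a) $G$ is a decomposable graphical model. (b) A distribution $P$ factors according to $G$ if and only if $P$ satisfies a set of quadratic binomials corresponding to global separation statements in $G$. (c) The ideal $I_{A(G)}$ has a quadratic Gröbner basis in which each polynomial corresponds to a global separation statement in $G$. (d) The maximum likelihood estimate for $G$ is a rational function. (e) The set $\mathrm{image}(\phi_{A(G)})$ is closed.
   Context: Graphs and models. $G$ is an undirected graph whose vertices are the discrete variables $X_1,\dots,X_n$; $I_{X_j}$ is the finite set of levels of $X_j$, and $\mathcal{X}=I_{X_1}\times\cdots\times I_{X_n}$. A clique is (the vertex set of) a maximal complete subgraph of $G$. The model $G$ is decomposable if the graph $G$ is chordal, i.e. every cycle of length 4 or more has a chord. The matrix $A(G)$ is the 0/1 matrix whose columns are indexed by $\mathcal{X}$ and whose rows are indexed by pairs $(C,c)$ with $C$ a clique of $G$ and $c\in\prod_{X_j\in C}I_{X_j}$; the entry in row $(C,c)$ and column $x$ is $1$ if the projection of $x$ to the coordinates in $C$ equals $c$, and $0$ otherwise. For a matrix $A=(a_{ij})$ of nonnegative integers with $d$ rows and $m$ columns, $\phi_A:\mathbf{R}_{\ge0}^d\to\mathbf{R}_{\ge0}^m$ is the map $(t_1,\dots,t_d)\mapsto(\prod_i t_i^{a_{i1}},\dots,\prod_i t_i^{a_{im}})$, with the convention $t^0=1$ for $t\ge 0$. A probability distribution $P=(p_x)_{x\in\mathcal{X}}$ (nonnegative entries summing to 1) factors according to $G$ if $P\in\mathrm{image}(\phi_{A(G)})$;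 equivalently $P(x)\propto\prod_C\psi_C(x)$, the product being over the cliques $C$ of $G$, with nonnegative functions $\psi_C$ depending on $x$ only through its coordinates in $C$. Toric ideal. Work in the polynomial ring $\mathbf{R}[\mathcal{X}]$ with indeterminates $p_x$, $x\in\mathcal{X}$. The toric ideal $I_{A(G)}$ is generated by all binomials $\prod_x p_x^{u_x}-\prod_x p_x^{v_x}$ with $u,v$ nonnegative integer vectors such that $A(G)u=A(G)v$. The nonnegative toric variety $X_{A(G)}$ is the set of points of $\mathbf{R}_{\ge0}^{\mathcal{X}}$ at which all polynomials of $I_{A(G)}$ vanish; the probability distributions in it are exactly those that factor according to $G$ or are limits of distributions that factor according to $G$ (the extended model). Binomials corresponding to global separation statements. Let $X,Y,Z$ be pairwise disjoint subsets of $\{X_1,\dots,X_n\}$ with $X\cup Y\cup Z=\{X_1,\dots,X_n\}$ such that $Z$ separates $X$ from $Y$ in $G$ (every path from a vertex in $X$ to a vertex in $Y$ passes through a vertex in $Z$). The quadratic binomials corresponding to this (saturated) separation statement are the cross-product differences $$p_{(x,y,z)}\,p_{(x',y',z)}-p_{(x',y,z)}\,p_{(x,y',z)},$$ where $x\neq x'$ are in $\prod_{X_i\in X}I_{X_i}$, $y\ne y'$ are in $\prod_{X_j\in Y}I_{X_j}$, $z\in\prod_{X_k\in Z}I_{X_k}$, and $(x,y,z)$ denotes the corresponding element of $\mathcal{X}$. A distribution $P$ satisfies a binomial if the binomial vanishes at $P$. A Gröbner basis is taken with respect to some term order. Maximum likelihood estimate. For a data set with cell counts $(m_x)_{x\in\mathcal{X}}$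 (nonnegative integers, not all zero, $N=\sum_x m_x$), the maximum likelihood estimate is $\hat m=N\hat P$, where $\hat P$ is the maximizer of $\prod_x P(x)^{m_x}$ over all probability distributions $P$ in the extended model, i.e. in $X_{A(G)}$. Equivalently, $\hat m$ is the unique nonnegative real vector in $X_{A(G)}$ with $A(G)\hat m=A(G)m$. In (d) the estimate is regarded as a function of the cell counts.
   Formalization: Every variable is assumed to have at least two levels; without this the equivalence fails: a 4-cycle in which one variable has a single level is not chordal, but its model is that of a path, whose image is closed. *)

(* Defs.v *)
From HB Require Import structures.
(* The notations of [mpoly] clash with those of analysis; it comes first because
   it redefines names such as [symmetric]. *)
From mathcomp Require Import -(notations) mpoly.
From mathcomp Require Import all_boot all_order all_algebra.
From mathcomp Require Import classical_sets reals topology normedtype.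

Set Implicit Arguments.
Unset Strict Implicit.
Unset Printing Implicit Defensive.

Import Order.TTheory GRing.Theory Num.Theory.
Import numFieldNormedType.Exports.

Section Graph.
Variables (V : finType) (e : rel V).

(* A chord joins two vertices of the cycle that are not consecutive on it. *)
Definition decomposable : Prop :=
  forall c : seq V, ucycle e c -> (3 < size c)%N ->
  exists x y : V,
    [/\ x \in c, y \in c, e x y, next c x != y & next c y != x].

Definition complete_set (C : {set V}) : bool :=
  [forall x in C, forall y in C, (x != y) ==> e x y].

Definition clique (C : {set V}) : bool := maxset complete_set C.

Definition separates (Z X Y : {set V}) : Prop :=
  forall (x y : V) (p : seq V), x \in X -> y \in Y ->
  path e x p -> last x p = y -> exists2 z, z \in x :: p & z \in Z.

Definition global_separation (X Y Z : {set V}) : Prop :=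
  [/\ [disjoint X & Y], [disjoint X & Z], [disjoint Y & Z],
      (forall v, v \in X :|: Y :|: Z) & separates Z X Y].

End Graph.

Section Cells.
Variables (V : finType) (I : V -> finType).

Definition cell : finType := {dffun forall v : V, I v}.

Definition assignment (C : {set V}) : finType :=
  {dffun forall v : {v : V | v \in C}, I (val v)}.

Definition proj (C : {set V}) (x : cell) : assignment C :=
  [ffun v : {v : V | v \in C} => x (val v)].

Variable e : rel V.

Definition design_row : finType :=
  {C : {C : {set V} | clique e C} & assignment (val C)}.

Definition design (r : design_row) (x : cell) : nat :=
  proj (val (tag r)) x == tagged r.

End Cells.

Arguments design {V} I e r x.

Local Open Scope classical_set_scope.
Local Open Scope ring_scope.

(* A matrix with rows [D] and columns [M] is a function [D -> M -> nat]. The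
   polynomial ring in the indeterminates p_x, x : M, is [mpoly #|M| R], where
   p_x is the variable of index [enum_rank x]. *)
Section Toric.
Variables (R : realType) (D M : finType) (A : D -> M -> nat).

Definition phi (t : D -> R) : M -> R :=
  fun x => \prod_i t i ^+ A i x.

Definition image_phi : set (M -> R) := phi @` [set t | forall i, 0 <= t i].

Definition indet (x : M) : mpoly #|M| R := mpolyX R (mnm1 (enum_rank x)).

Definition eval_at (P : M -> R) (f : mpoly #|M| R) : R :=
  meval (fun i => P (enum_val i)) f.

Definition ideal_gen (n : nat) (S : set (mpoly n R)) : set (mpoly n R) :=
  [set f | exists k (g b : 'I_k -> mpoly n R),
     (forall i, S (b i)) /\ f = \sum_i g i * b i].

Definition toric_ideal : set (mpoly #|M| R) :=
  ideal_gen [set f | exists u v : M -> nat,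
    (forall i, (\sum_x A i x * u x)%N = (\sum_x A i x * v x)%N) /\
    f = \prod_x indet x ^+ u x - \prod_x indet x ^+ v x].

Definition toric_variety : set (M -> R) :=
  [set P | (forall x, 0 <= P x) /\
           (forall f, toric_ideal f -> eval_at P f = 0)].

Definition distribution (P : M -> R) : Prop :=
  (forall x, 0 <= P x) /\ \sum_x P x = 1.

Definition likelihood (m : M -> nat) (P : M -> R) : R :=
  \prod_x P x ^+ m x.

Definition is_mle (m : M -> nat) (mhat : M -> R) : Prop :=
  exists P : M -> R,
    [/\ distribution P, toric_variety P,
        (forall Q, distribution Q -> toric_variety Q ->
           likelihood m Q <= likelihood m P)
      & forall x, mhat x = (\sum_y m y)%N%:R * P x].

(* The indeterminate p_x also stands for the count m_x. As usual for rational
   functions, nothing is required where a denominator vanishes. *)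
Definition mle_rational : Prop :=
  exists f g : M -> mpoly #|M| R,
    (forall x, g x != 0) /\
    forall m : M -> nat, (exists x, m x != 0%N) ->
      let ev := eval_at (fun x => (m x)%:R) in
      (forall x, ev (g x) != 0) -> is_mle m (fun x => ev (f x) / ev (g x)).

End Toric.

Arguments image_phi R {D M} A.
Arguments indet R {M} x.
Arguments toric_ideal R {D M} A.
Arguments mle_rational R {D M} A.

Section Groebner.
Variables (R : realType) (n : nat) (ord : rel (multinom n)).

Definition term_order : Prop :=
  [/\ reflexive ord, antisymmetric ord, transitive ord & total ord] /\
  (forall m, ord mnm0 m) /\
  (forall m m1 m2, ord m1 m2 -> ord (mnm_add m1 m) (mnm_add m2 m)).

Definition leading_monomial (f : mpoly n R) (m : multinom n) : Prop :=
  m \in msupp f /\ forall m', m' \in msupp f -> ord m' m.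

Definition initial_ideal (S : set (mpoly n R)) : set (mpoly n R) :=
  ideal_gen [set f | exists g m, [/\ S g, leading_monomial g m
                                   & f = mpolyX R m]].

Definition groebner_basis (J : set (mpoly n R)) (B : seq (mpoly n R)) : Prop :=
  (forall g, g \in B -> J g) /\
  initial_ideal [set g | g \in B] = initial_ideal J.

End Groebner.

Section Separation.
Variables (R : realType) (V : finType) (e : rel V) (I : V -> finType).

Definition joins (X Y Z : {set V}) (x : assignment I X) (y : assignment I Y)
    (z : assignment I Z) (w : cell I) : Prop :=
  [/\ proj X w = x, proj Y w = y & proj Z w = z].

Definition cross_product_difference (X Y Z : {set V})
    (f : mpoly #|cell I| R) : Prop :=
  exists (x x' : assignment I X) (y y' : assignment I Y) (z : assignment I Z)
         (a b c d : cell I),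
    [/\ x != x', y != y',
        joins x y z a /\ joins x' y' z b,
        joins x' y z c /\ joins x y' z d
      & f = indet R a * indet R b - indet R c * indet R d].

Definition separation_binomial (f : mpoly #|cell I| R) : Prop :=
  exists X Y Z : {set V},
    global_separation e X Y Z /\ cross_product_difference X Y Z f.

Definition factors (P : cell I -> R) : Prop :=
  image_phi R (design I e) P.

End Separation.

(* Main.v *)
(** A chordal graph has a perfect elimination ordering [rk]: the earlier neighbours
    [pa v] of each vertex form a complete set, which moreover separates [v] from all
    other earlier vertices. Summing the separation binomials over the later
    coordinates gives [P_{H+v} P_{pa v} = P_H P_{pa v + v}], where [H] is the set of
    vertices before [v]; so a nonnegative solution of the binomials is
    [P_0 \prod_v P_{pa v + v} / P_{pa v}], and it factors. This gives (b), and (e)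
    because the image is then cut out by closed conditions. The same product formula
    applied to the counts satisfies the likelihood equations, hence (d). For (c), order
    cells lexicographically along [rk] and monomials by degree reverse lexicographic
    order. In a monomial that no leading term of a separation binomial divides, the
    levels at [v] are matched monotonically with the earlier coordinates inside each
    configuration of [pa v], so each fiber contains only one such monomial.

    Conversely, contract a chordless cycle of length at least 4 to a triangle of
    binary variables, all other vertices being held at a fixed level. A clique sees
    at most two of the three bits, so on these eight cells the model is that of no
    three-way interaction: the quartic
    [p000 p011 p101 p110 - p001 p010 p100 p111] lies in the toric ideal, whereas
    no separation binomial involves a product of two of the eight cells. Hence the
    uniform distribution on the four even cells refutes (b), the leading monomial of
    the quartic refutes (c), and the indicator of the six cells other than 000 and 111,
    which is a limit of distributions that factor, refutes (e). For (d), take counts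
    [k^4] at 000 and [k^2] at the odd cells, up to bounded terms: the quartic forces
    the estimate at 011 to grow like [k^(4/3)], which is not the growth of a rational
    function of [k]. *)

Require Import Defs.
From HB Require Import structures.
From mathcomp Require Import -(notations) mpoly.
From mathcomp Require Import all_boot all_order all_algebra.
From mathcomp Require Import classical_sets reals topology normedtype.
From mathcomp Require Import ring lra.

Set Implicit Arguments.
Unset Strict Implicit.
Unset Printing Implicit Defensive.

Import Order.TTheory GRing.Theory Num.Theory.
Import numFieldNormedType.Exports.

Local Open Scope ring_scope.

(** * Cells and margins *)

Section Cells.
Variables (V : finType) (I : V -> finType).
Implicit Types (x y z a b : cell I) (C D Y : {set V}).

Definition agree C x y := [forall v in C, x v == y v].

Lemma agreeP C x y : reflect (forall v, v \in C -> x v = y v) (agree C x y).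
Proof.
by apply: (iffP forall_inP) => h v vC; [apply/eqP; exact: h | apply/eqP; exact: h].
Qed.

Lemma agree_refl C x : agree C x x. Proof. exact/agreeP. Qed.

Lemma agree_sym C x y : agree C x y = agree C y x.
Proof. by apply: eq_forallb => v; rewrite eq_sym. Qed.

Lemma agree_trans C y x z : agree C x y -> agree C y z -> agree C x z.
Proof.
by move=> /agreeP h /agreeP k; apply/agreeP => v vC; rewrite h ?k.
Qed.

Lemma agree_eql C x y z : agree C x y -> agree C x z = agree C y z.
Proof.
by move=> xy; apply/idP/idP; apply: agree_trans; rewrite // agree_sym.
Qed.

Lemma agree_sub C D x y : D \subset C -> agree C x y -> agree D x y.
Proof.
by move=> /fintype.subsetP s /agreeP h; apply/agreeP => v /s; exact: h.
Qed.

Lemma agreeU C D x y : agree (C :|: D) x y = agree C x y && agree D x y.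
Proof.
apply/idP/andP => [h|[/agreeP h /agreeP k]]; last first.
  by apply/agreeP => v; rewrite inE => /orP[/h|/k].
by split; apply: agree_sub h; [exact: finset.subsetUl | exact: finset.subsetUr].
Qed.

Lemma agree1 v x y : agree [set v] x y = (x v == y v).
Proof.
apply/agreeP/eqP => [-> //|h u]; first by rewrite inE.
by rewrite inE => /eqP ->.
Qed.

Lemma agree0 x y : agree finset.set0 x y.
Proof. by apply/agreeP => v; rewrite inE. Qed.

Lemma agreeT x y : agree finset.setT x y = (x == y).
Proof.
apply/agreeP/eqP => [h|-> //]; apply/ffunP => v; apply: h; exact: finset.in_setT.
Qed.

Lemma eq_proj C x y : (proj C x == proj C y) = agree C x y.
Proof.
apply/eqP/agreeP => [h v vC|h].
  by have := congr1 (fun f : assignment I C => f (exist _ v vC)) h; rewrite !ffunE.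
by apply/ffunP => -[v vC]; rewrite !ffunE /= h.
Qed.

(** If [x] and [y] agree on a separator of [X] and [Y], then [mix Y x y] and [mix Y y x] are the
    other two cells of a cross-product difference. *)
Definition mix Y x y : cell I := [ffun v => if v \in Y then y v else x v].

Lemma mixE Y x y v : mix Y x y v = if v \in Y then y v else x v.
Proof. by rewrite ffunE. Qed.

Lemma agree_mixl C Y x y : [disjoint C & Y] -> agree C (mix Y x y) x.
Proof.
move=> /disjointFr d; apply/agreeP => v vC.
by rewrite mixE d.
Qed.

Lemma agree_mixr C Y x y : (forall v, v \in C -> v \notin Y -> x v = y v) ->
  agree C (mix Y x y) y.
Proof.
by move=> h; apply/agreeP => v vC; rewrite mixE; case: ifPn => // /(h v vC).
Qed.

Lemma mixK Y x y : mix Y (mix Y x y) (mix Y y x) = x.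
Proof. by apply/ffunP => v; rewrite !mixE; case: (v \in Y). Qed.

Section Margin.
Variable S : nmodType.
Implicit Types u : cell I -> S.

(** Indexing margins by whole cells allows margins on different sets to be compared without
    casts. *)
Definition marg u C x : S := \sum_(y | agree C y x) u y.

Lemma margT u x : marg u finset.setT x = u x.
Proof.
by rewrite /marg (eq_bigl (pred1 x)) ?big_pred1_eq // => y; rewrite agreeT.
Qed.

Lemma marg0 u x : marg u finset.set0 x = \sum_y u y.
Proof. by apply: eq_bigl => y; rewrite agree0. Qed.

Lemma eq_marg u C x y : agree C x y -> marg u C x = marg u C y.
Proof.
move=> a; apply: eq_bigl => z; apply/idP/idP => h; apply: agree_trans h _ => //.
by rewrite agree_sym.
Qed.

Lemma sum_proj u (P : pred (cell I)) C :
  \sum_(y | P y) u y =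
  \sum_(c : assignment I C) \sum_(y | P y && (proj C y == c)) u y.
Proof. by rewrite (partition_big (@proj V I C) predT). Qed.

(** Each fiber of the projection to [C] lies inside [Q] or misses it, so the sum over [Q] is a sum
    of margins on [C]. *)
Lemma eq_sum_agree C (Q : pred (cell I)) u w :
  (forall x y, agree C x y -> Q x = Q y) ->
  (forall x, marg u C x = marg w C x) ->
  \sum_(y | Q y) u y = \sum_(y | Q y) w y.
Proof.
move=> QC h; rewrite [LHS](sum_proj _ _ C) [RHS](sum_proj _ _ C); apply: eq_bigr => c _.
case: (pickP (fun y => Q y && (proj C y == c))) => [y0|no]; last first.
  by rewrite !big_pred0.
case/andP=> Qy0 /eqP <-.
have E y : Q y && (proj C y == proj C y0) = agree C y y0.
  rewrite eq_proj andbC; case: (boolP (agree C y y0)) => //= a.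
  by rewrite (QC _ _ a).
by rewrite !(eq_bigl _ _ E) [LHS]h.
Qed.

Lemma marg_sub u w C D : D \subset C ->
  (forall x, marg u C x = marg w C x) -> forall x, marg u D x = marg w D x.
Proof.
move=> sDC h x; apply: eq_sum_agree h => y z yz; apply: agree_eql.
exact: agree_sub sDC yz.
Qed.

Lemma sum_design_row u (e : rel V) (C : {C : {set V} | clique e C}) x :
  \sum_y u y *+ design I e (existT _ C (proj (val C) x)) y = marg u (val C) x.
Proof.
rewrite /marg [RHS]big_mkcond /=; apply: eq_bigr => y _.
by rewrite /design /= eq_proj; case: ifP.
Qed.

Lemma eq_sum_design u w (e : rel V) :
  (forall C, clique e C -> forall x, marg u C x = marg w C x) ->
  forall i, \sum_x u x *+ design I e i x = \sum_x w x *+ design I e i x.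
Proof.
move=> h [C c]; case: (pickP (fun x => proj (val C) x == c)) => [x /eqP <-|no].
  by rewrite !sum_design_row; apply: h; exact: (valP C).
by rewrite !big1 // => x _; rewrite /design /= no.
Qed.

Lemma eq_marg_design u w (e : rel V) :
  (forall i, \sum_x u x *+ design I e i x = \sum_x w x *+ design I e i x) ->
  forall C, clique e C -> forall x, marg u C x = marg w C x.
Proof.
by move=> h C Cc x; have := h (existT _ (exist _ C Cc) (proj C x));
  rewrite !(sum_design_row _ (exist _ C Cc)).
Qed.

End Margin.

Lemma complete_sub_clique (e : rel V) C : complete_set e C ->
  exists2 K, clique e K & C \subset K.
Proof. by move=> /maxset_exists[K]; exists K. Qed.

Lemma complete_setP (e : rel V) C :
  reflect {in C &, forall u v, u != v -> e u v} (complete_set e C).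
Proof.
apply: (iffP forall_inP) => [h u v uC vC uv|h u uC].
  by have /forall_inP /(_ v vC) /implyP := h u uC; apply.
by apply/forall_inP => v vC; apply/implyP; exact: h.
Qed.

Lemma complete_sub (e : rel V) C D :
  D \subset C -> complete_set e C -> complete_set e D.
Proof.
move=> /fintype.subsetP s /complete_setP h; apply/complete_setP => u v /s uC /s vC.
exact: h.
Qed.

Lemma complete0 (e : rel V) : complete_set e finset.set0.
Proof. by apply/complete_setP => u v; rewrite inE. Qed.

Lemma marg_complete (S : nmodType) (u w : cell I -> S) (e : rel V) :
  (forall C, clique e C -> forall x, marg u C x = marg w C x) ->
  forall D, complete_set e D -> forall x, marg u D x = marg w D x.
Proof.
by move=> h D /complete_sub_clique[K cK sDK]; apply: marg_sub sDK (h _ cK).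
Qed.

End Cells.

Arguments complete_setP {V e C}.
Arguments agreeP {V I C x y}.

(** * Products of potentials on complete sets *)

Section Factors.
Variables (R : realType) (V : finType) (e : rel V) (I : V -> finType).
Implicit Types P Q : cell I -> R.

Lemma factorsM P Q : factors e P -> factors e Q -> factors e (fun x => P x * Q x).
Proof.
move=> [t t0 tP] [s s0 sQ]; exists (fun i => t i * s i) => [i|].
  by apply: mulr_ge0; [exact: t0 | exact: s0].
rewrite -tP -sQ; apply/boolp.funext => x; rewrite /phi -big_split /=.
by apply: eq_bigr => i _; rewrite exprMn.
Qed.

Lemma factors1 : factors e (fun _ : cell I => 1 : R).
Proof.
exists (fun=> 1) => // ; apply/boolp.funext => x.
by rewrite /phi big1 // => i _; rewrite expr1n.
Qed.

Lemma factors_prod (J : Type) (r : seq J) (p : pred J) (F : J -> cell I -> R) :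
  (forall j, p j -> factors e (F j)) ->
  factors e (fun x => \prod_(j <- r | p j) F j x).
Proof.
move=> h; elim: r => [|j r IH].
  by have := factors1; congr factors; apply/boolp.funext => x; rewrite big_nil.
case pj: (p j); last first.
  by move: IH; congr factors; apply/boolp.funext => x; rewrite big_cons pj.
have := factorsM (h j pj) IH.
by congr factors; apply/boolp.funext => x; rewrite big_cons pj.
Qed.

(** The parameters of one clique [K] containing [D] carry [psi]; all others are 1. *)
Lemma factors_potential D (psi : cell I -> R) : complete_set e D ->
  (forall x, 0 <= psi x) -> (forall x y, agree D x y -> psi x = psi y) ->
  factors e psi.
Proof.
move=> /complete_sub_clique[K cK sDK] psi0 psiD.
(* Any cell above [c] gives the same value because [D] lies in [K]; the default 1 is for assignments
   that extend to no cell. *)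
pose f (c : assignment I K) :=
  if [pick y | proj K y == c] is Some y then psi y else 1.
pose t (i : design_row I e) :=
  if boolP (val (tag i) == K) is AltTrue h then
    f (ecast C (assignment I C) (eqP h) (tagged i)) else 1.
exists t => [i|].
  rewrite /t; case: {-}_ / boolP => // h; rewrite /f; case: pickP => //.
apply/boolp.funext => x; rewrite /phi.
pose i0 : design_row I e := existT _ (exist _ K cK) (proj K x).
rewrite (bigD1 i0) //= big1 ?mulr1 => [|i ii0].
  rewrite /design eqxx expr1 /t /=; case: {-}_ / boolP; last by rewrite eqxx.
  move=> h; rewrite (eq_axiomK (eqP h)) /= /f; case: pickP => [y|/(_ x)].
    by rewrite eq_proj => a; apply: psiD; apply: agree_sub a.
  by rewrite eqxx.
rewrite /design; case: eqP => [E|]; last by rewrite expr0.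
rewrite expr1 /t; case: {-}_ / boolP => // h; case/eqP: ii0.
case: i E h => -[C cC] c /= <- h.
have CK := eqP h; rewrite /i0; move: cC {c h}; rewrite CK => cC.
by rewrite (bool_irrelevance cC cK).
Qed.

Lemma factors_ge0 P : factors e P -> forall x, 0 <= P x.
Proof.
move=> [t t0 <-] x; rewrite /phi; apply: prodr_ge0 => i _.
by rewrite exprn_ge0 //; exact: t0.
Qed.

End Factors.

(** * Perfect elimination orderings *)

Section PerfectElimination.
Variables (V : finType) (e : rel V).
Hypotheses (e_sym : symmetric e) (e_irr : irreflexive e).
Implicit Types (C W Z : {set V}) (u v w x y : V).

(** The index [j] is read in [t], hence stands for position [j.+1] of the walk [x :: t]: the edge
    skips at least one vertex. *)
Lemma path_shortcut x t i j : path e x t -> (i < j < size t)%N ->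
  e (nth x (x :: t) i) (nth x t j) -> path e x (take i t ++ drop j t).
Proof.
move=> pt /andP[ij jt] eij.
have it : (i <= size t)%N by rewrite ltnW // (ltn_trans ij).
have := pt; rewrite -{1}(cat_take_drop i t) cat_path => /andP[pi _].
have := pt; rewrite -{1}(cat_take_drop j t) cat_path => /andP[_].
rewrite cat_path pi /= (drop_nth x jt) /= => /andP[_ ->].
rewrite andbT; move: eij; congr (e _ _); case: i it {ij pi} => [|i] it; first by rewrite take0.
by rewrite -nth_last size_takel //= nth_take.
Qed.

(** The default value [w] of [nth] closes the cycle after its last vertex. *)
Lemma next_cons_nth w s u : u \in s -> uniq (w :: s) ->
  next (w :: s) u = nth w s (index u s).+1.
Proof.
move=> us; rewrite cons_uniq => /andP[ws _]; rewrite next_nth inE us orbT /=.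
by case: eqP => // wu; rewrite wu us in ws.
Qed.

(** The cycle through [w] and the path has a chord; it cannot end at [w], so it shortens the path,
    and induction on the length applies. *)
Lemma chordless_detour w x y C t : decomposable e ->
  e w x -> e w y -> x != y -> ~~ e x y ->
  (forall c, c \in C -> c != w /\ ~~ e w c) ->
  path e x t -> last x t = y -> uniq (x :: t) ->
  {subset t <= y |: C} -> False.
Proof.
move=> dec ewx ewy xy nexy CP.
have [n] := ubnP (size t); elim: n t => // n IH t szt pt lt ut sub.
have wt : w \notin x :: t.
  rewrite inE; apply/norP; split; first by apply/eqP => E; rewrite E e_irr in ewx.
  apply/negP => /sub; rewrite !inE => /orP[/eqP E|/CP[]]; last by rewrite eqxx.
  by rewrite E e_irr in ewy.
have szt2 : (1 < size t)%N.
  case: t lt pt {szt ut sub wt} => [/= E|b [|//]]; first by rewrite E eqxx in xy.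
  by move=> /= ->; rewrite andbT (negPf nexy).
have uc : uniq (w :: x :: t) by rewrite [uniq _]/= wt.
have ucyc : ucycle e (w :: x :: t).
  by rewrite /ucycle /= rcons_path ewx pt lt e_sym ewy wt.
have [u [v [uI vI euv nuv nvu]]] := dec _ ucyc szt2.
(* The only neighbours of [w] on the cycle are [x] and [y], which are consecutive to [w]. *)
have nw a b : b \in w :: x :: t -> e a b ->
    next (w :: x :: t) a != b -> next (w :: x :: t) b != a -> a != w.
  move=> bI eab h1 h2; apply/negP => /eqP aw; move: bI eab h1 h2.
  rewrite {a}aw => bI ewb; rewrite /= eqxx => xb.
  move: bI; rewrite !inE [b == x]eq_sym (negPf xb) /=.
  case/orP => [/eqP E|/sub]; first by rewrite E e_irr in ewb.
  rewrite !inE => /orP[/eqP-> |/CP[_]]; last by rewrite ewb.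
  have yt : y \in x :: t by rewrite -lt mem_last.
  change (next (w :: x :: t) y != w -> False).
  rewrite next_cons_nth // -[X in index X]lt index_last //.
  by rewrite nth_default ?eqxx.
have uw := nw u v vI euv nuv nvu.
have vw : v != w by apply: nw uI _ nvu nuv; rewrite e_sym.
have {}uI : u \in x :: t by move: uI; rewrite inE (negPf uw).
have {}vI : v \in x :: t by move: vI; rewrite inE (negPf vw).
wlog ij : u v uI vI euv nuv nvu {uw vw} / (index u (x :: t) < index v (x :: t))%N.
  move=> H; case: (ltngtP (index u (x :: t)) (index v (x :: t))) => [||E].
  - exact: H.
  - by apply: H; rewrite // e_sym.
  - move: euv; rewrite -(nth_index x uI) E (nth_index x vI).
    by rewrite e_irr.
set i := index u _ in ij; set j := index v _ in ij.
have jt : (j < size (x :: t))%N by rewrite index_mem.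
have Eu : nth x (x :: t) i = u by rewrite nth_index.
have Ev : nth x (x :: t) j = v by rewrite nth_index.
have ij1 : j != i.+1.
  apply: contraNneq nuv => ji; rewrite next_cons_nth //.
  by rewrite -/i -ji -[X in _ == X]Ev (set_nth_default x).
have {ij1} ij2 : (i.+1 < j)%N by rewrite ltn_neqAle eq_sym ij1.
case: j => [//|j] in ij ij2 jt Ev *.
rewrite /= ltnS in jt; rewrite ltnS in ij2; rewrite [LHS]/= in Ev.
have P : path e x (take i t ++ drop j t).
  by apply: path_shortcut; rewrite ?ij2 // Eu Ev.
have S : subseq (take i t ++ drop j t) t.
  rewrite -{3}(cat_take_drop j t) subseq_cat2r.
  by rewrite -(take_takel t (ltnW ij2)) take_subseq.
apply: (IH (take i t ++ drop j t)) => //.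
- rewrite -ltnS; apply: leq_trans szt; rewrite ltnS size_cat size_takel ?size_drop.
    by rewrite -[X in (_ < X)%N](subnKC (ltnW jt)) ltn_add2r.
  exact: ltnW (ltn_trans ij2 jt).
- by rewrite last_cat -lt -{3}(cat_take_drop j t) last_cat (drop_nth x jt).
- by apply: subseq_uniq ut; rewrite /= eqxx.
- by move=> z /(mem_subseq S) /sub.
Qed.

Definition simplicial W v := complete_set e [set u in W | e v u]%SET.

Lemma simplicial_far W w : decomposable e -> w \in W ->
  (exists2 u, u \in W & (u != w) && ~~ e w u) ->
  exists v, [/\ v \in W, v != w, ~~ e w v & simplicial W v].
Proof.
move=> dec; have [n] := ubnP #|W|; elim: n W w => // n IH W w szW wW [u0 u0W u0P].
have IH1 W' : (#|W'| < n)%N -> (exists u, u \in W') ->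
    exists2 v, v \in W' & simplicial W' v.
  move=> szW' [a aW'].
  case: (boolP [exists b in W', [exists c in W', (c != b) && ~~ e b c]]).
    case/exists_inP => b bW' /exists_inP[c cW' cb].
    by have [|v [vW _ _ vs]] := IH W' b szW' bW'; [exists c | exists v].
  move=> no; exists a => //; apply/complete_setP => p q.
  rewrite !inE => /andP[pW _] /andP[qW _] pq.
  apply: contraNT no => npq; apply/exists_inP; exists p => //.
  by apply/exists_inP; exists q => //; rewrite eq_sym pq.
pose U := [set u in W | (u != w) && ~~ e w u]%SET.
pose eU := [rel a b | [&& e a b, a \in U & b \in U]].
have eUs : connect_sym eU.
  by apply: sym_connect_sym => a b /=; rewrite e_sym [(a \in U) && _]andbC.
pose C := [set u | connect eU u0 u]%SET.
have u0U : u0 \in U by rewrite inE u0W.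
have CU : {subset C <= U}.
  move=> c; rewrite inE => /connectP[p + ->].
  elim/last_ind: p => [//|p z _]; rewrite rcons_path last_rcons /=.
  by case/and4P.
have CC a b : a \in C -> b \in U -> e a b -> b \in C.
  move=> aC bU eab; have := aC; rewrite !inE => h; apply: connect_trans h _.
  by apply: connect1; rewrite /= eab bU CU.
pose N := [set x in W | (x \notin C) && [exists c in C, e x c]]%SET.
have Nw x : x \in N -> e w x.
  rewrite inE => /and3P[xW xC /exists_inP[c cC exc]].
  have := CU c cC; rewrite inE => /and3P[_ cw ewc].
  have xw : x != w by apply: contraNneq ewc => <-.
  apply: contraNT xC => ewx; apply: (CC c) => //; last by rewrite e_sym.
  by rewrite inE xW xw.
(* Two nonadjacent vertices of [N] would be joined by a path through [C], contrary to
   [chordless_detour]. *)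
have Ncomp : complete_set e N.
  apply/complete_setP => x y xN yN xy; apply: contraT => nexy; exfalso.
  have := xN; rewrite inE => /and3P[xW xC /exists_inP[a aC exa]].
  have := yN; rewrite inE => /and3P[yW yC /exists_inP[b bC eyb]].
  have cab : connect eU a b.
    by apply: (connect_trans (y := u0)); [rewrite eUs|]; move: aC bC; rewrite !inE.
  case/connectP: cab => p0 /shortenP[p pp up _] bE.
  have pC : {subset a :: p <= C}.
    have : path eU a p by [].
    elim: (p) (a) aC => [|z q IHq] a' a'C /=.
      by move=> _ z; rewrite inE => /eqP ->.
    case/andP => /and3P[ea' _ zU] qq z'; rewrite inE => /orP[/eqP-> //|].
    by apply: IHq qq _; apply: CC ea'.
  apply: (@chordless_detour w x y C (a :: rcons p y)) => //.
  - exact: Nw.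
  - exact: Nw.
  - move=> c /CU; rewrite inE => /and3P[_ ? ?]; split => //.
  - rewrite /= rcons_path exa -bE e_sym eyb andbT.
    by apply: sub_path pp => p1 q1 /= /and3P[].
  - by rewrite /= last_rcons.
  - have ap : uniq (a :: rcons p y).
      rewrite -rcons_cons rcons_uniq up andbT.
      by apply: contra yC => /pC.
    rewrite cons_uniq ap andbT -rcons_cons mem_rcons inE negb_or xy /=.
    by apply: contra xC => /pC.
  - move=> z; rewrite -rcons_cons mem_rcons in_cons finset.in_setU1.
    by case/orP => [->|/pC ->] //; rewrite orbT.
pose W' := C :|: N.
have W'W : W' \proper W.
  apply/fintype.properP; split.
    apply/fintype.subsetP => z; rewrite !inE => /orP[zC|/andP[//]].
    by have : z \in U by [apply: CU; rewrite inE]; rewrite inE => /andP[].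
  exists w => //; rewrite finset.in_setU negb_or; apply/andP; split.
    by apply/negP => /CU; rewrite !inE eqxx /= andbF.
  by apply/negP => /Nw; rewrite e_irr.
have szW' : (#|W'| < n)%N by apply: leq_trans (proper_card W'W) _.
have nbr v z : v \in C -> z \in W -> e v z -> z \in W'.
  move=> vC zW evz; rewrite finset.in_setU; case: (boolP (z \in C)) => //= zC.
  by rewrite inE zW zC /=; apply/exists_inP; exists v => //; rewrite e_sym.
(* All neighbours in [W] of a vertex of [C] lie in [W']. *)
have conc v : v \in C -> simplicial W' v ->
    exists v, [/\ v \in W, v != w, ~~ e w v & simplicial W v].
  move=> vC vs; have := CU v vC; rewrite inE => /and3P[vW vw nwv].
  exists v; split => //; apply: complete_sub vs; apply/fintype.subsetP => z.
  rewrite finset.in_set => /andP[zW evz].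
  by rewrite finset.in_set evz andbT; apply: nbr evz.
(* A vertex obtained by induction that is not adjacent to [s] cannot lie in the complete set [N],
   hence lies in [C]. *)
case: (boolP [exists s in N, [exists r in W', (r != s) && ~~ e s r]]).
  case/exists_inP => s sN /exists_inP[r rW' rs].
  have sW' : s \in W' by rewrite finset.in_setU sN orbT.
  have [|v [vW' vs nsv vsimp]] := IH W' s szW' sW'; first by exists r.
  apply: (conc v) => //; move: vW'; rewrite finset.in_setU => /orP[//|vN].
  by case/negP: nsv; apply: (complete_setP Ncomp); rewrite // eq_sym.
move=> no.
(* Now each vertex of [N] is adjacent to all others of [W'], so a simplicial vertex of [C] is
   simplicial in [W']. *)
have all s r : s \in N -> r \in W' -> r != s -> e s r.
  move=> sN rW' rs; apply: contraNT no => nsr; apply/exists_inP; exists s => //.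
  by apply/exists_inP; exists r => //; rewrite rs.
have u0C : u0 \in C by rewrite inE connect0.
have szC : (#|C| < n)%N.
  apply: leq_ltn_trans szW'; apply: subset_leq_card; exact: finset.subsetUl.
have [v vC vs] : exists2 v, v \in C & simplicial C v by apply: IH1 => //; exists u0.
apply: (conc v) => //; apply/complete_setP => p q.
rewrite [p \in _]inE [q \in _]inE => /andP[pW' evp] /andP[qW' evq] pq.
case: (boolP (p \in N)) => pN; first by apply: all => //; rewrite eq_sym.
case: (boolP (q \in N)) => qN; first by rewrite e_sym; apply: all.
move: pW' qW'; rewrite !finset.in_setU (negPf pN) (negPf qN) !orbF => pC qC.
by apply: (complete_setP vs) => //; rewrite finset.in_set ?pC ?qC.
Qed.

Lemma simplicial_exists W : decomposable e -> (exists u, u \in W) ->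
  exists2 v, v \in W & simplicial W v.
Proof.
move=> dec [a aW].
case: (boolP [exists b in W, [exists c in W, (c != b) && ~~ e b c]]).
  case/exists_inP => b bW /exists_inP[c cW cb].
  by have [|v [vW _ _ vs]] := simplicial_far dec bW; [exists c | exists v].
move=> no; exists a => //; apply/complete_setP => p q.
rewrite !inE => /andP[pW _] /andP[qW _] pq.
apply: contraNT no => npq; apply/exists_inP; exists p => //.
by apply/exists_inP; exists q => //; rewrite eq_sym pq.
Qed.

Definition parents (rk : V -> nat) v := [set u | e v u && (rk u < rk v)%N]%SET.

(** The order of elimination is that of decreasing rank. *)
Definition perfect_elimination (rk : V -> nat) :=
  injective rk /\ forall v, complete_set e (parents rk v).

(** A simplicial vertex receives the largest rank; bounding the ranks by the cardinality leaves that
    rank free. *)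
Lemma decomposable_peo : decomposable e -> exists rk, perfect_elimination rk.
Proof.
move=> dec.
suff [rk [rki rkp _]] : exists rk : V -> nat, [/\ {in finset.setT &, injective rk},
    {in finset.setT, forall v, complete_set e [set u in finset.setT | e v u && (rk u < rk v)%N]%SET}
    & {in finset.setT, forall v, (rk v < #|[set: V]%SET|)%N}].
  exists rk; split=> [u v|v]; first by apply: rki; rewrite finset.in_setT.
  apply: complete_sub (rkp v (finset.in_setT v)).
  by apply/fintype.subsetP => u; rewrite !inE.
move: finset.setT => W; have [n] := ubnP #|W|.
elim: n W => // n IH W szW; have [->|[a aW]] := finset.set_0Vmem W.
  by exists (fun=> 0%N); split=> u; rewrite inE.
have [v vW vs] := simplicial_exists dec (ex_intro _ a aW).
have cW : #|W| = (#|W :\ v|).+1 by rewrite (finset.cardsD1 v) vW.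
have [|rk [rki rkp rkb]] := IH (W :\ v); first by rewrite -ltnS -cW.
exists (fun u => if u == v then #|W :\ v| else rk u); split.
- move=> x y xW yW; case: (eqVneq x v) (eqVneq y v) => [->|xv] [->|yv] // E.
  + by have := rkb y; rewrite !inE yv yW -E ltnn => /(_ isT).
  + by have := rkb x; rewrite !inE xv xW E ltnn => /(_ isT).
  + by apply: rki; rewrite // !inE ?xv ?yv.
- move=> x xW; case: (eqVneq x v) => [->|xv].
    apply: complete_sub vs; apply/fintype.subsetP => u; rewrite !inE.
    by case/and3P => -> ->.
  have xW' : x \in W :\ v by rewrite !inE xv.
  apply: complete_sub (rkp x xW'); apply/fintype.subsetP => u; rewrite !inE.
  case/and3P => uW exu; rewrite uW exu; case: (eqVneq u v) => //= _.
  by move=> /(ltn_trans (rkb x xW')); rewrite ltnn.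
- move=> x xW; rewrite cW; case: (eqVneq x v) => [_|xv]; first exact: ltnSn.
  by rewrite ltnS ltnW // rkb // !inE xv.
Qed.

(** Let [m] have the largest rank on a path ending below [v]. If [m] is [v], the first step leads to
    a parent. Otherwise the neighbours of [m] on the path are parents of [m], so they coincide or
    are adjacent, and [m] can be bypassed. *)
Lemma peo_path rk v p : perfect_elimination rk -> path e v p ->
  {in p, forall z, z \notin parents rk v} -> (rk v <= rk (last v p))%N.
Proof.
move=> [rki rkp]; have [n] := ubnP (size p); elim: n p => // n IH p szp pp pZ.
rewrite leqNgt; apply/negP => lt.
case: (@arg_maxnP _ v (fun z => z \in v :: p) rk (mem_head _ _)) => m mI mmax.
have lm : last v p != m.
  apply: contraTneq lt => ->; rewrite -leqNgt; exact: mmax (mem_head _ _).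
have below a : a \in v :: p -> e m a -> a \in parents rk m.
  move=> aI ema; rewrite inE ema ltn_neqAle /=; apply/andP; split; last exact: mmax aI.
  by apply: contraTneq ema => /rki ->; rewrite e_irr.
case: (eqVneq m v) => [mv|mv].
  case: p pp pZ lm below {szp mI mmax lt} => [|b p] /=; first by rewrite mv eqxx.
  case/andP => evb _ bZ _ below; have := bZ b (mem_head _ _).
  by rewrite -mv below // ?inE ?eqxx ?orbT // mv.
move: mI; rewrite inE (negPf mv) /= => mp.
case/splitPr: mp => p1 [|b p3] in szp pp pZ lt lm below mmax *.
  by rewrite last_cat /= eqxx in lm.
move: pp; rewrite cat_path /= => /and4P[pp1 eam emb pp3].
have aP : last v p1 \in parents rk m.
  apply: below; last by rewrite e_sym.
  by rewrite -cat_cons mem_cat mem_last.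
have bP : b \in parents rk m.
  by apply: below emb; rewrite inE mem_cat !inE eqxx !orbT.
rewrite ltnS in szp; have lb : (rk (last b p3) < rk v)%N by move: lt; rewrite last_cat.
have [ab|ab] := eqVneq (last v p1) b.
  suff: (rk v <= rk (last v (p1 ++ p3)))%N by rewrite last_cat ab leqNgt lb.
  apply: IH => [||z zI].
  - apply: leq_trans szp; rewrite !size_cat /= !addnS; exact: leqnSn.
  - by rewrite cat_path pp1 ab pp3.
  - by apply: pZ; move: zI; rewrite !mem_cat !inE => /orP[->|->]; rewrite ?orbT.
suff: (rk v <= rk (last v (p1 ++ b :: p3)))%N by rewrite last_cat leqNgt lb.
apply: IH => [||z zI].
- by apply: leq_trans szp; rewrite !size_cat /= !addnS.
- by rewrite cat_path pp1 /= pp3 (complete_setP (rkp m)).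
- by apply: pZ; move: zI; rewrite !mem_cat !inE => /or3P[->|->|->]; rewrite ?orbT.
Qed.

(** The set [Y] is the component of [v] once its parents are removed; by [peo_path] it contains no
    earlier vertex. *)
Lemma peo_separation rk v : perfect_elimination rk ->
  exists X Y : {set V}, [/\ global_separation e X Y (parents rk v), v \in Y
    & forall u, (rk u < rk v)%N -> u \notin Y].
Proof.
move=> peo; set Z := parents rk v.
pose eZ := [rel a b | [&& e a b, a \notin Z & b \notin Z]].
have eZs : connect_sym eZ.
  by apply: sym_connect_sym => a b /=; rewrite e_sym [(a \notin Z) && _]andbC.
have vZ : v \notin Z by rewrite inE ltnn andbF.
pose Y := [set u | connect eZ v u]%SET.
have YZ u : u \in Y -> u \notin Z.
  rewrite inE => /connectP[p + ->]; elim/last_ind: p => [//|p z _].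
  by rewrite rcons_path last_rcons /= => /and4P[].
exists (~: (Y :|: Z)), Y; split.
- split.
  + rewrite -finset.setI_eq0; apply/eqP/finset.setP => u.
    rewrite finset.in_setI finset.in_setC finset.in_setU finset.in_set0.
    by case: (u \in Y); rewrite ?andbF.
  + rewrite -finset.setI_eq0; apply/eqP/finset.setP => u.
    rewrite finset.in_setI finset.in_setC finset.in_setU finset.in_set0.
    by case: (u \in Z); rewrite ?orbT ?andbF.
  + rewrite finset.disjoints_subset; apply/fintype.subsetP => u /YZ.
    by rewrite finset.in_setC.
  + move=> u; rewrite !(finset.in_setC, finset.in_setU).
    by case: (u \in Y); case: (u \in Z).
  + move=> x y p xX yY pp lp.
    case: (boolP (has (mem Z) (x :: p))) => [/hasP[z ? ?]|no]; first by exists z.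
    have cxy : connect eZ x y.
      apply/connectP; exists p => //; move: pp no; elim: p x {xX lp} => //= b p IH x.
      case/andP => exb pp; rewrite !negb_or => /and3P[xZ bZ pZ].
      by rewrite exb xZ bZ /= IH //= negb_or bZ.
    have xY : x \in Y.
      by rewrite inE; rewrite inE in yY; apply: connect_trans yY _; rewrite eZs.
    by move: xX; rewrite finset.in_setC finset.in_setU xY.
- by rewrite inE connect0.
- move=> u uv; apply/negP; rewrite inE => /connectP[p pp uE].
  have : (rk v <= rk (last v p))%N; last by rewrite -uE leqNgt uv.
  apply: peo_path => //; first by apply: sub_path pp => a b /= /and3P[].
  rewrite -/Z; elim: (p) (v) pp => //= b q IH a /andP[/and3P[_ _ bZ] qq] z.
  by rewrite inE => /orP[/eqP->|] //; apply: IH qq z.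
Qed.

End PerfectElimination.

(** * Toric ideals and separation binomials *)

Section Monomials.
Variables (R : realType) (M : finType).
Implicit Types (u w : M -> nat) (P : M -> R) (x y : M) (m : multinom #|M|).

(** [monomial] and [expo] translate between exponents indexed by [M] and those indexed by
    ordinals. *)
Definition monomial u : multinom #|M| := Multinom [tuple u (enum_val i) | i < #|M|].

Definition expo m x : nat := m (enum_rank x).

Lemma monomialK u : expo (monomial u) =1 u.
Proof. by move=> x; rewrite /expo mnmE enum_rankK. Qed.

Lemma expo_inj m1 m2 : expo m1 =1 expo m2 -> m1 = m2.
Proof.
by move=> h; apply/mnmP => i; have := h (enum_val i); rewrite /expo enum_valK.
Qed.

Lemma expoD m1 m2 x : expo (mnm_add m1 m2) x = (expo m1 x + expo m2 x)%N.
Proof. exact: mnmDE. Qed.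

Lemma expoU x y : expo (mnm1 (enum_rank x)) y = (x == y).
Proof. by rewrite /expo mnm1E (inj_eq enum_rank_inj). Qed.

Lemma sum_enum_rank (S : nmodType) (F : 'I_#|M| -> S) :
  \sum_i F i = \sum_x F (enum_rank x).
Proof. by rewrite (reindex (@enum_rank M)) //; exact/onW_bij/enum_rank_bij. Qed.

Lemma prod_enum_rank (S : comNzRingType) (F : 'I_#|M| -> S) :
  \prod_i F i = \prod_x F (enum_rank x).
Proof. by rewrite (reindex (@enum_rank M)) //; exact/onW_bij/enum_rank_bij. Qed.

Lemma mpolyX_expo m : mpolyX R m = \prod_x indet R x ^+ expo m x.
Proof. by rewrite mpolyXE_id prod_enum_rank. Qed.

Lemma prod_indet u : \prod_x indet R x ^+ u x = mpolyX R (monomial u).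
Proof. by rewrite mpolyX_expo; apply: eq_bigr => x _; rewrite monomialK. Qed.

Lemma eval_indet P x : eval_at P (indet R x) = P x.
Proof. by rewrite /eval_at mevalXU enum_rankK. Qed.

Lemma eval_monomial P u :
  eval_at P (\prod_x indet R x ^+ u x) = \prod_x P x ^+ u x.
Proof.
rewrite /eval_at rmorph_prod; apply: eq_bigr => x _.
by rewrite rmorphXn /= -/(eval_at P _) eval_indet.
Qed.

Definition quadric a b : multinom #|M| :=
  mnm_add (mnm1 (enum_rank a)) (mnm1 (enum_rank b)).

Lemma indetM a b : indet R a * indet R b = mpolyX R (quadric a b).
Proof. by rewrite mpolyXD. Qed.

Lemma expo_quadric a b x : expo (quadric a b) x = ((a == x) + (b == x))%N.
Proof. by rewrite expoD !expoU. Qed.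

End Monomials.

Section Toric.
Variables (R : realType) (D M : finType) (A : D -> M -> nat).
Implicit Types (u w : M -> nat) (P : M -> R) (i : D) (m : multinom #|M|).

Definition row_sum u i : nat := (\sum_x A i x * u x)%N.

Definition congruent u w := forall i, row_sum u i = row_sum w i.

Lemma toric_binomial u w : congruent u w ->
  toric_ideal R A (\prod_x indet R x ^+ u x - \prod_x indet R x ^+ w x).
Proof.
move=> uw; exists 1%N, (fun=> 1), (fun=> \prod_x indet R x ^+ u x - \prod_x indet R x ^+ w x).
by split=> [_|]; [exists u, w | rewrite big_ord1 mul1r].
Qed.

(** Vanishing on the ideal is tested on its generating binomials. *)
Lemma toric_varietyP P : toric_variety A P <->
  (forall x, 0 <= P x) /\
  (forall u w, congruent u w -> \prod_x P x ^+ u x = \prod_x P x ^+ w x).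
Proof.
split=> -[P0 h]; split=> //.
  move=> u w /toric_binomial/h.
  rewrite /eval_at rmorphB /= -!/(eval_at P _) !eval_monomial => /eqP.
  by rewrite subr_eq0 => /eqP.
move=> f [k [g [b [bS ->]]]]; rewrite /eval_at rmorph_sum big1 //= => i _.
have [u [w [uw ->]]] := bS i.
by rewrite rmorphM rmorphB /= -!/(eval_at P _) !eval_monomial (h _ _ uw) subrr mulr0.
Qed.

Lemma prod_phi (S : comNzRingType) (t : D -> S) u :
  \prod_x (\prod_i t i ^+ A i x) ^+ u x = \prod_i t i ^+ row_sum u i.
Proof.
under eq_bigr do rewrite -prodrXl.
rewrite exchange_big /=; apply: eq_bigr => i _.
by rewrite -prodrXr; apply: eq_bigr => x _; rewrite exprM.
Qed.

Lemma image_toric P : image_phi R A P -> toric_variety A P.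
Proof.
move=> [t t0 <-]; apply/toric_varietyP; split=> [x|u w uw].
  by apply: prodr_ge0 => i _; rewrite exprn_ge0 //; exact: t0.
by rewrite /phi !prod_phi; apply: eq_bigr => i _; rewrite uw.
Qed.

Definition degree_monomial m : multinom #|D| := monomial (row_sum (expo m)).

(* Substituting the monomial [\prod_i t_i ^+ A i x] for [p_x] kills the toric ideal. *)
Lemma toric_ideal_fiber f m : toric_ideal R A f ->
  \sum_(m' <- msupp f | degree_monomial m' == degree_monomial m) mcoeff m' f = 0.
Proof.
pose h (x : 'I_#|M|) : mpoly #|D| R := \prod_i indet R i ^+ A i (enum_val x).
pose Psi (f : mpoly #|M| R) : mpoly #|D| R := mmap (@mpolyC #|D| R) h f.
have PsiX m' : Psi (mpolyX R m') = mpolyX R (degree_monomial m').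
  rewrite /Psi mmapX /mmap1 prod_enum_rank -prod_indet -prod_phi.
  by apply: eq_bigr => x _; rewrite /h enum_rankK.
have PsiE f' : Psi f' = \sum_(m' <- msupp f') mcoeff m' f' *: mpolyX R (degree_monomial m').
  by rewrite {1}/Psi /mmap; apply: eq_bigr => m' _; rewrite mul_mpolyC -PsiX /Psi mmapX.
move=> [k [g [b [bS fE]]]].
have : Psi f = 0.
  rewrite fE /Psi rmorph_sum big1 //= => i _.
  have [u [w [uw ->]]] := bS i.
  rewrite rmorphM rmorphB /= !prod_indet -!/(Psi _) !PsiX /degree_monomial.
  suff -> : monomial (row_sum (expo (monomial u))) = monomial (row_sum (expo (monomial w))).
    by rewrite subrr mulr0.
  apply: expo_inj => j; rewrite !monomialK; have := uw j.
  by congr (_ = _); apply: eq_bigr => x _; rewrite monomialK.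
move=> /(congr1 (mcoeff (degree_monomial m))).
rewrite PsiE raddf_sum /= mcoeff0 => E; rewrite -[RHS]E [LHS]big_mkcond.
apply: eq_bigr => m' _; rewrite mcoeffZ mcoeffX.
by case: ifP; rewrite ?mulr1 ?mulr0.
Qed.

Lemma degree_monomialP m m' :
  reflect (congruent (expo m) (expo m')) (degree_monomial m == degree_monomial m').
Proof.
apply: (iffP eqP) => [E i|E]; last by apply: expo_inj => i; rewrite !monomialK E.
by have := congr1 (@expo D ^~ i) E; rewrite !monomialK.
Qed.

End Toric.

Section Separation.
Variables (R : realType) (V : finType) (e : rel V) (I : V -> finType).
Implicit Types (a b x : cell I) (X Y Z C : {set V}) (u w : cell I -> nat).

Lemma row_sum_design u i : row_sum (design I e) u i = \sum_x u x *+ design I e i x.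
Proof.
apply: eq_bigr => x _; rewrite mulnC.
by elim: (design I e i x) => [|n IH]; rewrite ?muln0 // mulnS mulrS IH.
Qed.

Lemma congruentP u w : congruent (design I e) u w <->
  (forall C, clique e C -> forall x, marg u C x = marg w C x).
Proof.
split=> [h|h i]; last by rewrite !row_sum_design; exact: eq_sum_design.
by apply: eq_marg_design => i; rewrite -!row_sum_design.
Qed.

Lemma separated_edge X Y Z (v w : V) : global_separation e X Y Z ->
  v \in X -> w \in Y -> e v w = false.
Proof.
case=> _ XZ YZ _ sep vX wY; apply/negP => evw.
have [|z] := sep v w [:: w] vX wY _ erefl; first by rewrite /= evw.
by rewrite !inE => /orP[]/eqP ->; rewrite ?(disjointFr XZ vX) ?(disjointFr YZ wY).
Qed.

Lemma complete_separated X Y Z C : global_separation e X Y Z -> complete_set e C ->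
  [disjoint C & X] \/ [disjoint C & Y].
Proof.
move=> sep /complete_setP Cc; case: (boolP [disjoint C & X]) => [|/pred0Pn[v]]; first by left.
case/andP => /= vC vX; right; apply/pred0P => w /=; apply/negP => /andP[wC wY].
have := separated_edge sep vX wY; rewrite Cc //; apply: contraTneq wY => <-.
by case: sep => d _ _ _ _; rewrite (disjointFr d vX).
Qed.

Lemma mix_agree_other X Y Z C a b : global_separation e X Y Z -> agree Z a b ->
  [disjoint C & X] -> agree C (mix Y a b) b.
Proof.
case=> _ _ _ cov _ /agreeP Zab dis; apply: agree_mixr => v vC vY.
apply: Zab; have := cov v; rewrite !finset.in_setU (negPf vY) orbF.
by rewrite (disjointFr dis vC).
Qed.

(** A complete set misses [X] or [Y], so on it the exchanged cells agree with [a] and [b] in one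
    order or the other. *)
Lemma mix_agree_count X Y Z C a b x : global_separation e X Y Z -> agree Z a b ->
  complete_set e C ->
  (agree C a x + agree C b x = agree C (mix Y b a) x + agree C (mix Y a b) x)%N.
Proof.
move=> sep Zab /(complete_separated sep)[dis|dis].
  have Zba : agree Z b a by rewrite agree_sym.
  by rewrite (agree_eql x (mix_agree_other sep Zba dis))
    (agree_eql x (mix_agree_other sep Zab dis)).
by rewrite addnC (agree_eql x (agree_mixl b a dis)) (agree_eql x (agree_mixl a b dis)).
Qed.

Lemma marg_quadric C a b x :
  marg (expo (quadric a b)) C x = (agree C a x + agree C b x)%N.
Proof.
have sum1 c : (\sum_(y | agree C y x) (c == y))%N = agree C c x.
  case: (boolP (agree C c x)) => cx.
    by rewrite (bigD1 c) //= eqxx big1 // => y /andP[_ /negPf]; rewrite eq_sym => ->.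
  by rewrite big1 // => y yx; case: eqP => // cy; rewrite cy yx in cx.
rewrite /marg; under eq_bigr do rewrite expo_quadric.
by rewrite big_split /= -!sum1.
Qed.

Lemma congruent_quadric X Y Z a b : global_separation e X Y Z -> agree Z a b ->
  congruent (design I e) (expo (quadric a b)) (expo (quadric (mix Y b a) (mix Y a b))).
Proof.
move=> sep Zab; apply/congruentP => C /maxsetp cC x.
by rewrite !marg_quadric (mix_agree_count x sep Zab cC).
Qed.

(** Since [X], [Y] and [Z] cover all vertices, the cells [a] and [b] determine the other two by
    exchange of their [Y]-coordinates. *)
Lemma separation_binomialP (f : mpoly #|cell I| R) : separation_binomial e f <->
  exists X Y Z a b, [/\ global_separation e X Y Z, agree Z a b,
     (exists2 v, v \in X & a v != b v), (exists2 v, v \in Y & a v != b v) &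
     f = indet R a * indet R b - indet R (mix Y b a) * indet R (mix Y a b)].
Proof.
have projN C a b : proj C a != proj C b <-> exists2 v, v \in C & a v != b v.
  rewrite eq_proj; split=> [/forall_inPn //|[v vC ab]].
  by apply/forall_inPn; exists v.
split=> [[X [Y [Z [sep [x [x' [y [y' [z [a [b [c [d [xx' yy' [aE bE] [cE dE] ->]]]]]]]]]]]]]]|].
  exists X, Y, Z, a, b; move: aE bE cE dE xx' yy'.
  move=> [<- <- <-] [<- <- /eqP zE] [/eqP cX /eqP cY /eqP cZ] [/eqP dX /eqP dY /eqP dZ].
  move=> /projN xx' /projN yy'; split=> //.
    by rewrite agree_sym -eq_proj.
  move: zE cX cY cZ dX dY dZ; rewrite !eq_proj.
  move=> /agreeP bZ /agreeP cX /agreeP cY /agreeP cZ /agreeP dX /agreeP dY /agreeP dZ.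
  case: sep => XY _ YZ cov _.
  congr (_ - indet R _ * indet R _); apply/ffunP => v; rewrite mixE; have := cov v;
    rewrite !finset.in_setU; case: ifPn => [vY _|vY]; rewrite ?orbF.
  + by rewrite cY.
  + by case/orP => [vX|vZ]; [rewrite cX | rewrite cZ // bZ].
  + by rewrite dY.
  + by case/orP => [vX|vZ]; [rewrite dX | rewrite dZ].
case=> X [Y [Z [a [b [sep Zab Xab Yab ->]]]]]; exists X, Y, Z; split=> //.
exists (proj X a), (proj X b), (proj Y a), (proj Y b), (proj Z a), a, b, (mix Y b a), (mix Y a b).
case: (sep) => XY _ YZ cov _.
split; rewrite ?projN //.
  by split; split=> //; apply/eqP; rewrite eq_proj // agree_sym.
split; split; apply/eqP; rewrite eq_proj.
- by apply: agree_mixl.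
- by apply: agree_mixr => v ->.
- apply: agree_trans (agree_mixl _ _ _) _; last by rewrite agree_sym.
  by rewrite disjoint_sym.
- by apply: agree_mixl.
- by apply: agree_mixr => v ->.
- by apply: agree_mixl; rewrite disjoint_sym.
Qed.

End Separation.

Lemma separation_toric (R : realType) (V : finType) (e : rel V) (I : V -> finType)
    (f : mpoly #|cell I| R) :
  separation_binomial e f -> toric_ideal R (design I e) f.
Proof.
move=> /separation_binomialP[X [Y [Z [a [b [sep Zab _ _ ->]]]]]].
rewrite !indetM !mpolyX_expo; apply: toric_binomial; exact: (congruent_quadric sep).
Qed.

(** * Markov distributions factor *)

Section Markov.
Variables (R : realType) (V : finType) (e : rel V) (I : V -> finType).
Hypotheses (e_sym : symmetric e) (e_irr : irreflexive e).
Implicit Types (a b x : cell I) (X Y Z C H K : {set V}) (P : cell I -> R).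
Implicit Types (rk : V -> nat).

Definition markov P := forall f, separation_binomial e f -> eval_at P f = 0.

(** The binomials concern cells that differ on both [X] and [Y]; if they agree on one of these, the
    exchange returns the same pair. *)
Lemma markov_mix P X Y Z a b : markov P -> global_separation e X Y Z -> agree Z a b ->
  P a * P b = P (mix Y a b) * P (mix Y b a).
Proof.
move=> mP sep Zab; rewrite [RHS]mulrC.
case: (sep) => XY _ YZ cov _.
have Zeq v : v \in Z -> a v = b v by move/agreeP: Zab; apply.
have [Xab|/forall_inPn Xab] := boolP (agree X a b).
  have -> : mix Y b a = a.
    apply/ffunP => v; rewrite mixE; case: ifPn => // vY; have := cov v.
    rewrite !finset.in_setU (negPf vY) orbF => /orP[vX|/Zeq //].
    by rewrite (agreeP Xab).
  have -> // : mix Y a b = b.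
    apply/ffunP => v; rewrite mixE; case: ifPn => // vY; have := cov v.
    rewrite !finset.in_setU (negPf vY) orbF => /orP[vX|/Zeq //].
    by rewrite (agreeP Xab).
have [Yab|/forall_inPn Yab] := boolP (agree Y a b).
  have -> : mix Y b a = b.
    by apply/ffunP => v; rewrite mixE; case: ifPn => // /(agreeP Yab) ->.
  have -> : mix Y a b = a; last by rewrite mulrC.
  by apply/ffunP => v; rewrite mixE; case: ifPn => // /(agreeP Yab) ->.
have := mP (indet R a * indet R b - indet R (mix Y b a) * indet R (mix Y a b)).
rewrite /eval_at rmorphB !rmorphM /= -!/(eval_at P _) !eval_indet => E.
apply/eqP; rewrite -subr_eq0 E //; apply/separation_binomialP.
by exists X, Y, Z, a, b.
Qed.

(** Exchanging [Y]-coordinates is an involution on pairs of cells; it carries the pairs on one side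
    to those on the other, with equal terms by [markov_mix]. *)
Lemma markov_marg P X Y Z H K x : markov P -> global_separation e X Y Z ->
  [disjoint H & Y] -> Z \subset H -> K \subset Y :|: Z -> Z \subset K ->
  marg P (H :|: K) x * marg P Z x = marg P H x * marg P K x.
Proof.
move=> mP sep HY ZH KYZ ZK; rewrite /marg !big_distrlr /= !pair_big /=.
case: (sep) => _ _ YZ _ _.
have ZY : [disjoint Z & Y] by rewrite disjoint_sym.
rewrite (reindex_onto (fun p => (mix Y p.1 p.2, mix Y p.2 p.1))
                      (fun p => (mix Y p.1 p.2, mix Y p.2 p.1))) /=; last first.
  by move=> [a b] _ /=; rewrite !mixK.
have mixH a b : agree H (mix Y a b) x = agree H a x.
  exact: agree_eql (agree_mixl _ _ HY).
have mixZ a b : agree Z (mix Y a b) x = agree Z a x.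
  exact: agree_eql (agree_mixl _ _ ZY).
have mixKr a b : agree Z a x -> agree Z b x -> agree K (mix Y a b) x = agree K b x.
  move=> aZ bZ; apply: agree_eql; apply: agree_mixr => v vK vY.
  have vZ : v \in Z by move/fintype.subsetP: KYZ => /(_ v vK); rewrite finset.in_setU (negPf vY).
  by rewrite (agreeP aZ) ?(agreeP bZ).
have sub C (D : {set V}) a : D \subset C -> agree C a x -> agree D a x by exact: agree_sub.
apply: eq_big => [[a b] /=|[a b] /=]; rewrite !mixK eqxx andbT.
  rewrite agreeU mixH mixZ; apply/andP/andP => -[].
    case/andP => aH aK bZ; split=> //; rewrite -(mixKr a b) //; exact: sub aH.
  move=> aH bK; have aZ := sub _ _ _ ZH aH; have bZ := sub _ _ _ ZK bK.
  by rewrite aH mixKr.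
rewrite agreeU mixH mixZ => /andP[/andP[aH _] bZ].
rewrite [RHS](markov_mix mP sep) //; apply: agree_trans (sub _ _ _ ZH aH) _.
by rewrite agree_sym.
Qed.

Definition below (rk : V -> nat) n : {set V} := [set u | (rk u < n)%N]%SET.

Definition family (rk : V -> nat) v : {set V} := v |: parents e rk v.

Lemma belowS rk v : injective rk -> below rk (rk v).+1 = v |: below rk (rk v).
Proof.
move=> rki; apply/finset.setP => u.
by rewrite !inE ltnS leq_eqVlt (inj_eq rki).
Qed.

Lemma belowS_none rk n : (forall v, rk v != n) -> below rk n.+1 = below rk n.
Proof.
by move=> no; apply/finset.setP => u; rewrite !inE ltnS leq_eqVlt (negPf (no u)).
Qed.

Lemma below0 rk : below rk 0 = finset.set0.
Proof. by apply/finset.setP => u; rewrite !inE. Qed.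

Definition rank_bound (rk : V -> nat) : nat := (\max_v rk v).+1.

Lemma below_all rk : below rk (rank_bound rk) = finset.setT.
Proof. by apply/finset.setP => u; rewrite !inE ltnS leq_bigmax. Qed.

Lemma parents_below rk v : parents e rk v \subset below rk (rk v).
Proof. by apply/fintype.subsetP => u; rewrite !inE => /andP[]. Qed.

Lemma family_complete rk v : perfect_elimination e rk ->
  complete_set e (family rk v).
Proof.
move=> [_ rkp]; apply/complete_setP => x y; rewrite /family !finset.in_setU1.
move=> /predU1P[->|xv] /predU1P[->|yv] xy.
- by rewrite eqxx in xy.
- by move: yv; rewrite inE => /andP[].
- by move: xv; rewrite inE e_sym => /andP[].
- exact: (complete_setP (rkp v)).
Qed.

(** Ranks need not be consecutive, hence the separate step for numbers that are no rank. *)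
Lemma below_ind rk (T : nat -> Prop) : injective rk -> T 0%N ->
  (forall v, T (rk v) -> T (rk v).+1) ->
  (forall n, (forall v, rk v != n) -> T n -> T n.+1) -> forall n, T n.
Proof.
move=> rki T0 Tv Tn; elim=> // n Th.
case: (pickP (fun v => rk v == n)) => [v /eqP nE|no]; last by apply: Tn => // v; rewrite no.
by rewrite -nE; apply: Tv; rewrite nE.
Qed.

(** Conditional independence of [v] from the other earlier vertices given its parents, written
    without division. *)
Lemma markov_step P rk v x : markov P -> perfect_elimination e rk ->
  marg P (below rk (rk v).+1) x * marg P (parents e rk v) x =
  marg P (below rk (rk v)) x * marg P (family rk v) x.
Proof.
move=> mP peo; have [X [Y [sep vY below_Y]]] := peo_separation e_sym e_irr v peo.
have -> : below rk (rk v).+1 = below rk (rk v) :|: family rk v.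
  rewrite belowS; last by case: peo.
  rewrite /family finset.setUCA; congr (_ :|: _); apply/esym/finset.setUidPl.
  exact: parents_below.
apply: (markov_marg _ mP sep).
- rewrite -finset.setI_eq0; apply/eqP/finset.setP => u; rewrite !inE.
  by apply/andP => -[/below_Y/negPf ->].
- exact: parents_below.
- by rewrite /family finset.setSU // finset.sub1set.
- exact: finset.subsetUr.
Qed.

Lemma marg_ge0 P C x : (forall y, 0 <= P y) -> 0 <= marg P C x.
Proof. by move=> P0; apply: sumr_ge0. Qed.

Lemma marg_eq0_sub P C H x : (forall y, 0 <= P y) -> C \subset H ->
  marg P C x = 0 -> marg P H x = 0.
Proof.
move=> P0 sCH /eqP; rewrite psumr_eq0 // => /allP h.
apply: big1 => y /(agree_sub sCH) yC; apply/eqP.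
by have /implyP := h y (mem_index_enum _); apply.
Qed.

Lemma prod_belowS rk (F : V -> R) v : injective rk ->
  \prod_(u | (rk u < (rk v).+1)%N) F u = F v * \prod_(u | (rk u < rk v)%N) F u.
Proof.
move=> rki; rewrite (bigD1 v) //=; congr (_ * _); apply: eq_bigl => u.
by rewrite ltnS leq_eqVlt (inj_eq rki) andbC; case: eqP => // ->; rewrite ltnn.
Qed.

Lemma prod_belowS_none rk (F : V -> R) n : (forall v, rk v != n) ->
  \prod_(u | (rk u < n.+1)%N) F u = \prod_(u | (rk u < n)%N) F u.
Proof. by move=> no; apply: eq_bigl => u; rewrite ltnS leq_eqVlt (negPf (no u)). Qed.

(* Where the margin on the parents vanishes, so does the cell; the junk value
   [_ / 0 = 0] then makes the formula correct. *)
Lemma markov_product P rk x : (forall y, 0 <= P y) -> markov P ->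
  perfect_elimination e rk ->
  P x = (\sum_y P y) * \prod_v (marg P (family rk v) x / marg P (parents e rk v) x).
Proof.
move=> P0 mP peo; have [rki _] := peo.
pose F v := marg P (family rk v) x / marg P (parents e rk v) x.
suff H n : marg P (below rk n) x = (\sum_y P y) * \prod_(v | (rk v < n)%N) F v.
  rewrite -[LHS](margT P) -(below_all rk) H; congr (_ * _); apply: eq_bigl => v.
  by rewrite ltnS leq_bigmax.
move: n; apply: (below_ind rki) => [|v IH|n no IH].
- by rewrite below0 marg0 big_pred0 ?mulr1.
- rewrite prod_belowS // mulrCA -IH /F.
  have [pa0|pa0] := eqVneq (marg P (parents e rk v) x) 0.
    rewrite pa0 invr0 mulr0 mul0r; apply: marg_eq0_sub P0 _ pa0.
    by apply: fintype.subset_trans (parents_below _ _) _; rewrite belowS // finset.subsetUr.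
  by rewrite mulrAC [_ * marg P (below _ _) _]mulrC -markov_step // mulfK.
- by rewrite belowS_none // prod_belowS_none.
Qed.

Lemma markov_factors P : decomposable e -> (forall y, 0 <= P y) -> markov P ->
  factors e P.
Proof.
move=> /(decomposable_peo e_sym e_irr)[rk peo] P0 mP.
have -> : P = fun x => (\sum_y P y) *
    \prod_v (marg P (family rk v) x / marg P (parents e rk v) x).
  by apply/boolp.funext => x; exact: markov_product.
(* The total mass is a potential on the empty set, each quotient one on the family of [v]. *)
apply: factorsM.
  apply: (@factors_potential _ _ _ _ finset.set0) => //; first exact: complete0.
  by move=> _; exact: sumr_ge0.
apply: factors_prod => v _; apply: (factors_potential (family_complete v peo)).
  by move=> x; rewrite divr_ge0 // marg_ge0.
move=> x y xy; rewrite (eq_marg _ xy) (@eq_marg _ _ _ _ (parents e rk v) x y) //.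
by apply: agree_sub xy; exact: finset.subsetUr.
Qed.

Lemma factors_markov P : factors e P -> markov P.
Proof.
by move=> /image_toric[_ h] f /separation_toric; exact: h.
Qed.

Lemma factorsP P : decomposable e ->
  factors e P <-> (forall y, 0 <= P y) /\ markov P.
Proof.
move=> dec; split=> [fP|[]]; last exact: markov_factors.
by split; [exact: factors_ge0 fP | exact: factors_markov].
Qed.

End Markov.

(** * Closedness of decomposable models *)

Section Closedness.
Local Open Scope classical_set_scope.
Local Open Scope ring_scope.
Variables (R : realType) (V : finType) (e : rel V) (I : V -> finType).
Hypotheses (e_sym : symmetric e) (e_irr : irreflexive e).

Lemma eval_cell_continuous (a : cell I) :
  continuous (fun P : {ptws cell I -> R} => P a).
Proof. exact: (@proj_continuous (cell I) (fun=> R) a). Qed.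

Lemma decomposable_closed : decomposable e ->
  closed (image_phi R (design I e) : set {ptws cell I -> R}).
Proof.
move=> dec.
have -> : (image_phi R (design I e) : set {ptws cell I -> R}) =
    (\bigcap_(a in [set: cell I]) [set P : {ptws cell I -> R} | 0 <= P a]) `&`
    (\bigcap_(f in [set f | @separation_binomial R V e I f])
       [set P : {ptws cell I -> R} | eval_at P f = 0]).
  apply/seteqP; split=> P.
    by move/(factorsP e_sym e_irr _ dec) => [P0 mP]; split=> [a _|f fS]; [exact: P0|exact: mP].
  move=> [P0 mP]; apply/(factorsP e_sym e_irr _ dec); split=> [a|f fS].
    exact: P0.
  exact: mP.
apply: closedI.
  apply: closed_bigI => a _.
  apply: (@preimage_closed _ _ (fun P : {ptws cell I -> R} => P a) [set y | 0 <= y]).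
    by move=> P _; exact: eval_cell_continuous.
  exact: closed_ge.
apply: closed_bigI => f /separation_binomialP[X [Y [Z [a [b [_ _ _ _ ->]]]]]].
pose g (P : {ptws cell I -> R}) := P a * P b - P (mix Y b a) * P (mix Y a b).
have -> : [set P : {ptws cell I -> R} | eval_at P (indet R a * indet R b -
    indet R (mix Y b a) * indet R (mix Y a b)) = 0] = g @^-1` [set y | y = 0].
  apply/seteqP; split=> P /=; rewrite /eval_at rmorphB !rmorphM /= -!/(eval_at P _) !eval_indet //.
apply: preimage_closed; last exact: closed_eq.
have cM c d (P : {ptws cell I -> R}) : (fun Q : {ptws cell I -> R} => Q c * Q d) @ P --> P c * P d.
  exact: (cvgM (@eval_cell_continuous c P) (@eval_cell_continuous d P)).
move=> P _; exact: (cvgB (cM a b P) (cM (mix Y b a) (mix Y a b) P)).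
Qed.

End Closedness.

(** * Standard monomials of a perfect elimination ordering *)

Section RevLex.
Variables (M : finType) (rho : M -> nat).
Hypothesis rho_inj : injective rho.
Implicit Types (m : multinom #|M|) (x : M).

(** Cells of smaller [rho] are the smaller variables; at the least one where the exponents differ,
    the larger exponent gives the smaller monomial. *)
Definition revlex_lt m1 m2 := [exists x, (expo m2 x < expo m1 x)%N &&
  [forall y, (rho y < rho x)%N ==> (expo m1 y == expo m2 y)]].

Definition degrevlex m1 m2 := (mdeg m1 < mdeg m2)%N ||
  ((mdeg m1 == mdeg m2) && ((m1 == m2) || revlex_lt m1 m2)).

Lemma revlex_ltP m1 m2 : reflect (exists2 x, (expo m2 x < expo m1 x)%N &
    forall y, (rho y < rho x)%N -> expo m1 y = expo m2 y) (revlex_lt m1 m2).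
Proof.
apply: (iffP existsP) => [[x /andP[lt /forallP h]]|[x lt h]]; exists x => //.
  by move=> y yx; apply/eqP; have /implyP := h y; apply.
by rewrite lt; apply/forallP => y; apply/implyP => /h ->.
Qed.

Lemma revlex_lt_trans : transitive revlex_lt.
Proof.
move=> m2 m1 m3 /revlex_ltP[x x21 hx] /revlex_ltP[y y32 hy]; apply/revlex_ltP.
case: (ltngtP (rho x) (rho y)) => [xy|yx|/rho_inj xy].
- exists x => [|z zx]; first by rewrite -(hy x xy).
  by rewrite hx // hy // (ltn_trans zx).
- exists y => [|z zy]; first by rewrite (hx y yx).
  by rewrite hx ?hy // (ltn_trans zy).
- exists x => [|z zx]; first by apply: ltn_trans x21; rewrite xy.
  by rewrite hx // hy // -xy.
Qed.

Lemma revlex_ltxx m : revlex_lt m m = false.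
Proof. by apply/negbTE/negP; case/revlex_ltP => x; rewrite ltnn. Qed.

Lemma revlex_lt_total m1 m2 : m1 != m2 -> revlex_lt m1 m2 || revlex_lt m2 m1.
Proof.
move=> m12; have [x0 x0P] : exists x, expo m1 x != expo m2 x.
  apply/existsP; apply: contraR m12 => /existsPn h; apply/eqP/expo_inj => x.
  by apply/eqP; have := h x; rewrite negbK.
case: (@arg_minnP _ x0 (fun x => expo m1 x != expo m2 x) rho x0P) => x xP xmin.
have eq_below y : (rho y < rho x)%N -> expo m1 y = expo m2 y.
  by move=> yx; apply/eqP; apply: contraTT yx => /xmin; rewrite -leqNgt.
move: xP; rewrite neq_ltn => /orP[lt|lt]; apply/orP; [right|left];
  by apply/revlex_ltP; exists x => // y /eq_below.
Qed.

Lemma revlex_ltD m m1 m2 : revlex_lt m1 m2 -> revlex_lt (mnm_add m1 m) (mnm_add m2 m).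
Proof.
move=> /revlex_ltP[x lt h]; apply/revlex_ltP; exists x => [|y /h E].
  by rewrite !expoD ltn_add2r.
by rewrite !expoD E.
Qed.

Lemma degrevlex_order : term_order degrevlex.
Proof.
split; last split; first split.
- by move=> m; rewrite /degrevlex !eqxx orbT.
- move=> m1 m2; rewrite /degrevlex => /andP[].
  case: (ltngtP (mdeg m1) (mdeg m2)) => //= _ /predU1P[//|lt12] /predU1P[//|lt21].
  by have := revlex_lt_trans lt12 lt21; rewrite revlex_ltxx.
- move=> m2 m1 m3; rewrite /degrevlex.
  case: (ltngtP (mdeg m1) (mdeg m2)) => //= [lt _|E /predU1P[->|lt12]] //.
    case: (ltngtP (mdeg m2) (mdeg m3)) => //= [lt'|<-]; last by rewrite lt.
    by rewrite (ltn_trans lt lt').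
  rewrite E; case: (ltngtP (mdeg m2) (mdeg m3)) => //= _ /predU1P[<-|lt23].
    by rewrite lt12 orbT.
  by rewrite (revlex_lt_trans lt12 lt23) orbT.
- move=> m1 m2; rewrite /degrevlex; case: (ltngtP (mdeg m1) (mdeg m2)) => //= _.
  by case: eqVneq => //= /revlex_lt_total.
- move=> m; rewrite /degrevlex mdeg0; case: (posnP (mdeg m)) => //= /eqP.
  by rewrite mdeg_eq0 => /eqP ->; rewrite mdeg0 !eqxx.
- move=> m m1 m2; rewrite /degrevlex !mdegD ltn_add2r eqn_add2r.
  case/orP => [-> //|/andP[/eqP E /predU1P[->|lt]]]; first by rewrite !eqxx !orbT.
  by rewrite E eqxx revlex_ltD ?orbT.
Qed.

(** The cell [c] has the least rank of all four and does not occur in [quadric a b]. *)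
Lemma quadric_revlex a b c d : (rho c < rho a)%N -> (rho c < rho b)%N ->
  (rho c <= rho d)%N -> revlex_lt (quadric c d) (quadric a b).
Proof.
have neq x y : (rho x < rho y)%N -> (y == x) = false.
  by move=> xy; apply/eqP => yx; rewrite yx ltnn in xy.
move=> ca cb cd; apply/revlex_ltP; exists c => [|y yc]; rewrite !expo_quadric.
  by rewrite (neq c a) // (neq c b) // eqxx.
rewrite (neq y c) // (neq y d) ?(leq_trans yc) //.
by rewrite (neq y a) ?(neq y b) // (ltn_trans yc).
Qed.

Lemma mdeg_expo m : mdeg m = (\sum_x expo m x)%N.
Proof. by rewrite mdegE (sum_enum_rank m). Qed.

Lemma mdeg_quadric a b : mdeg (@quadric M a b) = 2.
Proof. by rewrite mdegD !mdeg1. Qed.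

Lemma quadric_le m a b : a != b -> (0 < expo m a)%N -> (0 < expo m b)%N ->
  lem (quadric a b) m.
Proof.
move=> ab ma mb; apply/mnm_lepP => i; rewrite -[i]enum_valK.
rewrite -/(expo _ _) -/(expo m _) expo_quadric.
case: eqVneq => [<-|_]; first by rewrite eq_sym (negPf ab).
by case: eqVneq => [<-|].
Qed.

End RevLex.

(** * Two-way tables with monotone support *)

Section Comonotone.
Variables (T : finType) (P : pred T) (h q : T -> nat).

Lemma sum_restrict (u : T -> nat) (A B : pred T) :
  (forall y, A y -> (0 < u y)%N -> B y) ->
  (\sum_(y | A y) u y = \sum_(y | A y && B y) u y)%N.
Proof.
move=> AB; rewrite (bigID B) /= [X in (_ + X)%N]big1 ?addn0 // => y /andP[yA].
by case: (posnP (u y)) => // uy; rewrite AB.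
Qed.

Lemma leq_sum_restrict (u : T -> nat) (A B : pred T) :
  (\sum_(y | A y && B y) u y <= \sum_(y | A y) u y)%N.
Proof. by rewrite [leqRHS](bigID B) leq_addr. Qed.

Definition comonotone (u : T -> nat) := forall x y, P x -> P y ->
  (0 < u x)%N -> (0 < u y)%N -> (h x < h y)%N -> (q x <= q y)%N.

(* The two sublevel sets are nested on the support. *)
Lemma comonotone_cumul u i k : comonotone u ->
  (\sum_(y | [&& P y, h y < i & q y < k]) u y =
   minn (\sum_(y | P y && (h y < i)) u y) (\sum_(y | P y && (q y < k)) u y))%N.
Proof.
move=> um; have [/existsP[x /and4P[xP ux xi kx]]|/existsPn no] :=
    boolP [exists x, [&& P x, 0 < u x, h x < i & k <= q x]%N].
  have -> : (\sum_(y | P y && (q y < k)) u y =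
             \sum_(y | [&& P y, h y < i & q y < k]) u y)%N.
    rewrite (@sum_restrict _ _ (fun y => (h y < i)%N)).
      by apply: eq_bigl => y; rewrite andbAC andbA.
    move=> y /andP[yP qy] uy; rewrite ltnNge; apply/negP => iy.
    have := um x y xP yP ux uy (leq_trans xi iy).
    by rewrite leqNgt (leq_trans qy kx).
  rewrite (minn_idPr _) //; under eq_bigl do rewrite andbA.
  exact: leq_sum_restrict.
have -> : (\sum_(y | P y && (h y < i)) u y =
           \sum_(y | [&& P y, h y < i & q y < k]) u y)%N.
  rewrite (@sum_restrict _ _ (fun y => (q y < k)%N)).
    by apply: eq_bigl => y; rewrite andbA.
  move=> y /andP[yP hy] uy; rewrite ltnNge; have := no y.
  by rewrite yP uy hy.
rewrite (minn_idPl _) //.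
rewrite (eq_bigl (fun y => (P y && (q y < k)%N) && (h y < i)%N)); last first.
  by move=> y; rewrite andbAC andbA.
exact: leq_sum_restrict.
Qed.

(** The joint cumulative counts are determined by the marginal ones, and their differences in both
    directions recover the entries. *)
Lemma comonotone_unique u w i k : comonotone u -> comonotone w ->
  (forall i, \sum_(y | P y && (h y < i)) u y = \sum_(y | P y && (h y < i)) w y)%N ->
  (forall k, \sum_(y | P y && (q y < k)) u y = \sum_(y | P y && (q y < k)) w y)%N ->
  (\sum_(y | [&& P y, h y == i & q y == k]) u y =
   \sum_(y | [&& P y, h y == i & q y == k]) w y)%N.
Proof.
move=> um wm hE qE.
have cum i' k' : (\sum_(y | [&& P y, h y < i' & q y < k']) u y =
                  \sum_(y | [&& P y, h y < i' & q y < k']) w y)%N.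
  by rewrite !comonotone_cumul // hE qE.
have split_h (f : T -> nat) k' : (\sum_(y | [&& P y, h y < i.+1 & q y < k']) f y =
    \sum_(y | [&& P y, h y < i & q y < k']) f y + \sum_(y | [&& P y, h y == i & q y < k']) f y)%N.
  rewrite (bigID (fun y => (h y < i)%N)) /=; congr (_ + _)%N; apply: eq_bigl => y.
    rewrite ltnS [(h y < i)%N]ltn_neqAle.
    by case: (P y); case: (h y <= i)%N; case: (q y < k')%N; rewrite ?andbF ?andbT.
  by rewrite ltnS [(h y <= i)%N]leq_eqVlt; case: (P y); case: ltngtP; rewrite ?andbF ?andbT.
have split_q (f : T -> nat) : (\sum_(y | [&& P y, h y == i & q y < k.+1]) f y =
    \sum_(y | [&& P y, h y == i & q y < k]) f y + \sum_(y | [&& P y, h y == i & q y == k]) f y)%N.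
  rewrite (bigID (fun y => (q y < k)%N)) /=; congr (_ + _)%N; apply: eq_bigl => y.
    rewrite ltnS [(q y <= k)%N]leq_eqVlt.
    by case: (P y); case: (h y == i); case: ltngtP; rewrite ?andbF ?andbT.
  rewrite ltnS [(q y <= k)%N]leq_eqVlt.
  by case: (P y); case: (h y == i); case: ltngtP; rewrite ?andbF ?andbT.
have eq_i k' : (\sum_(y | [&& P y, h y == i & q y < k']) u y =
                \sum_(y | [&& P y, h y == i & q y < k']) w y)%N.
  by have /eqP := cum i.+1 k'; rewrite !split_h cum eqn_add2l => /eqP.
by have /eqP := eq_i k.+1; rewrite !split_q eq_i eqn_add2l => /eqP.
Qed.

End Comonotone.

(** * Lexicographic ranks and standard monomials *)

Section LexRank.
Variables (V : finType) (e : rel V) (I : V -> finType) (rk : V -> nat).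
Hypothesis rk_inj : injective rk.
Implicit Types (x y a b : cell I) (v : V) (u w : cell I -> nat).

Definition level v x : nat := enum_rank (x v).

Definition lex_base : nat := (\max_v #|I v|).+1.

(* Base-[lex_base] digits along [rk]: [lexrank n] orders cells lexicographically by
   their coordinates of rank less than [n]. *)
Fixpoint lexrank n x : nat :=
  if n is n'.+1 then
    (lexrank n' x * lex_base +
      (if [pick v | rk v == n'] is Some v then level v x else 0))%N
  else 0%N.

Lemma level_lt v x : (level v x < lex_base)%N.
Proof. by rewrite ltnS; apply: ltnW (leq_trans (ltn_ord _) (leq_bigmax v)). Qed.

Lemma level_inj v x y : level v x = level v y -> x v = y v.
Proof. by move/val_inj/enum_rank_inj. Qed.

Lemma lexrankS v x :
  lexrank (rk v).+1 x = (lexrank (rk v) x * lex_base + level v x)%N.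
Proof.
rewrite /=; case: pickP => [w /eqP/rk_inj -> //|/(_ v)]; by rewrite eqxx.
Qed.

Lemma lexrankS_none n x : (forall v, rk v != n) ->
  lexrank n.+1 x = (lexrank n x * lex_base)%N.
Proof.
move=> no /=; case: pickP => [w wn|_]; last by rewrite addn0.
by have := no w; rewrite wn.
Qed.

Lemma digit_inj (B a d a' d' : nat) : (d < B)%N -> (d' < B)%N ->
  (a * B + d = a' * B + d')%N -> a = a' /\ d = d'.
Proof.
move=> dB dB' E; have B0 : (0 < B)%N by exact: leq_ltn_trans dB.
split; last by have := congr1 (modn^~ B) E; rewrite !modnMDl !modn_small.
by have := congr1 (divn^~ B) E; rewrite !divnMDl // !divn_small // !addn0.
Qed.

Lemma lexrankP n x y : lexrank n x = lexrank n y <-> agree (below rk n) x y.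
Proof.
move: n; apply: (below_ind rk_inj) => [|v [IH1 IH2]|n no IH].
- by rewrite below0 agree0.
- rewrite !lexrankS belowS // agreeU agree1; split.
    by move/(digit_inj (level_lt v x) (level_lt v y)) => [/IH1 -> /level_inj ->]; rewrite eqxx.
  by case/andP => /eqP E /IH2 ->; rewrite /level E.
- rewrite !lexrankS_none // belowS_none //; split=> [/eqP|/IH -> //].
  by rewrite eqn_pmul2r // => /eqP/IH.
Qed.

Lemma ltn_digit (B a d a' d' : nat) : (d < B)%N -> (a < a')%N ->
  (a * B + d < a' * B + d')%N.
Proof.
move=> dB aa; apply: leq_trans (leq_addr _ _).
by apply: leq_trans (leq_mul aa (leqnn B)); rewrite mulSn addnC ltn_add2r.
Qed.

(** Earlier coordinates are the more significant digits. *)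
Lemma lexrank_mono n m x y : (n <= m)%N ->
  (lexrank n x < lexrank n y)%N -> (lexrank m x < lexrank m y)%N.
Proof.
move=> /subnKC <-; elim: (m - n)%N => [|k IH]; first by rewrite addn0.
move=> /IH {}IH; rewrite addnS.
case: (pickP (fun v => rk v == (n + k)%N)) => [v /eqP E|no].
  by rewrite -E !lexrankS E ltn_digit // level_lt.
by rewrite !lexrankS_none ?ltn_mul2r ?IH // => v; rewrite no.
Qed.

Definition cell_rank x := lexrank (rank_bound rk) x.

Lemma cell_rank_inj : injective cell_rank.
Proof. by move=> x y /lexrankP; rewrite below_all agreeT => /eqP. Qed.

Lemma cell_rank_lt v x y : (lexrank (rk v) x < lexrank (rk v) y)%N ->
  (cell_rank x < cell_rank y)%N.
Proof. by apply: lexrank_mono; rewrite leqW // leq_bigmax. Qed.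

Lemma cell_rank_lt_level v x y : agree (below rk (rk v)) x y ->
  (level v x < level v y)%N -> (cell_rank x < cell_rank y)%N.
Proof.
move=> /lexrankP E lt; apply: (@lexrank_mono (rk v).+1); first by rewrite ltnS leq_bigmax.
by rewrite !lexrankS E ltn_add2l.
Qed.

(* The multisets [u] in which, for every [v], the level at [v] increases weakly with
   the earlier coordinates within each configuration of the parents of [v]. *)
Definition standard u := forall v a b, (0 < u a)%N -> (0 < u b)%N -> agree (parents e rk v) a b ->
    (lexrank (rk v) a < lexrank (rk v) b)%N -> (level v a <= level v b)%N.

Lemma eq_sumn_agree C (Q : pred (cell I)) u w :
  (forall x y, agree C x y -> Q x = Q y) ->
  (forall x, marg u C x = marg w C x) ->
  (\sum_(y | Q y) u y = \sum_(y | Q y) w y)%N.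
Proof. exact: eq_sum_agree. Qed.

(** Given the parents of [v], the table of earlier coordinates against the level at [v] is
    comonotone, hence fixed by its margins: one is known by induction, the other because the family
    of [v] is complete. *)
Lemma standard_unique u w : perfect_elimination e rk -> symmetric e ->
  standard u -> standard w ->
  (forall C, complete_set e C -> forall x, marg u C x = marg w C x) -> u =1 w.
Proof.
move=> peo e_sym us ws uw x.
suff H n y : marg u (below rk n) y = marg w (below rk n) y.
  by have := H (rank_bound rk) x; rewrite below_all !margT.
move: n y; apply: (below_ind rk_inj) => [y|v IH y|n no IH y]; last first.
- by rewrite belowS_none.
- pose P z := agree (parents e rk v) z y.
  have E z : agree (below rk (rk v).+1) z y =
      [&& P z, lexrank (rk v) z == lexrank (rk v) y & level v z == level v y].
    rewrite belowS // agreeU agree1 andbC.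
    have -> : (z v == y v) = (level v z == level v y).
      by apply/eqP/eqP => [|/level_inj //]; rewrite /level => ->.
    have -> : agree (below rk (rk v)) z y = (lexrank (rk v) z == lexrank (rk v) y).
      by apply/idP/eqP => /lexrankP.
    case: (boolP (P z)) => //=; apply: contraNF => /andP[/eqP/lexrankP h _].
    exact: agree_sub (parents_below e rk v) h.
  rewrite /marg !(eq_bigl _ _ E); apply: comonotone_unique.
  + by move=> a b aP bP ua ub; apply: us => //; apply: agree_trans aP _; rewrite agree_sym.
  + by move=> a b aP bP ua ub; apply: ws => //; apply: agree_trans aP _; rewrite agree_sym.
  + move=> i; apply: eq_sumn_agree IH => a b ab; congr (_ && (_ < _)%N).
      by apply: agree_eql; exact: agree_sub (parents_below e rk v) ab.
    by apply/lexrankP.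
  + move=> k; apply: eq_sumn_agree (uw _ (family_complete e_sym v peo)) => a b ab.
    move: ab; rewrite agreeU agree1 => /andP[/eqP E' ab].
    by rewrite /P (agree_eql _ ab) /level E'.
- by rewrite below0; apply: uw; exact: complete0.
Qed.

End LexRank.

(** * The Groebner basis *)

Section Groebner.
Variables (R : realType) (V : finType) (e : rel V) (I : V -> finType).
Hypotheses (e_sym : symmetric e) (e_irr : irreflexive e).
Variable rk : V -> nat.
Hypothesis peo : perfect_elimination e rk.
Implicit Types (a b c d x : cell I) (m : multinom #|cell I|).

Local Notation rho := (@cell_rank V I rk).
Local Notation ord := (degrevlex rho).
Local Notation standard := (@standard V e I rk).

Let rk_inj : injective rk. Proof. by case: peo. Qed.

Let rho_inj : injective rho. Proof. exact: cell_rank_inj rk_inj. Qed.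

(** A violation at [v] is repaired by exchanging the component [Y] of [v]: [mix Y a b] has the
    earlier coordinates of [a] and the lower level of [b] at [v], so it precedes the other three
    cells. *)
Lemma not_standard (u : cell I -> nat) : ~ standard u ->
  exists X Y Z a b, [/\ global_separation e X Y Z, agree Z a b,
    (exists2 v, v \in X & a v != b v), (exists2 v, v \in Y & a v != b v) &
    [/\ (0 < u a)%N, (0 < u b)%N, a != b & revlex_lt rho
       (quadric (mix Y a b) (mix Y b a)) (quadric a b)]].
Proof.
move=> /boolp.existsNP[v /boolp.existsNP[a /boolp.existsNP[b H]]].
have [ua [ub [Zab [lab /negP]]]] : [/\ (0 < u a)%N, (0 < u b)%N,
    agree (parents e rk v) a b & (lexrank rk (rk v) a < lexrank rk (rk v) b)%N /\
    ~ (level v a <= level v b)%N].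
  by do 4 (case/boolp.not_implyP: H => ? H); split.
rewrite -ltnNge => lba.
have [X [Y [sep vY belowY]]] := peo_separation e_sym e_irr v peo.
have belowYd : [disjoint below rk (rk v) & Y].
  rewrite -finset.setI_eq0; apply/eqP/finset.setP => u'; rewrite !inE.
  by apply/andP => -[/belowY/negPf ->].
have ab_v : a v != b v by apply: contraTneq lba; rewrite /level => ->; rewrite ltnn.
exists X, Y, (parents e rk v), a, b; split=> //; last first.
- split=> //; first by apply: contraNneq ab_v => ->.
  have cb : agree (below rk (rk v)) (mix Y a b) a by apply: agree_mixl.
  have db : agree (below rk (rk v)) (mix Y b a) b by apply: agree_mixl.
  have lc : (lexrank rk (rk v) (mix Y a b) < lexrank rk (rk v) b)%N.
    by move/(lexrankP rk_inj): cb => ->.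
  apply: quadric_revlex.
  + by apply: cell_rank_lt_level cb _ => //; rewrite /level mixE vY.
  + exact: cell_rank_lt lc.
  + apply/ltnW/(@cell_rank_lt _ _ _ rk_inj v).
    by move/(lexrankP rk_inj): db => ->.
- by exists v.
(* The cells differ at a vertex before [v]; it is neither in [Y] nor a parent of [v], so it lies in
   [X]. *)
- have : ~~ agree (below rk (rk v)) a b.
    by apply: contraTN lab => /(lexrankP rk_inj) ->; rewrite ltnn.
  case/forall_inPn => u' u'b ab'; exists u' => //.
  case: sep => _ _ _ cov _; have := cov u'; rewrite !finset.in_setU.
  rewrite (disjointFr belowYd u'b) orbF => /orP[//|u'Z].
  by rewrite (agreeP Zab) ?eqxx in ab'.
Qed.

Lemma congruentD m m1 m2 : congruent (design I e) (expo m1) (expo m2) ->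
  congruent (design I e) (expo (mnm_add m m1)) (expo (mnm_add m m2)).
Proof.
move=> h i; have rsD m' m'' : row_sum (design I e) (expo (mnm_add m' m'')) i =
    (row_sum (design I e) (expo m') i + row_sum (design I e) (expo m'') i)%N.
  by rewrite /row_sum -big_split; apply: eq_bigr => x _; rewrite expoD mulnDr.
by rewrite !rsD h.
Qed.

Lemma congruent_mdeg m1 m2 : congruent (design I e) (expo m1) (expo m2) ->
  mdeg m1 = mdeg m2.
Proof.
move=> /congruentP/marg_complete/(_ _ (complete0 e)) h.
case: (pickP (predT : pred (cell I))) => [x _|no].
  by have := h x; rewrite !marg0 !mdeg_expo.
by rewrite !mdeg_expo !big_pred0 // => x; have := no x.
Qed.

Lemma reduce_not_standard m : ~ standard (expo m) ->
  exists2 m', revlex_lt rho m' m & congruent (design I e) (expo m') (expo m).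
Proof.
move=> /not_standard[X [Y [Z [a [b [sep Zab _ _ [ua ub ab lt]]]]]]].
have mE : m = mnm_add (mnm_sub m (quadric a b)) (quadric a b).
  by rewrite submK // quadric_le.
exists (mnm_add (mnm_sub m (quadric a b)) (quadric (mix Y a b) (mix Y b a))).
  by rewrite {2}mE ![mnm_add (mnm_sub _ _) _]addmC; apply: revlex_ltD.
rewrite {2}mE; apply: congruentD => i; rewrite (congruent_quadric sep Zab).
by rewrite /quadric addmC.
Qed.

(** Reducing [m1] while it is not standard descends within the fiber and stops at a standard
    monomial, which is [m] by uniqueness. *)
Lemma standard_min m m1 : standard (expo m) ->
  congruent (design I e) (expo m1) (expo m) -> ord m m1.
Proof.
move=> ms.
have [[ordxx _ ord_tr _] _] := degrevlex_order rho_inj.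
(* Termination is measured by the number of monomials below [m1] of degree at most [mdeg m]; the
   bound in [bmultinom] is strict, hence the successor. *)
pose D m1 := [set m' : bmultinom #|cell I| (mdeg m).+1 | ord m' m1]%SET.
have [n] := ubnP #|D m1|; elim: n m1 => // n IH m1 szn m1m.
have [m1s|/reduce_not_standard[m2 lt21 m21]] := boolp.pselect (standard (expo m1)).
  have -> : m = m1; last exact: ordxx.
  apply: expo_inj; apply: (standard_unique rk_inj peo e_sym ms m1s) => C Cc x.
  by apply/esym; apply: marg_complete Cc x; apply/congruentP.
have m2m : congruent (design I e) (expo m2) (expo m) by move=> i; rewrite m21.
have ord21 : ord m2 m1 by rewrite /degrevlex (congruent_mdeg m21) eqxx lt21 !orbT.
apply: (ord_tr m2) => //; apply: IH => //; rewrite ltnS in szn; apply: leq_trans szn.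
apply: proper_card; apply/fintype.properP; split.
  apply/fintype.subsetP => m'; rewrite !inE => h; exact: ord_tr h ord21.
have m1b : (mdeg m1 < (mdeg m).+1)%N by rewrite (congruent_mdeg m1m).
exists (BMultinom m1b); rewrite inE //=.
apply/negP; rewrite /degrevlex (congruent_mdeg m21) eqxx ltnn /=.
case/predU1P => [E|lt12]; first by rewrite E revlex_ltxx in lt21.
have := revlex_lt_trans rho_inj lt12 lt21.
by rewrite revlex_ltxx.
Qed.

(** The coefficients of [f] sum to 0 over each fiber. A standard [m] is least in its fiber, so if it
    led, it would be the only monomial of its fiber in the support. *)
Lemma leading_not_standard (f : mpoly #|cell I| R) m :
  toric_ideal R (design I e) f -> leading_monomial ord f m -> ~ standard (expo m).
Proof.
move=> fI [mf mmax] ms.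
have [[_ ord_anti _ _] _] := degrevlex_order rho_inj.
have := toric_ideal_fiber m fI; rewrite big_mkcond (bigD1_seq m) ?msupp_uniq //= eqxx.
rewrite big1_seq => [/eqP|m' /andP[m'm m'f]].
  by rewrite addr0 mcoeff_eq0 mf.
case: degree_monomialP => // cong; case/eqP: m'm; apply: ord_anti.
by rewrite mmax // standard_min.
Qed.

(** A basis is a list, so the binomials are filtered from the finite list of all differences of two
    products of two indeterminates. *)
Definition separation_binomials : seq (mpoly #|cell I| R) :=
  [seq f <- [seq indet R p.1.1 * indet R p.1.2 - indet R p.2.1 * indet R p.2.2
            | p : ((cell I * cell I) * (cell I * cell I))%type]
  | boolp.asbool (separation_binomial e f)].

Lemma mem_separation_binomials f :
  f \in separation_binomials <-> separation_binomial e f.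
Proof.
rewrite mem_filter; split=> [/andP[/boolp.asboolP]//|sf].
apply/andP; split; first exact/boolp.asboolP.
have /separation_binomialP[X [Y [Z [a [b [_ _ _ _ ->]]]]]] := sf.
by apply/mapP; exists ((a, b), (mix Y b a, mix Y a b)); rewrite ?mem_enum.
Qed.

Lemma ideal_gen_multiples n (S S' : set (mpoly n R)) :
  (forall f, S f -> exists g h, S' g /\ f = h * g) ->
  forall f, ideal_gen S f -> ideal_gen S' f.
Proof.
move=> SS' f [k [g [b [bS ->]]]].
have /boolp.choice[c cP] i := SS' _ (bS i).
have /boolp.choice[d dP] i := cP i.
exists k, (fun i => g i * d i), c; split=> [i|]; first by case: (dP i).
by apply: eq_bigr => i _; rewrite -mulrA; case: (dP i) => _ <-.
Qed.

Lemma leading_quadric (Y : {set V}) a b :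
  revlex_lt rho (quadric (mix Y a b) (mix Y b a)) (quadric a b) ->
  leading_monomial ord (indet R a * indet R b - indet R (mix Y b a) * indet R (mix Y a b))
    (quadric a b).
Proof.
move=> lt; rewrite !indetM.
have -> : quadric (mix Y b a) (mix Y a b) = quadric (mix Y a b) (mix Y b a).
  by rewrite /quadric addmC.
split.
  have neq : (quadric (mix Y a b) (mix Y b a) == quadric a b) = false.
    by apply/eqP => E; rewrite E revlex_ltxx in lt.
  by rewrite mcoeff_msupp mcoeffB !mcoeffX eqxx neq subr0 oner_neq0.
move=> m /msuppB_le; rewrite mem_cat !msuppX !inE /degrevlex => /orP[] /eqP ->.
  by rewrite !eqxx orbT.
by rewrite !mdeg_quadric eqxx lt !orbT.
Qed.

(** A leading monomial of the ideal is not standard, so by [not_standard] the leading monomial of a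
    separation binomial divides it. *)
Lemma peo_groebner :
  groebner_basis ord (toric_ideal R (design I e)) separation_binomials.
Proof.
split=> [g /mem_separation_binomials/separation_toric //|].
apply/seteqP; split.
  apply: ideal_gen_multiples => f [g [m [gB gm ->]]].
  exists (mpolyX R m), 1; split; last by rewrite mul1r.
  exists g, m; split=> //; apply: separation_toric.
  exact/mem_separation_binomials.
apply: ideal_gen_multiples => f [g [m [gI gm ->]]].
have := leading_not_standard gI gm.
move=> /not_standard[X [Y [Z [a [b [sep Zab Xab Yab [ua ub ab lt]]]]]]].
exists (mpolyX R (quadric a b)), (mpolyX R (mnm_sub m (quadric a b))); split.
  exists (indet R a * indet R b - indet R (mix Y b a) * indet R (mix Y a b)).
  exists (quadric a b); split=> //; last exact: leading_quadric.
  apply/mem_separation_binomials/separation_binomialP.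
  by exists X, Y, Z, a, b.
by rewrite -mpolyXD submK // quadric_le.
Qed.

End Groebner.

(** * The maximum likelihood estimate of a decomposable model *)

Section Gibbs.
Variables (R : realType) (M : finType).
Implicit Types (w m : M -> nat) (P Q : M -> R).

(** The inequality of arithmetic and geometric means for a family in which [x] is repeated [w x]
    times. *)
Lemma agm_weighted w (E : M -> R) (K := (\sum_x w x)%N) : (forall x, 0 <= E x) ->
  \prod_x E x ^+ w x <= ((\sum_x (w x)%:R * E x) / K%:R) ^+ K.
Proof.
move=> E0; pose J : finType := {x : M & 'I_(w x)}.
have cJ : #|J| = K by rewrite card_tagged sumnE big_map big_enum; under eq_bigr do rewrite card_ord.
have := leif_AGM (A := predT) (E := fun j : J => E (tag j)) (fun j _ => E0 (tag j)).
case=> + _; rewrite cJ.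
have -> : \prod_(j : J) E (tag j) = \prod_x E x ^+ w x.
  rewrite -(@sig_big_dep _ _ _ _ _ predT (fun _ => predT) (fun x _ => E x)) /=.
  by apply: eq_bigr => x _; rewrite prodr_const card_ord.
have -> // : \sum_(j : J) E (tag j) = \sum_x (w x)%:R * E x.
rewrite -(@sig_big_dep _ _ _ _ _ predT (fun _ => predT) (fun x _ => E x)) /=.
by apply: eq_bigr => x _; rewrite sumr_const card_ord mulr_natl.
Qed.

(** The weighted inequality of means, applied to the ratios [Q x / P x], bounds the ratio of the two
    likelihoods by 1. *)
Lemma gibbs w P Q : (0 < \sum_x w x)%N -> distribution Q ->
  (forall x, (w x)%:R = (\sum_y w y)%N%:R * P x) ->
  \prod_x Q x ^+ w x <= \prod_x P x ^+ w x.
Proof.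
set K := (\sum_x w x)%N => K0 [Q0 Q1] wE.
have K0R : 0 < K%:R :> R by rewrite ltr0n.
have PE x : P x = (w x)%:R / K%:R by rewrite wE mulrC mulKf // gt_eqF.
have P0 x : 0 <= P x by rewrite PE divr_ge0 ?ler0n.
have Pw x : (0 < w x)%N -> P x != 0.
  by move=> wx; rewrite PE mulf_neq0 ?invr_neq0 ?pnatr_eq0 -?lt0n.
have ratio : \prod_x (Q x / P x) ^+ w x <= 1.
  have E0 x : 0 <= Q x / P x by rewrite divr_ge0.
  apply: le_trans (agm_weighted w E0) _; apply: exprn_ile1.
    by rewrite divr_ge0 ?ler0n // sumr_ge0 // => x _; rewrite mulr_ge0 ?ler0n.
  have KQ : K%:R = \sum_x K%:R * Q x by rewrite -mulr_sumr Q1 mulr1.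
  rewrite ler_pdivrMr // mul1r KQ; apply: ler_sum => x _.
  case: (posnP (w x)) => [->|/Pw Px]; first by rewrite mul0r mulr_ge0 ?ler0n.
  by rewrite wE -mulrA [P x * _]mulrC divfK.
have -> : \prod_x Q x ^+ w x = (\prod_x (Q x / P x) ^+ w x) * \prod_x P x ^+ w x.
  rewrite -big_split; apply: eq_bigr => x _ /=; rewrite -exprMn.
  by case: (posnP (w x)) => [->|/Pw Px]; rewrite ?expr0 // divfK.
rewrite -[leRHS]mul1r; apply: ler_wpM2r ratio.
by apply: prodr_ge0 => x _; rewrite exprn_ge0.
Qed.

(** Clearing denominators by [d] turns [P] into integral counts [w] in the fiber of [d * m]; on the
    toric variety the likelihood of [w] is then the [d]-th power of that of [m], and [gibbs] applies
    to [w]. *)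
Lemma mle_sufficient (D : finType) (A : D -> M -> nat) m w P (d : nat) :
  (0 < d)%N -> (0 < \sum_x m x)%N -> distribution P -> toric_variety A P ->
  (forall x, (w x)%:R = (d * \sum_y m y)%N%:R * P x) ->
  congruent A w (fun x => (d * m x)%N) ->
  forall Q, distribution Q -> toric_variety A Q -> likelihood m Q <= likelihood m P.
Proof.
move=> d0 m0 [P0 P1] /toric_varietyP[_ tP] wE cong Q dQ /toric_varietyP[_ tQ].
have wK : (\sum_x w x)%N = (d * \sum_y m y)%N.
  apply: (@mulrIn R 1) => //; first exact: oner_neq0.
  by rewrite natr_sum (eq_bigr _ (fun x _ => wE x)) -mulr_sumr P1 mulr1.
have power T : (forall u v, congruent A u v -> \prod_x T x ^+ u x = \prod_x T x ^+ v x) ->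
    \prod_x T x ^+ w x = likelihood m T ^+ d.
  move=> /(_ _ _ cong) ->; rewrite /likelihood -prodrXl.
  by apply: eq_bigr => x _; rewrite mulnC exprM.
have lik0 (T : M -> R) : (forall x, 0 <= T x) -> likelihood m T \is Num.nneg.
  by move=> T0; rewrite nnegrE; apply: prodr_ge0 => x _; rewrite exprn_ge0.
rewrite -(ler_pXn2r d0) ?lik0 //; last by case: dQ.
rewrite -!power //; apply: gibbs => //; first by rewrite wK muln_gt0 d0.
by move=> x; rewrite wK.
Qed.

Lemma common_denominator (a b : M -> nat) : (forall x, (0 < b x)%N) ->
  exists d w, (0 < d)%N /\
    forall x, (w x)%:R = d%:R * ((a x)%:R / (b x)%:R) :> R.
Proof.
move=> b0; exists (\prod_x b x)%N, (fun x => (a x * \prod_(y | y != x) b y)%N).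
split=> [|x]; first by rewrite prodn_gt0.
have bx : (b x)%:R != 0 :> R by rewrite pnatr_eq0 -lt0n.
by rewrite /= [in RHS](bigD1 x) //= !natrM [RHS]mulrCA mulrAC mulfV // mul1r.
Qed.

End Gibbs.

(** * Products of conditional frequencies *)

Section Product.
Variables (R : realType) (V : finType) (e : rel V) (I : V -> finType).
Hypotheses (e_sym : symmetric e).
Variable rk : V -> nat.
Hypothesis peo : perfect_elimination e rk.
Implicit Types (x y z : cell I) (C D : {set V}).

Local Notation pa := (parents e rk).
Local Notation fa := (family e rk).

Let rk_inj : injective rk. Proof. by case: peo. Qed.

Definition upd x v (t : I v) : cell I :=
  [ffun u => if eqP is ReflectT E then ecast u (I u) E t else x u].

Lemma upd_same x v (t : I v) : upd x t v = t.
Proof. by rewrite ffunE; case: eqP => // E; rewrite (eq_axiomK E). Qed.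

Lemma upd_other x v (t : I v) u : u != v -> upd x t u = x u.
Proof. by move=> uv; rewrite ffunE; case: eqP => // vu; rewrite vu eqxx in uv. Qed.

Lemma agree_upd x v (t : I v) C : v \notin C -> agree C (upd x t) x.
Proof.
by move=> vC; apply/agreeP => u uC; rewrite upd_other //; apply: contraNneq vC => <-.
Qed.

Lemma marg_upd (u : cell I -> R) C x v : v \notin C ->
  marg u C x = \sum_(t : I v) marg u (v |: C) (upd x t).
Proof.
move=> vC; rewrite /marg (partition_big (fun y => y v) predT) //=.
apply: eq_bigr => t _; apply: eq_bigl => y; rewrite agreeU agree1 upd_same andbC.
by congr (_ && _); rewrite ![agree C y _]agree_sym; apply/esym/agree_eql/agree_upd.
Qed.

Variable m : cell I -> R.
Hypothesis pa_neq0 : forall v x, marg m (pa v) x != 0.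

(** The empirical conditional frequency of the level at [v] given the parents of [v]. *)
Let F v x := marg m (fa v) x / marg m (pa v) x.

Let P x := \prod_v F v x.

Let F_agree v x y : agree (fa v) x y -> F v x = F v y.
Proof.
move=> xy; rewrite /F (eq_marg _ xy) (@eq_marg _ _ _ _ (pa v) x y) //.
by apply: agree_sub xy; exact: finset.subsetUr.
Qed.

Lemma product_sum1 v x : \sum_(t : I v) F v (upd x t) = 1.
Proof.
have vpa : v \notin pa v by rewrite inE ltnn andbF.
under eq_bigr => t _ do rewrite /F (eq_marg _ (agree_upd x t vpa)).
by rewrite -mulr_suml -marg_upd // mulfV.
Qed.

Let F_upd u v x (t : I v) : (rk u < rk v)%N -> F u (upd x t) = F u x.
Proof.
move=> uv; apply: F_agree; apply: agree_upd; rewrite !inE negb_or.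
apply/andP; split; first by apply: contraTneq uv => ->; rewrite ltnn.
by rewrite negb_and -leqNgt [(rk u <= _)%N]ltnW ?orbT.
Qed.

(** Downward induction from the full vertex set: summing out the last vertex [v] removes the factor
    [F v], whose sum over the levels of [v] is 1. *)
Lemma product_below n x :
  marg P (below rk n) x = \prod_(v | (rk v < n)%N) F v x.
Proof.
have step n' : (forall x, marg P (below rk n'.+1) x = \prod_(v | (rk v < n'.+1)%N) F v x) ->
    forall x, marg P (below rk n') x = \prod_(v | (rk v < n')%N) F v x.
  move=> H z; case: (pickP (fun v => rk v == n')) => [v /eqP vn|no]; last first.
    have {}no v : rk v != n' by rewrite no.
    by have := H z; rewrite belowS_none // prod_belowS_none.
  subst n'; have vb : v \notin below rk (rk v) by rewrite inE ltnn.
  rewrite (marg_upd P z vb) -belowS //.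
  transitivity ((\sum_(t : I v) F v (upd z t)) * \prod_(u | (rk u < rk v)%N) F u z); last first.
    by rewrite product_sum1 mul1r.
  rewrite mulr_suml; apply: eq_bigr => t _.
  rewrite [LHS]H prod_belowS //.
  by congr (_ * _); apply: eq_bigr => u uv; apply: F_upd.
suff H k : forall n, (rank_bound rk <= n + k)%N -> forall x,
    marg P (below rk n) x = \prod_(v | (rk v < n)%N) F v x.
  by apply: (H (rank_bound rk)); rewrite leq_addl.
elim: k => [|k IH] {x}n nk x; last by apply: step; apply: IH; rewrite addSnnS.
have nb v : (rk v < n)%N.
  by rewrite addn0 in nk; apply: leq_trans nk; rewrite ltnS leq_bigmax.
have -> : below rk n = finset.setT by apply/finset.setP => v; rewrite !inE nb.
by rewrite margT; apply: eq_bigl => v; rewrite nb.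
Qed.

(** By [product_below], adjoining [v] multiplies each margin on the vertices before [v] by [F v],
    which is constant on the cells of the given family configuration. *)
Lemma product_family v x :
  marg P (fa v) x = F v x * marg P (pa v) x.
Proof.
(* Both sides become unrestricted sums, to be compared on each configuration of the vertices before
   [v]. *)
pose u y := if agree (fa v) y x then P y else 0.
pose w y := if agree (pa v) y x then F v x * P y else 0.
have -> : marg P (fa v) x = \sum_y u y by rewrite /marg big_mkcond.
have -> : F v x * marg P (pa v) x = \sum_y w y.
  by rewrite /marg mulr_sumr big_mkcond.
apply: (@eq_sum_agree _ _ _ (below rk (rk v)) predT) => // z.
have [zx|zx] := boolP (agree (pa v) z x); last first.
  have nz y : agree (below rk (rk v)) y z -> agree (pa v) y x = false.
    move=> yz; apply: contraNF zx => yx; apply: agree_trans yx.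
    by rewrite agree_sym; apply: agree_sub yz; exact: parents_below.
  rewrite /marg !big1 // => y /nz yx; first by rewrite /w yx.
  by rewrite /u /family agreeU yx andbF.
have pz y : agree (below rk (rk v)) y z -> agree (pa v) y x.
  move=> yz; apply: agree_trans zx; apply: agree_sub yz; exact: parents_below.
have -> : marg w (below rk (rk v)) z = F v x * marg P (below rk (rk v)) z.
  by rewrite /marg mulr_sumr; apply: eq_bigr => y /pz yx; rewrite /w yx.
have vb : v \notin below rk (rk v) by rewrite inE ltnn.
have -> : marg u (below rk (rk v)) z = marg P (below rk (rk v).+1) (upd z (x v)).
  rewrite belowS // /marg big_mkcond [RHS]big_mkcond; apply: eq_bigr => y _.
  rewrite agreeU agree1 upd_same ![agree (below _ _) y _]agree_sym.
  rewrite (agree_eql _ (agree_upd z (x v) vb)) ![agree (below _ _) z y]agree_sym.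
  case: (boolP (agree _ y z)) => [/pz yx|]; last by rewrite andbF.
  by rewrite /u /family agreeU yx agree1 andbT.
rewrite !product_below prod_belowS //; congr (_ * _).
  apply: F_agree; rewrite /family agreeU agree1 upd_same eqxx /=.
  rewrite (agree_eql _ (agree_upd _ _ _)) //.
  by rewrite inE ltnn andbF.
by apply: eq_bigr => u' uv; apply: F_upd.
Qed.

(** Induction on the last vertex [v] of [D]: the set lies in the family of [v], whose margin is
    [F v] times that of the parents, which is known by induction. *)
Lemma product_marg D x : complete_set e D ->
  (\sum_y m y) * marg P D x = marg m D x.
Proof.
suff H n : forall D, complete_set e D -> D \subset below rk n -> forall x,
    (\sum_y m y) * marg P D x = marg m D x.
  by move=> Dc; apply: (H (rank_bound rk)) => //; rewrite below_all finset.subsetT.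
move: n; apply: (below_ind rk_inj) => {D x} [D _|v IH D Dc DS x|n no IH D Dc]; last first.
- by rewrite belowS_none //; exact: IH.
- have [vD|vD] := boolP (v \in D); last first.
    apply: IH => //; apply/fintype.subsetP => u uD.
    have /fintype.subsetP /(_ u uD) := DS; rewrite belowS // finset.in_setU1.
    by case: eqP => // uv; rewrite -uv uD in vD.
  have Dfa : D \subset fa v.
    apply/fintype.subsetP => u uD; rewrite finset.in_setU1.
    case: eqVneq => //= uv; rewrite inE (complete_setP Dc) //= 1?eq_sym //.
    have /fintype.subsetP /(_ u uD) := DS; rewrite inE ltnS leq_eqVlt (inj_eq rk_inj).
    by rewrite (negPf uv).
  have mulE C z : marg (fun y => (\sum_y m y) * P y) C z = (\sum_y m y) * marg P C z.
    by rewrite /marg mulr_sumr.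
  rewrite -mulE; apply: (marg_sub Dfa) => z; rewrite mulE product_family mulrCA.
  rewrite IH; [|by case: peo|exact: parents_below].
  by rewrite /F divfK.
- rewrite below0 finset.subset0 => /eqP -> x; rewrite !marg0.
  have := product_below 0 x; rewrite below0 marg0 big_pred0 // => ->.
  by rewrite mulr1.
Qed.

End Product.

(** * A rational formula for the estimate *)

Section RationalMLE.
Variables (R : realType) (V : finType) (e : rel V) (I : V -> finType).
Hypotheses (e_sym : symmetric e) (e_irr : irreflexive e).
Implicit Types (x y : cell I) (C D : {set V}).

Definition margin_poly C x : mpoly #|cell I| R := \sum_(y | agree C y x) indet R y.

Lemma eval_margin_poly P C x : eval_at P (margin_poly C x) = marg P C x.
Proof.
rewrite /eval_at /margin_poly rmorph_sum; apply: eq_bigr => y _.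
exact: eval_indet.
Qed.

Lemma margin_poly_neq0 C x : margin_poly C x != 0.
Proof.
apply/eqP => /(congr1 (eval_at (fun=> 1))); rewrite eval_margin_poly /eval_at raddf0.
move/eqP; rewrite psumr_eq0 => [/allP/(_ x (mem_index_enum _))|y _]; last exact: ler01.
by rewrite agree_refl oner_eq0.
Qed.

Lemma decomposable_mle_rational : decomposable e -> mle_rational R (design I e).
Proof.
move=> /(decomposable_peo e_sym e_irr)[rk peo].
exists (fun x => margin_poly finset.set0 x * \prod_v margin_poly (family e rk v) x).
exists (fun x => \prod_v margin_poly (parents e rk v) x).
split=> [x|m m_neq0 ev ev_neq0].
  by apply/prodf_neq0 => v _; exact: margin_poly_neq0.
set mR : cell I -> R := fun x => (m x)%:R.
have ev_prod (J : finType) (p : J -> mpoly #|cell I| R) : ev (\prod_j p j) = \prod_j ev (p j).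
  by rewrite /ev /eval_at rmorph_prod.
(* The denominator at [x] is the product of the parent margins at [x]. *)
have pa_neq0 v x : marg mR (parents e rk v) x != 0.
  have := ev_neq0 x; rewrite ev_prod => /prodf_neq0/(_ v isT).
  by rewrite /ev eval_margin_poly.
pose F v x := marg mR (family e rk v) x / marg mR (parents e rk v) x.
pose P x := \prod_v F v x.
have mR0 y : 0 <= mR y by rewrite ler0n.
have F0 v x : 0 <= F v x by rewrite divr_ge0 ?marg_ge0.
have P0 x : 0 <= P x by apply: prodr_ge0.
set N := (\sum_y m y)%N.
have NE : \sum_y mR y = N%:R by rewrite natr_sum.
have N0 : (0 < N)%N by case: m_neq0 => x mx; rewrite /N (bigD1 x) //= addn_gt0 lt0n mx.
have PD D x : complete_set e D -> N%:R * marg P D x = marg mR D x.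
  by move=> Dc; rewrite -NE; exact: (product_marg peo pa_neq0 x Dc).
have P1 : \sum_x P x = 1.
  have [x _] := m_neq0; have := PD finset.set0 x (complete0 e).
  rewrite !marg0 NE => /(canRL (mulKf _)) -> //; rewrite ?mulVf ?pnatr_eq0 -?lt0n //.
have mhatE x : ev (margin_poly finset.set0 x * \prod_v margin_poly (family e rk v) x) /
    ev (\prod_v margin_poly (parents e rk v) x) = N%:R * P x.
  have evM p q : ev (p * q) = ev p * ev q by rewrite /ev /eval_at rmorphM.
  rewrite evM !ev_prod /ev eval_margin_poly marg0 NE -mulrA; congr (_ * _).
  rewrite -prodf_div; apply: eq_bigr => v _; by rewrite !eval_margin_poly.
have tP : toric_variety (design I e) P.
  apply: image_toric; rewrite -/(factors e P); apply: factors_prod => v _.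
  apply: (factors_potential (family_complete e_sym v peo)) => // x y xy.
  rewrite /F (eq_marg _ xy) (@eq_marg _ _ _ _ (parents e rk v) x y) //.
  by apply: agree_sub xy; exact: finset.subsetUr.
exists P; split=> // Q dQ tQ.
(* The margins are taken in natural numbers to obtain a common integral denominator for
   [mle_sufficient]. *)
pose nat_marg C x := (\sum_(y | agree C y x) m y)%N.
have margE C x : marg mR C x = (nat_marg C x)%:R by rewrite natr_sum.
pose A x := (N * \prod_v nat_marg (family e rk v) x)%N.
pose B x := (\prod_v nat_marg (parents e rk v) x)%N.
have B0 x : (0 < B x)%N.
  by rewrite prodn_gt0 // => v; have := pa_neq0 v x; rewrite margE pnatr_eq0 lt0n.
have [d [w [d0 wE]]] := common_denominator R A B0.
have NPE x : N%:R * P x = (A x)%:R / (B x)%:R.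
  rewrite natrM -mulrA !natr_prod -prodf_div; congr (_ * _).
  by apply: eq_bigr => v _; rewrite /F !margE.
have wE' x : (w x)%:R = (d * N)%N%:R * P x by rewrite wE -NPE natrM mulrA.
apply: (mle_sufficient d0 N0 _ tP wE' _ dQ tQ) => //.
apply/congruentP => C /maxsetp Cc x; apply: (@mulrIn R 1); first exact: oner_neq0.
rewrite /marg !natr_sum -[RHS]/(\sum_(y | _) (d * m y)%N%:R).
under eq_bigr do rewrite wE'.
under [RHS]eq_bigr do rewrite natrM.
by rewrite -!mulr_sumr natrM -mulrA [N%:R * _]PD.
Qed.

End RationalMLE.

(** * Chordless cycles *)

Definition bits : finType := (bool * bool * bool)%type.

Definition flip (i : nat) (p : bits) : bits :=
  let: (a, b, c) := p in
  match i with 0 => (~~ a, b, c) | 1 => (a, ~~ b, c) | _ => (a, b, ~~ c) end.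

Definition parity (p : bits) : bool := p.1.1 (+) p.1.2 (+) p.2.

Lemma flipK i : involutive (flip i).
Proof. by case: i => [|[|i]] [[[] []] []]. Qed.

Lemma parity_flip i p : parity (flip i p) = ~~ parity p.
Proof. by case: i p => [|[|i]] [[[] []] []]. Qed.

(** What the counterexamples need of the cube: no complete set sees all three bits, some complete
    set sees exactly the two bits other than [i], cells that look like corners on every complete set
    are corners, and no separation statement acts nontrivially on two corners. *)
Record obstruction (V : finType) (e : rel V) (I : V -> finType)
    (corner : bits -> cell I) : Prop := Obstruction {
  corner_inj : injective corner;
  corner_blind : forall C, complete_set e C ->
    exists i, forall p, agree C (corner p) (corner (flip i p));
  corner_detect : forall i, exists2 D, complete_set e D &
    forall p p', agree D (corner p) (corner p') = (p' == p) || (p' == flip i p);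
  corner_local : forall x : cell I,
    (forall D, complete_set e D -> exists p, agree D x (corner p)) ->
    exists p, x = corner p;
  corner_separation : forall X Y Z p p', global_separation e X Y Z ->
    agree Z (corner p) (corner p') ->
    ~~ agree X (corner p) (corner p') -> ~~ agree Y (corner p) (corner p') -> False
}.

Section ChordlessCycle.
Variables (V : finType) (e : rel V) (I : V -> finType).
Hypotheses (e_sym : symmetric e) (e_irr : irreflexive e).
Variables (c1 c2 c3 : V) (r : seq V).
Hypothesis cyc : ucycle e [:: c1, c2, c3 & r].
Hypothesis r_neq0 : (0 < size r)%N.
Hypothesis chordless : forall u v, u \in [:: c1, c2, c3 & r] ->
  v \in [:: c1, c2, c3 & r] -> e u v ->
  next [:: c1, c2, c3 & r] u = v \/ next [:: c1, c2, c3 & r] v = u.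
Variables (l0 l1 : forall v, I v).
Hypothesis l01 : forall v, l0 v != l1 v.
Implicit Types (p : bits) (u v w : V).

Let c := [:: c1, c2, c3 & r].
Let block := c3 :: r.

(* The vertices of the cycle after the second one move together: the cycle is
   contracted to a triangle, and the corners are those of the binary cube. *)
Definition bit p v : bool :=
  if v == c1 then p.1.1 else if v == c2 then p.1.2 else (v \in block) && p.2.

Definition corner p : cell I := [ffun v => if bit p v then l1 v else l0 v].

Let c_uniq : uniq c. Proof. by case/andP: cyc. Qed.

Let c12 : c1 != c2.
Proof. by move: c_uniq; rewrite /= !inE !negb_or -!andbA => /and5P[]. Qed.

Let c1_block : c1 \notin block.
Proof. by move: c_uniq; rewrite /= inE negb_or => /andP[/andP[_ ->]]. Qed.

Let c2_block : c2 \notin block.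
Proof. by move: c_uniq; rewrite /= => /and3P[_ ->]. Qed.

Let c3_r : c3 \notin r.
Proof. by move: c_uniq; rewrite /= => /and4P[_ _ ->]. Qed.

Let e12 : e c1 c2. Proof. by case/andP: cyc => /= /and3P[]. Qed.

Let e23 : e c2 c3. Proof. by case/andP: cyc => /= /and3P[]. Qed.

Let path_block : path e c3 r.
Proof. by case/andP: cyc => /=; rewrite rcons_path => /and4P[_ _ ->]. Qed.

Let e1l : e c1 (last c3 r).
Proof. by case/andP: cyc => /=; rewrite rcons_path => /and4P[_ _ _]; rewrite e_sym. Qed.

Let last_block : last c3 r \in block. Proof. exact: mem_last. Qed.

Let block_c w : w \in block -> w \in c.
Proof. by move=> wb; rewrite !inE -in_cons wb !orbT. Qed.

Let last_neq : last c3 r != c3.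
Proof.
case: r r_neq0 c3_r => // b s _; apply: contraNneq => <- /=; exact: mem_last.
Qed.

Let next_inj u v : next c u = next c v -> u = v.
Proof. by move/(congr1 (prev c)); rewrite !prev_next. Qed.

Let next1 : next c c1 = c2. Proof. by rewrite /= eqxx. Qed.

Let next2 : next c c2 = c3. Proof. by rewrite /= [c2 == c1]eq_sym (negPf c12) eqxx. Qed.

Let next_last : next c (last c3 r) = c1.
Proof.
have us : uniq (c2 :: block) by move: c_uniq => /= /andP[].
have lb : last c2 block \in c2 :: block by exact: mem_last.
have -> : last c3 r = last c2 block by [].
by rewrite /c next_cons_nth // index_last // nth_default.
Qed.

(** Without chords adjacent vertices of the cycle are consecutive, so [c1] meets the block only in
    its last vertex; likewise [c2] only in its first. *)
Let block_nbr1 w : w \in block -> e c1 w -> w = last c3 r.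
Proof.
move=> wb e1w; case: (chordless _ (block_c wb) e1w); first by rewrite inE eqxx.
  by rewrite -/c next1 => w2; rewrite -w2 (negPf c2_block) in wb.
by rewrite -/c -next_last => /next_inj.
Qed.

Let block_nbr2 w : w \in block -> e c2 w -> w = c3.
Proof.
move=> wb e2w; case: (chordless _ (block_c wb) e2w); first by rewrite !inE eqxx orbT.
  by rewrite -/c next2.
by rewrite -/c -next1 => /next_inj w1; rewrite w1 (negPf c1_block) in wb.
Qed.

Lemma bit1 p : bit p c1 = p.1.1. Proof. by rewrite /bit eqxx. Qed.

Lemma bit2 p : bit p c2 = p.1.2. Proof. by rewrite /bit [c2 == c1]eq_sym (negPf c12) eqxx. Qed.

Lemma bit_block p w : w \in block -> bit p w = p.2.
Proof.
move=> wb; rewrite /bit wb; case: eqP => [w1|_].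
  by have := c1_block; rewrite -w1 wb.
by case: eqP => // w2; have := c2_block; rewrite -w2 wb.
Qed.

Lemma corner_eq p p' v : (corner p v == corner p' v) = (bit p v == bit p' v).
Proof.
rewrite !ffunE; case: (bit p v) (bit p' v) => [] [] //; rewrite ?eqxx //.
  by rewrite eq_sym (negPf (l01 v)).
by rewrite (negPf (l01 v)).
Qed.

Lemma corner_obstruction : obstruction e corner.
Proof.
have c3b : c3 \in block by rewrite inE eqxx.
have pair_complete u v : e u v -> complete_set e (u |: [set v])%SET.
  move=> euv; apply/complete_setP => a b; rewrite !inE => /orP[]/eqP-> /orP[]/eqP-> //.
  - by rewrite eqxx.
  - by rewrite e_sym.
  - by rewrite eqxx.
split.
- move=> p p' E.
  have bE v : bit p v = bit p' v by apply/eqP; rewrite -corner_eq E.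
  have := bE c1; have := bE c2; have := bE c3.
  rewrite !bit1 !bit2 !bit_block //.
  by case: p p' {E bE} => [[a b] d] [[a' b'] d'] /= -> -> ->.
(* A complete set containing [c1], [c2] and a vertex of the block would force the block to have a
   single vertex. *)
- move=> C /complete_setP Cc.
  have blind i : (forall p v, v \in C -> bit p v = bit (flip i p) v) ->
      exists i, forall p, agree C (corner p) (corner (flip i p)).
    move=> h; exists i => p; apply/agreeP => v vC; apply/eqP.
    by rewrite corner_eq h.
  have [c1C|c1C] := boolP (c1 \in C); last first.
    apply: (blind 0) => -[[a b] d] v vC; rewrite /bit /=.
    by case: eqP => // v1; rewrite -v1 vC in c1C.
  have [c2C|c2C] := boolP (c2 \in C); last first.
    apply: (blind 1) => -[[a b] d] v vC; rewrite /bit /=.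
    by case: eqP => // _; case: eqP => // v2; rewrite -v2 vC in c2C.
  apply: (blind 2) => -[[a b] d] v vC; rewrite /bit /=.
  case: eqP => // /eqP v1; case: eqP => // /eqP v2.
  case: (boolP (v \in block)) => //= vb.
  have vl : v = last c3 r by apply: block_nbr1 => //; apply: Cc => //; rewrite eq_sym.
  have v3 : v = c3 by apply: block_nbr2 => //; apply: Cc => //; rewrite eq_sym.
  by have := last_neq; rewrite -vl -v3 eqxx.
- have det u v i : e u v ->
      (forall p p', (bit p u == bit p' u) && (bit p v == bit p' v) =
                    (p' == p) || (p' == flip i p)) ->
      exists2 D, complete_set e D &
      forall p p', agree D (corner p) (corner p') = (p' == p) || (p' == flip i p).
    move=> euv h; exists (u |: [set v])%SET => [|p p']; first exact: pair_complete.
    by rewrite agreeU !agree1 !corner_eq h.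
  move=> [|[|i]].
  + apply: (det c2 c3) => // p p'; rewrite !bit2 !bit_block //.
    by case: p p' => [[[] []] []] [[[] []] []].
  + apply: (det c1 (last c3 r)) => // p p'; rewrite !bit1 !bit_block //.
    by case: p p' => [[[] []] []] [[[] []] []].
  + apply: (det c1 c2) => // p p'; rewrite !bit1 !bit2.
    by case: p p' => [[[] []] []] [[[] []] []].
(* Singletons show that [x] takes only the two chosen levels on the block, and the edges of the
   block that it takes the same one throughout. *)
- move=> x loc.
  have one v : exists p, x v = corner p v.
    have vc : complete_set e [set v]%SET.
      by apply/complete_setP => a b; rewrite !inE => /eqP-> /eqP->; rewrite eqxx.
    by have [p] := loc _ vc; rewrite agree1 => /eqP; exists p.
  have blockE w : w \in block -> (x w == l1 w) = (x c3 == l1 c3).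
    have walk s u : path e u s -> {subset u :: s <= block} ->
        {in s, forall w, (x w == l1 w) = (x u == l1 u)}.
      elim: s u => // b s IH u /= /andP[eub ps] sub z.
      have ub : u \in block by apply: sub; rewrite inE eqxx.
      have bb : b \in block by apply: sub; rewrite !inE eqxx orbT.
      have bu : (x b == l1 b) = (x u == l1 u).
        have [p] := loc _ (pair_complete _ _ eub).
        rewrite agreeU !agree1 => /andP[/eqP-> /eqP->].
        by rewrite !ffunE !bit_block //; case: (p.2); rewrite ?eqxx ?(negPf (l01 _)).
      rewrite inE => /predU1P[->//|zs]; rewrite -bu; apply: IH => // t ts.
      by apply: sub; rewrite inE ts orbT.
    by rewrite inE => /predU1P[->//|wr]; apply: walk path_block _ _ wr.
  have x1E v p : x v = corner p v -> bit p v = (x v == l1 v).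
    by move=> ->; rewrite ffunE; case: ifP; rewrite ?eqxx // (negPf (l01 _)).
  exists (x c1 == l1 c1, x c2 == l1 c2, x c3 == l1 c3); apply/ffunP => v.
  have [p xp] := one v; rewrite {1}xp; apply/eqP; rewrite corner_eq.
  rewrite (x1E _ _ xp) /bit /=.
  case: (eqVneq v c1) => [->|v1]; first by rewrite eqxx.
  case: (eqVneq v c2) => [->|v2]; first by rewrite eqxx.
  case: (boolP (v \in block)) => vb /=; first by rewrite blockE.
  by rewrite -(x1E _ _ xp) /bit (negPf v1) (negPf v2) (negPf vb).
(* The vertices where the two corners differ form a connected set that misses [Z], so it cannot meet
   both [X] and [Y]. *)
- move=> X Y Z p p' sep /agreeP Zpp' /forall_inPn[x xX xD] /forall_inPn[y yY yD].
  pose D v := corner p v != corner p' v.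
  pose eD := [rel u v | [&& e u v, D u & D v]].
  have eDs : connect_sym eD.
    by apply: sym_connect_sym => u v /=; rewrite e_sym [D u && _]andbC.
  have D1 : D c1 = (p.1.1 != p'.1.1) by rewrite /D corner_eq !bit1.
  have D2 : D c2 = (p.1.2 != p'.1.2) by rewrite /D corner_eq !bit2.
  have Db w : w \in block -> D w = (p.2 != p'.2).
    by move=> wb; rewrite /D corner_eq !bit_block.
  have conn3 w : p.2 != p'.2 -> w \in block -> connect eD c3 w.
    move=> d3 wb; apply: (@path_connect _ eD c3 r); last exact: wb.
    have sub : {subset c3 :: r <= block} by [].
    elim: r (c3) path_block sub {wb} => //= b s IH u /andP[eub ps] sub.
    rewrite eub !Db ?d3 ?sub ?inE ?eqxx ?orbT //=; apply: IH => // z zs.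
    by apply: sub; rewrite inE zs orbT.
  have inD v : D v -> [\/ v = c1, v = c2 | v \in block].
    rewrite /D corner_eq /bit; case: (eqVneq v c1) => [-> _|_]; first by constructor 1.
    case: (eqVneq v c2) => [-> _|_]; first by constructor 2.
    by case: (boolP (v \in block)) => [vb _|]; [constructor 3 | rewrite eqxx].
  have [h conn] : exists h, forall v, D v -> connect eD h v.
    have [d3|d3] := boolP (p.2 != p'.2).
      exists c3 => v Dv; case: (inD v Dv) => [v1|v2|vb]; last exact: conn3.
        apply: (connect_trans (conn3 (last c3 r) d3 last_block)); apply: connect1.
        by rewrite /= e_sym v1 e1l Db // d3 -v1.
      by apply: connect1; rewrite /= e_sym v2 e23 Db // d3 -v2.
    have nb v : D v -> v \notin block.
      by move=> Dv; apply: contra d3 => vb; rewrite -(Db v).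
    have [d2|d2] := boolP (D c2).
      exists c2 => v Dv; case: (inD v Dv) => [v1|->|vb]; last by have := nb v Dv; rewrite vb.
        by apply: connect1; rewrite /= e_sym v1 e12 d2 -v1.
      exact: connect0.
    exists c1 => v Dv; case: (inD v Dv) => [->|v2|vb]; [exact: connect0| |].
      by rewrite v2 (negPf d2) in Dv.
    by have := nb v Dv; rewrite vb.
  have : connect eD x y by apply: connect_trans (conn y yD); rewrite eDs conn.
  case/connectP => s es yE; case: sep => _ _ _ _ /(_ x y s xX yY).
  case=> [||z zs zZ].
  + by apply: sub_path es => u v /= /and3P[].
  + by rewrite -yE.
  + have : D z; last by rewrite /D (Zpp' z zZ) eqxx.
    move: zs; rewrite inE => /predU1P[->//|].
    elim: s (x) es {yE xX xD} => //= b s IH u /andP[/and3P[_ _ Db'] ps].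
    by rewrite inE => /predU1P[->//|]; apply: IH ps.
Qed.

End ChordlessCycle.

Lemma not_decomposable_obstruction (V : finType) (e : rel V) (I : V -> finType) :
  symmetric e -> irreflexive e -> (forall v, (1 < #|I v|)%N) ->
  ~ decomposable e -> exists corner : bits -> cell I, obstruction e corner.
Proof.
move=> e_sym e_irr levels /boolp.existsNP[c /boolp.not_implyP[cyc /boolp.not_implyP[sz no]]].
have two v : exists l : I v * I v, l.1 != l.2.
  have [l0 _] : exists l0 : I v, l0 \in I v by apply/card_gt0P/ltnW/levels.
  have : (0 < #|predC1 l0|)%N by rewrite cardC1 -subn1 subn_gt0 levels.
  by case/card_gt0P => l1 l10; exists (l0, l1); rewrite eq_sym.
pose l v := xchoose (two v).
case: c => [|c1 [|c2 [|c3 r]]] // in cyc sz no *.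
exists (corner c1 c2 c3 r (fun v => (l v).1) (fun v => (l v).2)).
apply: corner_obstruction => //.
- move=> u v uc vc euv; apply: boolp.contrapT => /boolp.not_orP[nu nv].
  by apply: no; exists u, v; split=> //; apply/eqP.
- by move=> v; exact: xchooseP (two v).
Qed.

(** * Distributions on the corners of a chordless cycle *)

Section NonDecomposable.
Variables (R : realType) (V : finType) (e : rel V) (I : V -> finType).
Variable corner : bits -> cell I.
Hypothesis obs : obstruction e corner.
Implicit Types (p : bits) (x a b : cell I) (P : cell I -> R).

Let cinj : injective corner. Proof. exact: corner_inj obs. Qed.

(** The exponent vector of one of the two terms of the quartic. *)
Definition parity_count (s : bool) x : nat := (\sum_(p | parity p == s) (corner p == x))%N.

Lemma parity_count_corner s p : parity_count s (corner p) = (parity p == s).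
Proof.
rewrite /parity_count big_mkcond (bigD1 p) //= eqxx big1 => [|p' p'p].
  by rewrite addn0; case: eqP.
by rewrite (inj_eq cinj) (negPf p'p); case: ifP.
Qed.

Lemma parity_count_gt0 s x : (0 < parity_count s x)%N ->
  exists2 p, x = corner p & parity p = s.
Proof.
rewrite lt0n sum_nat_eq0 => /forallPn[p]; rewrite negb_imply => /andP[/eqP <-].
by rewrite eqb0 negbK => /eqP <-; exists p.
Qed.

(** Flipping a bit that the clique does not see exchanges even and odd corners without changing
    their projections. *)
Lemma parity_count_congruent :
  congruent (design I e) (parity_count false) (parity_count true).
Proof.
apply/congruentP => C /maxsetp/(corner_blind obs)[i blind] x.
have marg_count s : marg (parity_count s) C x =
    (\sum_(p | parity p == s) agree C (corner p) x)%N.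
  rewrite /marg /parity_count exchange_big /=; apply: eq_bigr => p _.
  case: (boolP (agree C (corner p) x)) => px.
    by rewrite (bigD1 (corner p)) //= eqxx big1 // => y /andP[_ /negPf]; rewrite eq_sym => ->.
  by rewrite big1 // => y yx; case: eqP => // py; rewrite py yx in px.
rewrite !marg_count (reindex_inj (inv_inj (flipK i))) /=.
apply: eq_big => p; first by rewrite parity_flip; case: (parity p).
by rewrite -(agree_eql x (blind p)).
Qed.

Lemma prod_parity_count P s :
  \prod_x P x ^+ parity_count s x = \prod_(p | parity p == s) P (corner p).
Proof.
under eq_bigr do rewrite /parity_count -prodrXr.
rewrite exchange_big /=; apply: eq_bigr => p _.
rewrite (bigD1 (corner p)) //= eqxx expr1 big1 ?mulr1 // => x.
by rewrite eq_sym => /negPf ->.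
Qed.

Lemma toric_parity P : toric_variety (design I e) P ->
  \prod_(p | parity p == false) P (corner p) = \prod_(p | parity p == true) P (corner p).
Proof.
by move=> /toric_varietyP[_ h]; rewrite -!prod_parity_count; exact: h parity_count_congruent.
Qed.

Lemma separated_not_corners X Y Z a b : global_separation e X Y Z -> agree Z a b ->
  (exists2 v, v \in X & a v != b v) -> (exists2 v, v \in Y & a v != b v) ->
  forall p p', a = corner p -> b = corner p' -> False.
Proof.
move=> sep Zab Xab Yab p p' aE bE; move: Zab Xab Yab; rewrite {}aE {}bE.
move=> Zab [v vX vD] [w wY wD]; apply: (corner_separation obs sep Zab).
  by apply/forall_inPn; exists v.
by apply/forall_inPn; exists w.
Qed.

(** The exchanged pair again agrees on [Z] and differs on both [X] and [Y]. *)
Lemma separated_mix_not_corners X Y Z a b : global_separation e X Y Z -> agree Z a b ->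
  (exists2 v, v \in X & a v != b v) -> (exists2 v, v \in Y & a v != b v) ->
  forall p p', mix Y b a = corner p -> mix Y a b = corner p' -> False.
Proof.
move=> sep Zab [v vX vD] [w wY wD]; case: (sep) => XY _ YZ _ _.
apply: separated_not_corners sep _ _ _.
- apply: agree_trans (agree_mixl _ _ _) _; first by rewrite disjoint_sym.
  rewrite agree_sym; apply: agree_trans (agree_mixl _ _ _) Zab.
  by rewrite disjoint_sym.
- by exists v => //; rewrite !mixE (disjointFr XY vX) eq_sym.
- by exists w => //; rewrite !mixE wY.
Qed.

(** Each product in a separation binomial involves a cell that is not a corner. *)
Lemma corner_supported_markov P : (forall x, P x != 0 -> exists p, x = corner p) ->
  markov e P.
Proof.
move=> supp f /separation_binomialP[X [Y [Z [a [b [sep Zab Xab Yab ->]]]]]].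
rewrite /eval_at rmorphB !rmorphM /= -!/(eval_at P _) !eval_indet.
have zero c d : (forall p p', c = corner p -> d = corner p' -> False) -> P c * P d = 0.
  move=> no; apply/eqP; rewrite mulf_eq0; apply: contraT.
  by rewrite negb_or => /andP[/supp[p pE] /supp[p' p'E]]; case: (no p p').
rewrite (zero a b) ?(zero (mix Y b a)) ?subrr //.
  exact: (separated_mix_not_corners sep Zab Xab Yab).
exact: (separated_not_corners sep Zab Xab Yab).
Qed.

Lemma obstruction_not_markov :
  exists P, [/\ distribution P, markov e P & ~ factors e P].
Proof.
pose K := (\sum_x parity_count false x)%N.
have K0 : (0 < K)%N.
  rewrite /K (bigD1 (corner (false, false, false))) //= parity_count_corner //.
have K0R : K%:R != 0 :> R by rewrite pnatr_eq0 -lt0n.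
pose P x : R := (parity_count false x)%:R / K%:R.
have P0 x : (P x != 0) = (0 < parity_count false x)%N.
  by rewrite mulf_eq0 invr_eq0 (negPf K0R) orbF pnatr_eq0 lt0n.
exists P; split.
- split=> [x|]; first by rewrite divr_ge0 ?ler0n.
  by rewrite -mulr_suml -natr_sum mulfV.
- by apply: corner_supported_markov => x; rewrite P0 => /parity_count_gt0[p]; exists p.
(* The product over the odd corners is 0, the one over the even corners is not. *)
- move=> /image_toric/toric_parity; rewrite [RHS](bigD1 (true, false, false)) //=.
  have -> : P (corner (true, false, false)) = 0.
    by apply/eqP; rewrite -[_ == 0]negbK P0 parity_count_corner.
  move/eqP; rewrite mul0r; apply/negP/prodf_neq0 => p /eqP pE.
  by rewrite P0 parity_count_corner pE.
Qed.

(** Either term of the quartic may lead. Both are supported on corners, so a separation binomial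
    whose leading term divides one of them would contain a product of two corners. *)
Lemma obstruction_not_groebner (ord : rel (multinom #|cell I|)) (B : seq (mpoly #|cell I| R)) :
  term_order ord -> groebner_basis ord (toric_ideal R (design I e)) B ->
  (forall f, f \in B -> separation_binomial e f) -> False.
Proof.
case=> -[ordxx _ _ ord_total] _ [_ inB] Bsep.
pose q s : multinom #|cell I| := monomial (parity_count s).
have q_neq : q false != q true.
  apply/eqP => /(congr1 (@expo _ ^~ (corner (true, false, false)))).
  by rewrite /= !monomialK !parity_count_corner.
have supp s : q s \in msupp (mpolyX R (q false) - mpolyX R (q true)).
  rewrite mcoeff_msupp mcoeffB !mcoeffX; case: s; rewrite ?eqxx.
    by rewrite (negPf q_neq) sub0r oppr_eq0 oner_eq0.
  by rewrite [q true == _]eq_sym (negPf q_neq) subr0 oner_eq0.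
have [s lead] : exists s, leading_monomial ord (mpolyX R (q false) - mpolyX R (q true)) (q s).
  have supp' m : m \in msupp (mpolyX R (q false) - mpolyX R (q true)) -> m = q false \/ m = q true.
    by move/msuppB_le; rewrite mem_cat !msuppX !inE => /orP[]/eqP; [left|right].
  have /orP[h|h] := ord_total (q false) (q true); [exists true | exists false];
    by split=> // m /supp'[] ->.
have : initial_ideal ord (toric_ideal R (design I e)) (mpolyX R (q s)).
  exists 1%N, (fun=> 1), (fun=> mpolyX R (q s)).
  split=> [_|]; last by rewrite big_ord1 mul1r.
  exists (mpolyX R (q false) - mpolyX R (q true)), (q s); split=> //.
  by rewrite -!prod_indet; apply: toric_binomial; exact: parity_count_congruent.
rewrite -inB => -[k [g [b [bB E]]]].
have [i] : exists i, mcoeff (q s) (g i * b i) != 0.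
  apply: boolp.contrapT => /boolp.forallNP h.
  have := congr1 (mcoeff (q s)) E; rewrite mcoeffX eqxx raddf_sum big1 => [/eqP|i _].
    by rewrite oner_eq0.
  by apply/eqP; have /negP := h i; rewrite negbK.
have [f [m [fB [mf _] ->]]] := bB i.
rewrite -mcoeff_msupp => /msuppM_le/allpairsP[[m1 m2] /= [_]].
rewrite msuppX inE => /eqP -> qE.
have dvd x : (0 < expo m x)%N -> exists p, x = corner p.
  move=> mx; have [|p ->] := @parity_count_gt0 s x; last by exists p.
  by rewrite -monomialK -/(q s) qE expoD addn_gt0 mx orbT.
have /separation_binomialP[X [Y [Z [a [c [sep Zac Xac Yac fE]]]]]] := Bsep f fB.
move: mf; rewrite fE !indetM => /msuppB_le; rewrite mem_cat !msuppX !inE.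
case/orP => /eqP mE.
  have [p pE] : exists p, a = corner p by apply: dvd; rewrite mE expo_quadric eqxx.
  have [p' p'E] : exists p, c = corner p by apply: dvd; rewrite mE expo_quadric eqxx addn1.
  exact: (separated_not_corners sep Zac Xac Yac pE p'E).
have [p pE] : exists p, mix Y c a = corner p by apply: dvd; rewrite mE expo_quadric eqxx.
have [p' p'E] : exists p, mix Y a c = corner p by apply: dvd; rewrite mE expo_quadric eqxx addn1.
exact: (separated_mix_not_corners sep Zac Xac Yac pE p'E).
Qed.

Definition constant_bits p := (p == (false, false, false)) || (p == (true, true, true)).

Definition equal_bits (i : nat) p : bool :=
  let: (a, b, c) := p in match i with 0 => b == c | 1 => a == c | _ => a == b end.

Lemma equal_bits_flip i p : equal_bits i (flip i p) = equal_bits i p.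
Proof. by case: i p => [|[|i]] [[a b] c]. Qed.

(* For [t > 0] this is [t^-1] times the product over the edges of the triangle of
   [t] or [1], according to whether the two bits agree. *)
Definition pinched (t : R) x : R :=
  \sum_(p | corner p == x) (if constant_bits p then t * t else 1).

Lemma pinched_corner t p : pinched t (corner p) = if constant_bits p then t * t else 1.
Proof. by rewrite /pinched (eq_bigl (pred1 p)) ?big_pred1_eq // => p'; rewrite (inj_eq cinj). Qed.

Lemma pinched_other t x : (forall p, x <> corner p) -> pinched t x = 0.
Proof. by move=> no; rewrite /pinched big_pred0 // => p; apply/eqP => /esym /no. Qed.

(** If all bits agree the three edge potentials give [t ^+ 3]; otherwise exactly one pair agrees and
    they give [t]. The constant [t^-1] corrects both. *)
Lemma pinched_factors t : 0 < t -> factors e (pinched t).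
Proof.
move=> t0.
pose loc (D : {set V}) x := [exists p, agree D x (corner p)].
have fc : factors e (fun _ : cell I => t^-1).
  by apply: (factors_potential (complete0 e)) => // _; rewrite invr_ge0 ltW.
(* By [corner_local] this product is the indicator function of the corners. *)
have floc : factors e (fun x => \prod_(D | complete_set e D) (loc D x)%:R : R).
  apply: factors_prod => D Dc; apply: (factors_potential Dc) => [x|x y xy].
    by rewrite ler0n.
  by congr (_ _)%:R; apply: eq_existsb => p; exact: agree_eql.
have edge i : exists2 psi : cell I -> R, factors e psi &
    forall p, psi (corner p) = if equal_bits i p then t else 1.
  have [D Dc det] := corner_detect obs i.
  exists (fun x => if [exists p, agree D x (corner p) && equal_bits i p] then t else 1).
    apply: (factors_potential Dc) => [x|x y xy]; first by case: ifP; rewrite ?ler01 ?ltW.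
    by congr (if _ then _ else _); apply: eq_existsb => p; rewrite (agree_eql _ xy).
  move=> p; congr (if _ then _ else _); apply/existsP/idP => [[p' /andP[]]|pe].
    by rewrite det => /orP[]/eqP -> //; rewrite equal_bits_flip.
  by exists p; rewrite agree_refl.
have [psi0 f0 psi0E] := edge 0%N; have [psi1 f1 psi1E] := edge 1%N.
have [psi2 f2 psi2E] := edge 2.
have := factorsM (factorsM fc floc) (factorsM f0 (factorsM f1 f2)).
congr factors; apply/boolp.funext => x.
have [[p ->]|no] := boolp.pselect (exists p, x = corner p); last first.
  rewrite pinched_other => [|p xp]; last by apply: no; exists p.
  have [D Dc Dx] : exists2 D, complete_set e D & ~~ loc D x.
    apply: boolp.contrapT => h; apply: no; apply: (corner_local obs) => D Dc.
    apply: boolp.contrapT => nD; apply: h; exists D => //.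
    by apply/existsP => -[p px]; apply: nD; exists p.
  by rewrite (bigD1 D) //= (negPf Dx) !(mul0r, mulr0).
rewrite pinched_corner psi0E psi1E psi2E big1 => [|D _]; last first.
  by rewrite /loc; case: existsP => // -[]; exists p; exact: agree_refl.
rewrite mulr1; have tn : t != 0 by rewrite gt_eqF.
by case: p => [[[] []] []]; rewrite /= ?mulr1 ?mul1r ?mulVf // mulKf.
Qed.

(** The zero at 000 would come from a zero parameter of some clique; flipping a bit which that
    clique does not see gives another zero, where the value is 1. *)
Lemma pinched0_not_factors : ~ factors e (pinched 0).
Proof.
case=> t t0 tE.
have := pinched_corner 0 (false, false, false); rewrite /= mul0r -tE => /eqP.
rewrite prodf_seq_eq0 => /hasP[row _ /=].
rewrite expf_eq0 => /andP[]; rewrite lt0b => /eqP rowE trow.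
have [i blind] := corner_blind obs (maxsetp (valP (tag row))).
have : pinched 0 (corner (flip i (false, false, false))) = 0.
  rewrite -tE /phi (bigD1 row) //= /design -rowE.
  have := blind (false, false, false); rewrite -eq_proj eq_sym => ->.
  by rewrite expr1 (eqP trow) mul0r.
by rewrite pinched_corner; case: i {blind} => [|[|i]] /= /eqP; rewrite oner_eq0.
Qed.

End NonDecomposable.

(** * A limit of factoring functions outside the model *)

Section NotClosed.
Local Open Scope classical_set_scope.
Local Open Scope ring_scope.
Variables (R : realType) (V : finType) (e : rel V) (I : V -> finType).
Variable corner : bits -> cell I.
Hypothesis obs : obstruction e corner.

Lemma obstruction_not_closed :
  ~ closed (image_phi R (design I e) : set {ptws cell I -> R}).
Proof.
move=> cl; apply: (@pinched0_not_factors R _ _ _ _ obs).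
have lim : (fun t : R => pinched corner t : {ptws cell I -> R}) @ 0^'+ -->
    (pinched corner 0 : {ptws cell I -> R}).
  apply/cvg_sup => x U [W [[O oO <-] O0 WU]].
  have cvgx : (fun t : R => pinched corner t x) @ 0^'+ --> pinched corner 0 x.
    apply: cvg_at_right_filter.
    have [[p ->]|no] := boolp.pselect (exists p, x = corner p); last first.
      have z (t : R) : pinched corner t x = 0 by apply: pinched_other => p xp; apply: no; exists p.
      by rewrite (boolp.funext z) z; exact: cvg_cst.
    rewrite (boolp.funext (fun t => pinched_corner obs t p)) (pinched_corner obs).
    by case: ifP => _; [apply: cvgM; exact: cvg_id | exact: cvg_cst].
  by apply: filterS WU _; apply: cvgx; apply: open_nbhs_nbhs.
apply: (closed_cvg _ cl _ _ lim); near=> t; apply: pinched_factors => //.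
Unshelve. all: by end_near.
Qed.

End NotClosed.

(** * The likelihood equations *)

Section Score.
Variable R : realType.

Lemma bernoulli (t : R) n : -1 <= t -> 1 + n%:R * t <= (1 + t) ^+ n.
Proof.
move=> t1; elim: n => [|n IH]; first by rewrite mul0r addr0 expr0.
have t0 : 0 <= 1 + t by lra.
have n0 : 0 <= n%:R :> R by rewrite ler0n.
rewrite exprS; apply: le_trans (ler_wpM2l t0 IH).
by rewrite -natr1; nra.
Qed.

Lemma expr_quadratic_bound n : exists2 K : R, 0 <= K & forall y, -1 <= y <= 1 ->
  (1 + y) ^+ n <= 1 + n%:R * y + K * y ^+ 2.
Proof.
elim: n => [|n [K K0 IH]]; first by exists 0 => // y _; rewrite expr0; lra.
exists (n%:R + 2 * K) => [|y /andP[y1 y2]]; first by rewrite addr_ge0 ?mulr_ge0.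
have y0 : 0 <= 1 + y by lra.
rewrite exprS; apply: le_trans (ler_wpM2l y0 (IH y _)) _; first by rewrite y1.
rewrite -natr1 -subr_ge0.
have -> : 1 + (n%:R + 1) * y + (n%:R + 2 * K) * y ^+ 2 -
  (1 + y) * (1 + n%:R * y + K * y ^+ 2) = K * y ^+ 2 * (1 - y) by ring.
by apply: mulr_ge0; [rewrite mulr_ge0 ?sqr_ge0 | lra].
Qed.

(** Both sides are 1 at [t = 0], so the inequality for [t] of either sign forces equal derivatives
    [M] and [N * q]; [bernoulli] and a quadratic upper bound replace differentiation. *)
Lemma tangent_exponents (q : R) M N : 0 <= q <= 1 ->
  (forall t, -1 < t -> (1 + t) ^+ M <= (1 + t * q) ^+ N) -> M%:R = N%:R * q.
Proof.
move=> /andP[q0 q1] h; have [K K0 Kb] := expr_quadratic_bound N.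
have bound t : -1 < t <= 1 -> M%:R * t <= N%:R * q * t + K * t ^+ 2.
  move=> /andP[t1 t2].
  have y1 : -1 <= t * q <= 1 by apply/andP; split; nra.
  have := le_trans (le_trans (bernoulli M (ltW t1)) (h t t1)) (Kb _ y1).
  have : K * (t * q) ^+ 2 <= K * t ^+ 2.
    by apply: ler_wpM2l => //; rewrite exprMn ler_piMr ?sqr_ge0 // expr_le1.
  nra.
set d := M%:R - N%:R * q.
suff d0 : d = 0 by apply/eqP; rewrite -subr_eq0 -/d d0.
have small (r : R) : (forall t, 0 < t <= 2^-1 -> r <= K * t) -> r <= 0.
  move=> H; rewrite leNgt; apply/negP => r0.
  have K1 : 0 < 2 * K + 2 * r + 1 by lra.
  (* This makes [t] at most 1/2 and [K * t] smaller than [r]. *)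
  pose t := r / (2 * K + 2 * r + 1).
  have t0 : 0 < t by rewrite divr_gt0.
  have tE : t * (2 * K + 2 * r + 1) = r by rewrite divfK ?gt_eqF.
  have t1 : t <= 2^-1 by nra.
  by have := H t; rewrite t0 t1 => /(_ isT); nra.
apply/eqP; rewrite eq_le; apply/andP; split.
  apply: small => t /andP[t0 t1]; have t2 : -1 < t by lra.
  have t3 : t <= 1 by lra.
  by have := bound t; rewrite t2 t3 => /(_ isT); rewrite /d; nra.
rewrite -oppr_le0; apply: small => t /andP[t0 t1].
have t2 : -1 < - t by lra.
have t3 : - t <= 1 by lra.
by have := bound (- t); rewrite t2 t3 => /(_ isT); rewrite /d; nra.
Qed.

Variables (V : finType) (e : rel V) (I : V -> finType).
Implicit Types (P Q : cell I -> R) (m u w : cell I -> nat).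

Lemma congruent_total u w : congruent (design I e) u w -> (\sum_x u x = \sum_x w x)%N.
Proof.
move=> /congruentP/marg_complete/(_ _ (complete0 e)) h.
case: (pickP (predT : pred (cell I))) => [x _|no]; first by have := h x; rewrite !marg0.
by rewrite !big_pred0 // => x; have := no x.
Qed.

(* Perturbing the maximizer by [(1 + t) ^+ A i x] stays on the toric variety. *)
Lemma mle_design m P (i : design_row I e) : distribution P ->
  toric_variety (design I e) P -> 0 < likelihood m P ->
  (forall Q, distribution Q -> toric_variety (design I e) Q ->
     likelihood m Q <= likelihood m P) ->
  (row_sum (design I e) m i)%:R = (\sum_x m x)%N%:R * \sum_x P x *+ design I e i x.
Proof.
move=> [P0 P1] /toric_varietyP[_ tP] L0 Pmax.
set q := \sum_x P x *+ design I e i x.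
have q0 : 0 <= q by apply: sumr_ge0 => x _; rewrite mulrn_wge0.
have q1 : q <= 1.
  by rewrite -P1; apply: ler_sum => x _; rewrite /design; case: eqP; rewrite ?mulr1n ?mulr0n.
apply: tangent_exponents => [|t t1]; first by rewrite q0.
have t0 : 0 < 1 + t by lra.
have Z0 : 0 < 1 + t * q.
  have qt : 0 <= q * (1 + t) by rewrite mulr_ge0 // ltW.
  case: (ltP q 1) => q1'; first by lra.
  by have -> : q = 1; [apply/eqP; rewrite eq_le q1 | lra].
pose Q x := P x * (1 + t) ^+ design I e i x / (1 + t * q).
have prodQ u : \prod_x Q x ^+ u x = \prod_x P x ^+ u x *
    (1 + t) ^+ row_sum (design I e) u i / (1 + t * q) ^+ (\sum_x u x)%N.
  rewrite /Q; under eq_bigr do rewrite !exprMn exprVn.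
  rewrite !big_split /= prodfV !prodrXr; congr (_ * _ / _).
  by rewrite -prodrXr; apply: eq_bigr => x _; rewrite exprM.
have Qpos x : 0 <= Q x by rewrite /Q divr_ge0 ?mulr_ge0 ?exprn_ge0 // ltW.
have dQ : distribution Q.
  split=> //; rewrite -mulr_suml.
  have -> : \sum_x P x * (1 + t) ^+ design I e i x = \sum_x (P x + t * (P x *+ design I e i x)).
    apply: eq_bigr => x _; rewrite /design; case: eqP => _ /=.
      by rewrite expr1 mulr1n; ring.
    by rewrite expr0 mulr0n; ring.
  by rewrite big_split /= P1 -mulr_sumr mulfV // gt_eqF.
have tQ : toric_variety (design I e) Q.
  apply/toric_varietyP; split=> // u w uw.
  by rewrite !prodQ (tP u w uw) uw (congruent_total uw).
have := Pmax Q dQ tQ; rewrite /likelihood prodQ -mulrA ger_pMr // ler_pdivrMr ?mul1r //.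
by rewrite exprn_gt0.
Qed.

Lemma uniform_likelihood (x0 : cell I) m : exists Q, [/\ distribution Q,
  toric_variety (design I e) Q & 0 < likelihood m Q].
Proof.
pose n : R := #|cell I|%:R.
have n0 : 0 < n by rewrite ltr0n; apply/card_gt0P; exists x0.
exists (fun=> n^-1); split.
- split=> [_|]; first by rewrite invr_ge0 ltW.
  by rewrite sumr_const -mulr_natl mulfV // gt_eqF.
- apply/toric_varietyP; split=> [_|u w /congruent_total uw]; first by rewrite invr_ge0 ltW.
  by rewrite !prodrXr uw.
- by apply: prodr_gt0 => x _; rewrite exprn_gt0 // invr_gt0.
Qed.

(** The likelihood equations and the binomials; scaling by the total respects the latter because
    congruent exponents have equal degree. *)
Lemma mle_margins m (mhat : cell I -> R) : (exists x, m x != 0%N) ->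
  is_mle (design I e) m mhat ->
  [/\ forall x, 0 <= mhat x,
      forall D, complete_set e D -> forall x, marg mhat D x = marg (fun y => (m y)%:R) D x
    & forall u w, congruent (design I e) u w -> \prod_x mhat x ^+ u x = \prod_x mhat x ^+ w x].
Proof.
move=> [x0 _] [P [dP tP Pmax mE]].
have [P0 tP'] := (iffLR (toric_varietyP _ _)) tP.
have [Q [dQ tQ Q0]] := uniform_likelihood x0 m.
have L0 : 0 < likelihood m P by apply: lt_le_trans Q0 (Pmax Q dQ tQ).
split=> [x|D Dc x|u w uw].
- by rewrite mE mulr_ge0.
- apply: marg_complete Dc x; apply: eq_marg_design => i.
  have := mle_design i dP tP L0 Pmax; rewrite mulr_sumr /row_sum natr_sum => E.
  transitivity (\sum_x (design I e i x * m x)%N%:R : R).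
    by rewrite E; apply: eq_bigr => x _; rewrite mE mulrnAr.
  by apply: eq_bigr => x _; rewrite natrM mulr_natl.
- under eq_bigr do rewrite mE exprMn; under [RHS]eq_bigr do rewrite mE exprMn.
  by rewrite !big_split /= !prodrXr (congruent_total uw) (tP' u w uw).
Qed.

End Score.

(** * Growth of polynomials *)

Section Growth.
Variable R : realType.
Implicit Types (p q : {poly R}).

Lemma poly_upper p n : (size p <= n.+1)%N ->
  exists2 S : R, 0 <= S & forall t, 1 <= t -> `|p.[t]| <= S * t ^+ n.
Proof.
move=> sp; exists (\sum_(i < size p) `|p`_i|) => [|t t1]; first exact: sumr_ge0.
rewrite horner_coef mulr_suml; apply: le_trans (ler_norm_sum _ _ _) _.
apply: ler_sum => i _; rewrite normrM; apply: ler_wpM2l => //.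
rewrite normrX ger0_norm ?(le_trans ler01) //; apply: ler_weXn2l => //.
by rewrite -ltnS (leq_trans (ltn_ord i)).
Qed.

Lemma poly_lower p : p != 0 ->
  exists2 c : R, 0 < c & exists T : R, forall t, T <= t -> c * t ^+ (size p).-1 <= `|p.[t]|.
Proof.
move=> p0; set d := (size p).-1; set a := lead_coef p.
have a0 : 0 < `|a| by rewrite normr_gt0 lead_coef_eq0.
have [d0|d0] := posnP d.
  have /size_poly1P[c c0 ->] : size p == 1%N.
    by rewrite -[size p]prednK ?lt0n ?size_poly_eq0 // -/d d0.
  exists `|c|; first by rewrite normr_gt0.
  by exists 0 => t _; rewrite d0 mulr1 hornerC.
pose r := p - a *: 'X^d.
have sr : (size r <= d.-1.+1)%N.
  rewrite prednK //; apply/leq_sizeP => j dj; rewrite coefB coefZ coefXn.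
  case: eqP => [->|/eqP jd]; first by rewrite mulr1 subrr.
  rewrite mulr0 subr0 nth_default // -[size p]prednK ?lt0n ?size_poly_eq0 //.
  by rewrite -/d ltn_neqAle eq_sym jd.
have [S S0 Sb] := poly_upper sr.
exists (`|a| / 2); first by rewrite divr_gt0.
exists (Num.max 1 (2 * S / `|a|)) => t; rewrite ge_max => /andP[t1 tS].
have t0 : 0 <= t by rewrite (le_trans ler01).
have -> : p.[t] = a * t ^+ d + r.[t] by rewrite /r hornerD hornerN hornerZ hornerXn addrC subrK.
have := lerB_normD (a * t ^+ d) r.[t].
apply: le_trans; rewrite normrM normrX (ger0_norm t0).
have : `|r.[t]| <= `|a| / 2 * t ^+ d; last lra.
apply: le_trans (Sb t t1) _; rewrite -{2}(prednK d0) exprS mulrA.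
apply: ler_wpM2r; first exact: exprn_ge0.
by move: tS; rewrite ler_pdivrMr //; lra.
Qed.

(** A polynomial of larger degree would win at large natural numbers. *)
Lemma poly_size_le p q (C T : R) :
  (forall k : nat, T <= k%:R -> `|p.[k%:R]| <= C * `|q.[k%:R]|) -> (size p <= size q)%N.
Proof.
move=> h; rewrite leqNgt; apply/negP => lt.
have p0 : p != 0 by rewrite -size_poly_eq0 -lt0n (leq_ltn_trans _ lt).
have [c c0 [T' Tp]] := poly_lower p0.
have sq : (size q <= (size p).-2.+1)%N.
  by move: lt; case: (size p) => [|[|n]]; rewrite ?ltnS //; case: (size q).
have [S S0 Sb] := poly_upper sq.
pose B := Num.max (Num.max T T') (Num.max 1 ((`|C| * S + 1) / c)).
have [k Bk] : exists k : nat, B <= k%:R.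
  by exists (Num.bound B); apply/ltW/archi_boundP; rewrite !le_max ler01 !orbT.
move: Bk; rewrite !ge_max => /andP[/andP[k1 k2] /andP[k3 k4]].
have := le_trans (Tp _ k2) (h k k1); apply/negP; rewrite -ltNge.
have CS : C * `|q.[k%:R]| <= `|C| * (S * k%:R ^+ (size p).-2).
  apply: le_trans (ler_wpM2r (normr_ge0 _) (ler_norm C)) _.
  by apply: ler_wpM2l (Sb _ k3).
apply: le_lt_trans CS _.
have kn : 0 < k%:R ^+ (size p).-2 :> R by rewrite exprn_gt0 // (lt_le_trans ltr01).
have [sp1|sp1] := leqP (size p) 1.
  have q0 : q = 0 by apply/eqP; rewrite -size_poly_eq0 -leqn0 -ltnS (leq_trans lt).
  have := le_trans (Tp _ k2) (h k k1); rewrite q0 horner0 normr0 mulr0.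
  by rewrite leNgt mulr_gt0 // exprn_gt0 // (lt_le_trans ltr01).
have -> : (size p).-1 = (size p).-2.+1 by rewrite prednK // -ltnS prednK // ltnW.
rewrite exprS !mulrA ltr_pM2r //; move: k4; rewrite ler_pdivrMr //; lra.
Qed.

Lemma poly_nat_neq0 p : p != 0 -> exists T : R, forall t, T <= t -> p.[t] != 0.
Proof.
move=> /poly_lower[c c0 [T Tp]]; exists (Num.max 1 T) => t.
rewrite ge_max => /andP[t1 /Tp]; rewrite -normr_gt0; apply: lt_le_trans.
by rewrite mulr_gt0 // exprn_gt0 // (lt_le_trans ltr01).
Qed.

Lemma nat_above (T : R) : exists k : nat, T <= k%:R.
Proof.
exists (Num.bound (Num.max 1 T)); apply: le_trans (ltW (archi_boundP _)).
  by rewrite le_max lexx orbT.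
by rewrite le_max ler01.
Qed.

End Growth.

(** * Restriction to curves and nonvanishing at natural points *)

Section Substitution.
Variables (R : realType) (n : nat).
Implicit Types (f : mpoly n R) (m : multinom n).

Definition subst (gamma : 'I_n -> {poly R}) f : {poly R} := mmap polyC gamma f.

Lemma horner_subst gamma f t : (subst gamma f).[t] = meval (fun i => (gamma i).[t]) f.
Proof.
rewrite /subst /mmap mevalE horner_sum; apply: eq_bigr => m _.
by rewrite hornerM hornerC horner_prod; congr (_ * _); apply: eq_bigr => i _; rewrite horner_exp.
Qed.

Definition code (B k : nat) (m : nat -> nat) : nat := (\sum_(i < k) m i * B ^ i)%N.

Lemma code_lt B k (m : nat -> nat) : (forall i, m i < B)%N -> (code B k m < B ^ k)%N.
Proof.
move=> mB; elim: k => [|k IH]; first by rewrite /code big_ord0.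
rewrite /code big_ord_recr /= -/(code B k m) expnS.
by apply: leq_trans (leq_mul (mB k) (leqnn _)); rewrite mulSn ltn_add2r.
Qed.

Lemma code_inj B k (m m' : nat -> nat) : (forall i, m i < B)%N -> (forall i, m' i < B)%N ->
  code B k m = code B k m' -> forall i, (i < k)%N -> m i = m' i.
Proof.
move=> mB mB'; elim: k => [//|k IH]; rewrite /code !big_ord_recr /=.
rewrite -!/(code B k _) ![(code B k _ + _)%N]addnC.
move=> /(digit_inj (code_lt k mB) (code_lt k mB'))[mk /IH E] i.
by rewrite ltnS leq_eqVlt => /predU1P[->|/E].
Qed.

(* Kronecker substitution: [X_i := T^(B^i)] separates the monomials of [f]. *)
Lemma mpoly_nat_neq0 f : f != 0 -> exists w : 'I_n -> nat, meval (fun i => (w i)%:R) f != 0.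
Proof.
move=> f0; pose B := (\max_(m <- msupp f) mdeg m)%N.+1.
pose gamma (i : 'I_n) : {poly R} := 'X^(B ^ i).
pose dig m (i : nat) := if insub i is Some j then fun_of_multinom m j else 0%N.
have digE m (i : 'I_n) : dig m i = m i by rewrite /dig valK.
have dig_lt m : m \in msupp f -> forall i, (dig m i < B)%N.
  move=> mf i; rewrite /dig ltnS; case: insubP => // j _ _.
  apply: (@leq_trans (mdeg m)); first by rewrite mdegE (bigD1 j) //= leq_addr.
  exact: leq_bigmax_seq.
have substE : subst gamma f = \sum_(m <- msupp f) mcoeff m f *: 'X^(code B n (dig m)).
  apply: eq_bigr => m _; rewrite mul_polyC; congr (_ *: _); rewrite /mmap1.
  rewrite /code -prodrXr; apply: eq_bigr => i _.
  by rewrite /gamma -exprM digE mulnC.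
have [m0 m0f] : exists m, m \in msupp f.
  have := f0; rewrite -msupp_eq0; case: (msupp f) => // m s _.
  by exists m; rewrite inE eqxx.
have sub0 : subst gamma f != 0.
  apply/eqP => /(congr1 (fun q : {poly R} => q`_(code B n (dig m0)))).
  rewrite substE coef_sum coef0 (bigD1_seq m0) ?msupp_uniq //= coefZ coefXn eqxx mulr1.
  rewrite big1_seq ?addr0 => [/eqP|m /andP[mm0 mf]]; first by rewrite mcoeff_eq0 m0f.
  rewrite coefZ coefXn; case: eqP => [E|_]; last by rewrite mulr0.
  case/eqP: mm0; apply/mnmP => i; rewrite -!digE.
  by apply: (code_inj (dig_lt m mf) (dig_lt m0 m0f) (esym E)).
have [T hT] := poly_nat_neq0 sub0; have [k /hT] := nat_above T.
rewrite horner_subst => k0; exists (fun i => (k ^ (B ^ i))%N).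
apply: contra_neq k0 => E; rewrite -[RHS]E; apply: meval_eq => i.
by rewrite hornerXn natrX.
Qed.

End Substitution.

(** * Growth of the estimate on a chordless cycle *)

Section CubicGrowth.
Variable R : realFieldType.
Implicit Types (K E s a b t z : R).

Lemma ler_pM4 (x1 x2 x3 x4 y1 y2 y3 y4 : R) :
  0 <= x1 <= y1 -> 0 <= x2 <= y2 -> 0 <= x3 <= y3 -> 0 <= x4 <= y4 ->
  x1 * x2 * x3 * x4 <= y1 * y2 * y3 * y4.
Proof.
move=> /andP[a1 b1] /andP[a2 b2] /andP[a3 b3] /andP[a4 b4].
by do 3 (apply: ler_pM; rewrite ?mulr_ge0 //).
Qed.

(** If [s] exceeds [4 * E], then [a] and [b] are at least [s / 2] and [t] at least [K ^+ 2 / 2],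
    while the right-hand product is at most [16 * K ^+ 4]. *)
Lemma quartic_upper K E s a b t z1 z2 z3 z4 :
  0 < K -> 0 <= E -> 4 * E <= K ^+ 2 -> E ^+ 3 <= K ^+ 2 -> 0 <= s ->
  s - 2 * E <= a -> s - 2 * E <= b -> K ^+ 2 - 2 * E <= t ->
  0 <= z1 <= 2 * K -> 0 <= z2 <= 2 * K -> 0 <= z3 <= 2 * K -> 0 <= z4 <= 2 * K ->
  t * s * a * b = z1 * z2 * z3 * z4 -> s ^+ 3 <= 128 * K ^+ 2.
Proof.
move=> K0 E0 EK E3 s0 sa sb tK hz1 hz2 hz3 hz4 quartic.
have K2 : 0 < K ^+ 2 by rewrite exprn_gt0.
have [sE|sE] := leP s (4 * E).
  have : s ^+ 3 <= (4 * E) ^+ 3 by apply: lerXn2r => //; rewrite nnegrE ?mulr_ge0.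
  rewrite exprMn => h; apply: le_trans h _; move: E3 K2; clear; lra.
have zb := ler_pM4 hz1 hz2 hz3 hz4.
have low : K ^+ 2 / 2 * s * (s / 2) * (s / 2) <= t * s * a * b.
  apply: ler_pM4; apply/andP; split; rewrite ?divr_ge0 ?sqr_ge0 //.
  - by move: tK EK; clear; lra.
  - by move: sE sa; clear; lra.
  - by move: sE sb; clear; lra.
have : K ^+ 2 * s ^+ 3 <= K ^+ 2 * (128 * K ^+ 2).
  have -> : K ^+ 2 * s ^+ 3 = 8 * (K ^+ 2 / 2 * s * (s / 2) * (s / 2)) by field.
  have -> : K ^+ 2 * (128 * K ^+ 2) = 8 * (2 * K * (2 * K) * (2 * K) * (2 * K)) by ring.
  by apply: ler_wpM2l => //; rewrite (le_trans low) // quartic.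
by rewrite ler_pM2l.
Qed.

(** The quartic gives [K ^+ 2 <= 32 * (s + 2 * E) ^+ 3]; the bound on [E] excludes [s < 2 * E], so
    the cube is at most that of [2 * s]. *)
Lemma quartic_lower K E s a b t z1 z2 z3 z4 :
  0 < K -> 0 <= E -> 32 * (64 * E ^+ 3) < K ^+ 2 -> 0 <= s ->
  0 <= a <= s + 2 * E -> 0 <= b <= s + 2 * E -> 0 <= t <= 2 * K ^+ 2 ->
  K / 2 <= z1 -> K / 2 <= z2 -> K / 2 <= z3 -> K / 2 <= z4 ->
  t * s * a * b = z1 * z2 * z3 * z4 -> K ^+ 2 <= 256 * s ^+ 3.
Proof.
move=> K0 E0 E3 s0 ha hb ht hz1 hz2 hz3 hz4 quartic.
have K2 : 0 < K ^+ 2 by rewrite exprn_gt0.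
have K20 : 0 <= K / 2 by rewrite divr_ge0 // ltW.
have sE0 : 0 <= s + 2 * E by rewrite addr_ge0 ?mulr_ge0.
have zlow : K / 2 * (K / 2) * (K / 2) * (K / 2) <= z1 * z2 * z3 * z4.
  by apply: ler_pM4; rewrite K20.
have high : t * s * a * b <= 2 * K ^+ 2 * (s + 2 * E) * (s + 2 * E) * (s + 2 * E).
  by apply: ler_pM4 => //; rewrite s0 lerDl mulr_ge0.
have cub : K ^+ 2 <= 32 * (s + 2 * E) ^+ 3.
  suff : K ^+ 2 * K ^+ 2 <= K ^+ 2 * (32 * (s + 2 * E) ^+ 3) by rewrite ler_pM2l.
  have -> : K ^+ 2 * K ^+ 2 = 16 * (K / 2 * (K / 2) * (K / 2) * (K / 2)) by field.
  have -> : K ^+ 2 * (32 * (s + 2 * E) ^+ 3) =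
    16 * (2 * K ^+ 2 * (s + 2 * E) * (s + 2 * E) * (s + 2 * E)) by ring.
  by apply: ler_wpM2l => //; rewrite (le_trans zlow) // -quartic.
have [sE|sE] := ltP s (2 * E).
  have : (s + 2 * E) ^+ 3 <= (4 * E) ^+ 3.
    by apply: lerXn2r; rewrite ?nnegrE ?mulr_ge0 //; move: sE; clear; lra.
  by rewrite exprMn; move: cub E3; clear; lra.
have : (s + 2 * E) ^+ 3 <= (2 * s) ^+ 3.
  by apply: lerXn2r; rewrite ?nnegrE ?mulr_ge0 //; move: sE; clear; lra.
by rewrite exprMn; move: cub; clear; lra.
Qed.

(** Through the edge sums this keeps the odd values above [K / 2], as [quartic_lower] requires. *)
Lemma cube_small K s : 0 < K -> 64 * 128 < K -> 0 <= s -> s ^+ 3 <= 128 * K ^+ 2 -> s <= K / 4.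
Proof.
move=> K0 KL s0 h; rewrite leNgt; apply/negP => Ks.
have K40 : 0 <= K / 4 by rewrite divr_ge0 // ltW.
have : (K / 4) ^+ 3 < s ^+ 3 by apply: ltrXn2r.
have -> : (K / 4) ^+ 3 = K * K ^+ 2 / 64 by field.
have : 64 * 128 * K ^+ 2 < K * K ^+ 2 by rewrite ltr_pM2r // exprn_gt0.
by move: h; clear; lra.
Qed.

(* [t, s, a, b] sit at the even and [z1], ..., [z4] at the odd vertices of a cube; the
   hypotheses bound sums along its edges. *)
Lemma cubic_growth K E s a b t z1 z2 z3 z4 :
  0 <= E -> 1 + 64 * 128 + 12 * E + 32 * (64 * E ^+ 3) <= K ->
  0 <= s -> 0 <= a -> 0 <= b -> 0 <= t ->
  0 <= z1 -> 0 <= z2 -> 0 <= z3 -> 0 <= z4 ->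
  `|s + z1 - K| <= E -> `|s + z2 - K| <= E -> `|s + z4 - K| <= E ->
  `|a + z1 - K| <= E -> `|a + z3 - K| <= E -> `|b + z2 - K| <= E ->
  `|t + z3 - (K ^+ 2 + K)| <= E ->
  t * s * a * b = z1 * z2 * z3 * z4 ->
  K ^+ 2 <= 256 * s ^+ 3 /\ s ^+ 3 <= 128 * K ^+ 2.
Proof.
move=> E0 KB s0 a0 b0 t0 z10 z20 z30 z40; rewrite !ler_norml.
move=> /andP[h1 h1'] /andP[h2 h2'] /andP[h4 h4'] /andP[g1 g1'] /andP[g3 g3'].
move=> /andP[f2 f2'] /andP[k3 k3'] quartic.
have E30 : 0 <= E ^+ 3 by exact: exprn_ge0.
have K1 : 1 <= K by move: KB E0 E30; clear; lra.
have KL : 64 * 128 < K by move: KB E0 E30; clear; lra.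
have KE : 12 * E <= K by move: KB E0 E30; clear; lra.
have KE3 : 32 * (64 * E ^+ 3) < K by move: KB E0 E30; clear; lra.
have K2 : K * 2 <= K ^+ 2.
  rewrite expr2; apply: ler_wpM2l; first by rewrite (le_trans ler01).
  by move: KL; clear; lra.
have K0 : 0 < K by rewrite (lt_le_trans ltr01).
have upper : s ^+ 3 <= 128 * K ^+ 2.
  apply: (quartic_upper (E := E) (a := a) (b := b) (t := t) (z1 := z1) (z2 := z2)
    (z3 := z3) (z4 := z4)) => //.
  - by move: K2 KE E0; clear; lra.
  - by move: K2 KE3 E30 K0; clear; lra.
  - by move: h1' g1; clear; lra.
  - by move: h2' f2; clear; lra.
  - by move: k3 g3' a0 E0 K0; clear; lra.
  - by rewrite z10; move: h1' s0 KE E0; clear; lra.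
  - by rewrite z20; move: h2' s0 KE E0; clear; lra.
  - by rewrite z30; move: g3' a0 KE E0; clear; lra.
  - by rewrite z40; move: h4' s0 KE E0; clear; lra.
split=> //; have sK := cube_small K0 KL s0 upper.
apply: (quartic_lower (E := E) (a := a) (b := b) (t := t) (z1 := z1) (z2 := z2)
  (z3 := z3) (z4 := z4)) => //.
- by move: K2 KE3 K0; clear; lra.
- by rewrite a0; move: h1 g1'; clear; lra.
- by rewrite b0; move: h2 f2'; clear; lra.
- by rewrite t0; move: k3' z30 K2 KE E0; clear; lra.
- by move: h1 sK KE E0; clear; lra.
- by move: h2 sK KE E0; clear; lra.
- by move: h1 g1' g3 sK KE E0; clear; lra.
- by move: h4 sK KE E0; clear; lra.
Qed.

End CubicGrowth.

(** * Margins along the edges of the cube *)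

Section PairMargins.
Variables (R : realType) (V : finType) (e : rel V) (I : V -> finType).
Variable corner : bits -> cell I.
Hypothesis obs : obstruction e corner.
Variables (mu : bits -> R) (w : cell I -> R) (mhat : cell I -> R).
Hypotheses (w_ge0 : forall x, 0 <= w x) (mhat_ge0 : forall x, 0 <= mhat x).

Let data x : R := \sum_(p | corner p == x) mu p + w x.

Hypothesis margins : forall D, complete_set e D ->
  forall x, marg mhat D x = marg data D x.

Let W : R := \sum_x w x.

Let W_ge0 : 0 <= W. Proof. exact: sumr_ge0. Qed.

Let marg_w_le D x : marg w D x <= W.
Proof.
rewrite /marg /W [leRHS](bigID (fun y => agree D y x)) /= lerDl.
exact: sumr_ge0.
Qed.

Let marg_data D x : marg data D x = \sum_(p | agree D (corner p) x) mu p + marg w D x.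
Proof.
rewrite /marg big_split /=; congr (_ + _).
rewrite (exchange_big_dep (fun p => agree D (corner p) x)) /=; last first.
  by move=> y p yx /eqP ->.
apply: eq_bigr => p px; rewrite (big_pred1 (corner p)) // => y.
by rewrite eq_sym /=; case: eqP => [->|]; rewrite ?px ?andbF.
Qed.

(** On some complete set the cell looks like no corner, so the margin of the data there comes from
    [w] alone. *)
Lemma mhat_off_corners x : (forall p, x <> corner p) -> mhat x <= W.
Proof.
move=> no; have [D Dc Dx] : exists2 D, complete_set e D & forall p, ~~ agree D (corner p) x.
  apply: boolp.contrapT => h.
  have [p xp] : exists p, x = corner p; last by exact: no xp.
  apply: (corner_local obs) => D Dc; apply: boolp.contrapT => nD; apply: h.
  by exists D => // p; apply/negP => px; apply: nD; exists p; rewrite agree_sym.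
apply: le_trans (marg_w_le D x).
have <- : marg mhat D x = marg w D x.
  by rewrite margins // marg_data big_pred0 ?add0r // => p; apply/negbTE.
by rewrite /marg (bigD1 x) ?agree_refl //= lerDl; exact: sumr_ge0.
Qed.

(** The margin that sees all bits but [i] contains just two corners; every other cell in it
    contributes at most [W], and [w] adds at most [W] to the data. *)
Lemma mhat_pair i p :
  `|mhat (corner p) + mhat (corner (flip i p)) - (mu p + mu (flip i p))|
    <= #|cell I|%:R * W + W.
Proof.
have [D Dc det] := corner_detect obs i.
have flip_neq : (flip i p == p) = false by case: i {D Dc det} p => [|[|i]] [[[] []] []].
have det' p' : agree D (corner p') (corner p) = (p' == p) || (p' == flip i p).
  by rewrite agree_sym det.
have := margins Dc (corner p); rewrite marg_data.
have -> : \sum_(p' | agree D (corner p') (corner p)) mu p' = mu p + mu (flip i p).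
  rewrite (eq_bigl _ _ det') (bigD1 p) ?eqxx //=; congr (_ + _).
  rewrite (big_pred1 (flip i p)) // => p' /=.
  case: (eqVneq p' p) => [->|_]; last by rewrite andbT.
  by rewrite andbF eq_sym flip_neq.
pose far y := [&& agree D y (corner p), y != corner p & y != corner (flip i p)].
have -> : marg mhat D (corner p) =
    mhat (corner p) + mhat (corner (flip i p)) + \sum_(y | far y) mhat y.
  rewrite /marg (bigD1 (corner p)) ?agree_refl //= -addrA; congr (_ + _).
  rewrite (bigD1 (corner (flip i p))) /=; last first.
    by rewrite det' eqxx orbT (inj_eq (corner_inj obs)) flip_neq.
  by congr (_ + _); apply: eq_bigl => y; rewrite -andbA.
have far0 : 0 <= \sum_(y | far y) mhat y by exact: sumr_ge0.
have farW : \sum_(y | far y) mhat y <= #|cell I|%:R * W.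
  apply: le_trans (_ : \sum_(y : cell I) W <= _); last first.
    by rewrite sumr_const mulr_natl.
  rewrite [leRHS](bigID far) /= -[leLHS]addr0; apply: lerD; last exact: sumr_ge0.
  apply: ler_sum => y /and3P[yD yp yf]; apply: mhat_off_corners => p' yp'.
  move: yD yp yf; rewrite yp' det' !(inj_eq (corner_inj obs)).
  by case: eqP => //= _; case: eqP.
have mw0 : 0 <= marg w D (corner p) by exact: sumr_ge0.
have mwW := marg_w_le D (corner p).
move: (marg w D _) (\sum_(y | far y) _) (#|cell I|%:R * W) far0 farW mw0 mwW.
move=> mw fs cW fs0 fsW mw0 mwW E; rewrite ler_norml.
move: (mhat _) (mhat _) (mu _) (mu _) fs0 fsW mw0 mwW E => t1 t2 u1 u2.
by clear; move=> *; apply/andP; split; lra.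
Qed.

End PairMargins.

(** * Counts that force fractional growth *)

Section NotRational.
Variables (R : realType) (V : finType) (e : rel V) (I : V -> finType).
Variable corner : bits -> cell I.
Hypothesis obs : obstruction e corner.
Implicit Types (x : cell I) (k : nat).

Lemma prod_bits (F : bits -> R) : \prod_p F p =
  F (true, true, true) * F (true, true, false) *
  (F (true, false, true) * F (true, false, false)) *
  (F (false, true, true) * F (false, true, false) *
  (F (false, false, true) * F (false, false, false))).
Proof.
rewrite (eq_bigr (fun p => F (p.1, p.2))) => [|[p c] _ //].
rewrite -(pair_bigA _ (fun p c => F (p, c))) /=.
rewrite (eq_bigr (fun p => \prod_c F ((p.1, p.2), c))) => [|[a b] _ //].
by rewrite -(pair_bigA _ (fun a b => \prod_c F ((a, b), c))) /= !big_bool.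
Qed.

Variable w : cell I -> nat.

(* The counts [w] only keep the denominators of the estimate from vanishing; the
   exponents 4 and 2 make the estimate at (0,1,1) grow like [k^(4/3)]. *)
Definition peak_counts k x : nat := ((corner (false, false, false) == x) * k ^ 4 +
  parity_count corner true x * k ^ 2 + w x)%N.

Lemma natr_peak_counts k x : (peak_counts k x)%:R =
  (corner (false, false, false) == x)%:R * k%:R ^+ 4 +
  (parity_count corner true x)%:R * k%:R ^+ 2 + (w x)%:R :> R.
Proof.
by rewrite !natrD [(_ * k ^ 4)%:R]natrM [(_ * k ^ 2)%:R]natrM !natrX.
Qed.

Let mu k (p : bits) : R :=
  if p == (false, false, false) then k%:R ^+ 4 else if parity p then k%:R ^+ 2 else 0.

Let peak_countsE k x : (peak_counts k x)%:R = \sum_(p | corner p == x) mu k p + (w x)%:R.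
Proof.
rewrite natr_peak_counts; congr (_ + _).
rewrite (bigID (fun p => p == (false, false, false))) /=; congr (_ + _).
  case: eqP => [<-|ne].
    rewrite (big_pred1 (false, false, false)) ?mul1r // => p.
    by rewrite (inj_eq (corner_inj obs)) /= andbb.
  by rewrite mul0r big_pred0 // => p; case: eqP => // cp; case: eqP => // p0; rewrite -p0 in ne.
rewrite /parity_count natr_sum mulr_suml big_mkcond [RHS]big_mkcond /=.
apply: eq_bigr => p _; rewrite /mu.
case: (eqVneq p (false, false, false)) => [->|_]; first by rewrite andbF.
by rewrite andbT; case: (parity p); case: (corner p == x); rewrite ?mul1r ?mul0r.
Qed.

Lemma mle_growth : exists2 B : R, 0 <= B & forall k (mhat : cell I -> R), B <= k%:R ->
  is_mle (design I e) (peak_counts k) mhat ->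
  k%:R ^+ 4 <= 256 * mhat (corner (false, true, true)) ^+ 3 /\
  mhat (corner (false, true, true)) ^+ 3 <= 128 * k%:R ^+ 4.
Proof.
(* The error bound of [mhat_pair]; below, a bound on [k] yields one on [K] since [k <= k ^+ 2]. *)
pose E : R := #|cell I|%:R * (\sum_x (w x)%:R) + \sum_x (w x)%:R.
have E0 : 0 <= E by rewrite addr_ge0 ?mulr_ge0 // sumr_ge0.
have E30 : 0 <= E ^+ 3 by rewrite exprn_ge0.
exists (1 + 64 * 128 + 12 * E + 32 * (64 * E ^+ 3)) => [|k mhat kB mle].
  by rewrite !addr_ge0 ?mulr_ge0.
set K : R := k%:R ^+ 2.
have k1 : 1 <= k%:R :> R by apply: le_trans kB; rewrite -!addrA lerDl !addr_ge0 ?mulr_ge0.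
have kK : k%:R <= K by rewrite /K expr2 ler_peMr // (le_trans ler01).
have KB := le_trans kB kK.
have k_gt0 : (0 < k)%N by rewrite -(ltr0n R) (lt_le_trans ltr01).
have nonzero : exists x, peak_counts k x != 0%N.
  exists (corner (false, false, false)).
  by rewrite -lt0n /peak_counts eqxx mul1n -addnA addn_gt0 expn_gt0 k_gt0.
have [mh0 mhM mhT] := mle_margins nonzero mle.
have margins D : complete_set e D -> forall x, marg mhat D x =
    marg (fun y => \sum_(p | corner p == y) mu k p + (w y)%:R) D x.
  by move=> Dc x; rewrite mhM //; apply: eq_bigr => y _; exact: peak_countsE.
have pair := mhat_pair obs (fun x => ler0n R (w x)) mh0 margins.
have := mhT _ _ (parity_count_congruent obs); rewrite !prod_parity_count.
have -> : k%:R ^+ 4 = K ^+ 2 by rewrite -exprM.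
rewrite ![\prod_(p | _) _]big_mkcond !prod_bits /= !(mul1r, mulr1).
move=> quartic.
have m2 : mu k (false, false, false) = K ^+ 2 by rewrite /mu eqxx /K -exprM.
apply: (cubic_growth E0 KB (a := mhat (corner (true, false, true)))
  (b := mhat (corner (true, true, false))) (t := mhat (corner (false, false, false)))
  (z1 := mhat (corner (false, false, true))) (z2 := mhat (corner (false, true, false)))
  (z3 := mhat (corner (true, false, false))) (z4 := mhat (corner (true, true, true)))) => //.
(* Each of the seven edges of the cube is given by its even end and its direction. *)
- by have := pair 1 (false, true, true); rewrite /mu /= add0r.
- by have := pair 2 (false, true, true); rewrite /mu /= add0r.
- by have := pair 0 (false, true, true); rewrite /mu /= add0r.
- by have := pair 0 (true, false, true); rewrite /mu /= add0r.
- by have := pair 2 (true, false, true); rewrite /mu /= add0r.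
- by have := pair 0 (true, true, false); rewrite /mu /= add0r.
- by have := pair 0 (false, false, false); rewrite m2 /mu /=.
- have perm (x1 x2 x3 x4 y1 y2 y3 y4 : R) :
      x1 * x2 * (x3 * x4) = y1 * y2 * (y3 * y4) -> x4 * x3 * x2 * x1 = y4 * y3 * y2 * y1.
    by move=> E'; transitivity (x1 * x2 * (x3 * x4)); [ring | rewrite E'; ring].
  exact: perm quartic.
Qed.

End NotRational.

(** The degrees would satisfy [3 * deg F = 4 + 3 * deg G], which fails modulo 3. *)
Lemma size_growth (R : realType) (F G : {poly R}) : G != 0 ->
  (exists T : R, forall k : nat, T <= k%:R -> G.[k%:R] != 0 /\
     let s := F.[k%:R] / G.[k%:R] in
     [/\ 0 <= s, k%:R ^+ 4 <= 256 * s ^+ 3 & s ^+ 3 <= 128 * k%:R ^+ 4]) -> False.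
Proof.
move=> G0 [T h].
have cube k : T <= k%:R -> `|F.[k%:R]| ^+ 3 =
    (F.[k%:R] / G.[k%:R]) ^+ 3 * `|G.[k%:R]| ^+ 3.
  move=> /h[Gk [s0 _ _]]; rewrite -exprMn; congr (_ ^+ _).
  by rewrite -{1}(ger0_norm s0) -normrM divfK.
have le1 : (size ('X^4 * G ^+ 3)%R <= size (F ^+ 3)%R)%N.
  apply: (@poly_size_le _ _ _ 256 T) => k Tk; have [Gk [s0 lo _]] := h k Tk.
  rewrite hornerM hornerXn !horner_exp normrM !normrX normr_nat cube // [leRHS]mulrA.
  by apply: ler_wpM2r; [exact: exprn_ge0 | exact: lo].
have le2 : (size (F ^+ 3)%R <= size ('X^4 * G ^+ 3)%R)%N.
  apply: (@poly_size_le _ _ _ 128 T) => k Tk; have [Gk [s0 _ hi]] := h k Tk.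
  rewrite [in leRHS]hornerM hornerXn !horner_exp [in leRHS]normrM !normrX normr_nat.
  rewrite cube // [leRHS]mulrA.
  by apply: ler_wpM2r; [exact: exprn_ge0 | exact: hi].
have E : size (F ^+ 3)%R = size ('X^4 * G ^+ 3)%R by apply/eqP; rewrite eqn_leq le1 le2.
have G30 : size (G ^+ 3) != 0%N by rewrite size_poly_eq0 expf_neq0.
have : ((size G).-1 * 3 + 4 = (size F).-1 * 3)%N.
  rewrite -!size_exp E [size ('X^4 * _)]size_mul ?expf_neq0 ?polyX_eq0 // size_polyXn.
  by case: (size (G ^+ 3)) G30 => // n _; rewrite addnC.
by move/(congr1 (modn^~ 3)); rewrite modnMDl modnMl.
Qed.

Lemma obstruction_not_rational (R : realType) (V : finType) (e : rel V) (I : V -> finType)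
    (corner : bits -> cell I) :
  obstruction e corner -> mle_rational R (design I e) -> False.
Proof.
move=> obs [f [g [g0 fg]]].
(* The product of all denominators is a nonzero polynomial, so it does not vanish at some natural
   counts. *)
have [w' w'P] : exists w : 'I_#|cell I| -> nat, meval (fun i => (w i)%:R) (\prod_x g x) != 0.
  by apply: mpoly_nat_neq0; apply/prodf_neq0 => x _.
pose w x := w' (enum_rank x).
pose gamma (i : 'I_#|cell I|) : {poly R} :=
  let x := enum_val i in (corner (false, false, false) == x)%:R *: 'X^4 +
    (parity_count corner true x)%:R *: 'X^2 + (w x)%:R%:P.
have gammaE k i : (gamma i).[k%:R] = (peak_counts corner w k (enum_val i))%:R.
  by rewrite natr_peak_counts /gamma !hornerD !hornerZ !hornerXn hornerC.
have substE k (q : mpoly #|cell I| R) : (subst gamma q).[k%:R] =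
    eval_at (fun x => (peak_counts corner w k x)%:R) q.
  by rewrite horner_subst; apply: meval_eq => i; exact: gammaE.
have G0 x : subst gamma (g x) != 0.
  (* At [k = 0] the counts reduce to [w], where no denominator vanishes. *)
  apply/eqP => /(congr1 (horner^~ 0%:R)); rewrite substE horner0 => E.
  move: w'P; rewrite rmorph_prod /= => /prodf_neq0 /(_ x isT) /eqP; apply.
  rewrite -[RHS]E; apply: meval_eq => i.
  by rewrite /peak_counts !muln0 /w enum_valK.
have prodG0 : \prod_x subst gamma (g x) != 0 by apply/prodf_neq0.
have [T hT] := poly_nat_neq0 prodG0.
have [B B0 hB] := mle_growth R obs w.
set S := corner (false, true, true).
apply: (size_growth (F := subst gamma (f S)) (G0 S)).
exists (Num.max 1 (Num.max T B)) => k; rewrite !ge_max => /and3P[k1 /hT Tk Bk].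
have Gk x : (subst gamma (g x)).[k%:R] != 0.
  by move: Tk; rewrite horner_prod => /prodf_neq0; apply.
have k_gt0 : (0 < k)%N by rewrite -(ltr0n R) (lt_le_trans ltr01).
have nonzero : exists x, peak_counts corner w k x != 0%N.
  exists (corner (false, false, false)).
  by rewrite -lt0n /peak_counts eqxx mul1n -addnA addn_gt0 expn_gt0 k_gt0.
have evg x : eval_at (fun x => (peak_counts corner w k x)%:R) (g x) != 0.
  by rewrite -substE.
have mle := fg _ nonzero evg.
split; [exact: Gk | rewrite /= !substE; case: (hB k _ Bk mle) => lo hi; split=> //].
by case: (mle_margins nonzero mle) => h _ _; exact: h.
Qed.

(** * Equivalence of the five conditions *)

Local Open Scope classical_set_scope.
Local Open Scope ring_scope.

Theorem theorem4p4 (R : realType) (V : finType) (e : rel V) (I : V -> finType)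
    (e_sym : symmetric e) (e_irr : irreflexive e)
    (I_levels : forall v, (1 < #|I v|)%N) :
  [<-> decomposable e;

       exists S : set (mpoly #|cell I| R),
         (forall f, S f -> separation_binomial e f) /\
         forall P : cell I -> R, distribution P ->
           (factors e P <-> forall f, S f -> eval_at P f = 0);

       exists (ord : rel (multinom #|cell I|)) (B : seq (mpoly #|cell I| R)),
         [/\ term_order ord,
             groebner_basis ord (toric_ideal R (design I e)) B
           & forall f, f \in B -> separation_binomial e f];

       mle_rational R (design I e);

       closed (image_phi R (design I e) : set {ptws cell I -> R})].
Proof.
have by_obstruction (A : Prop) :
    (forall corner : bits -> cell I, obstruction e corner -> ~ A) -> A -> decomposable e.
  move=> noA a; apply: boolp.contrapT => nd.
  by have [corner /noA] := not_decomposable_obstruction e_sym e_irr I_levels nd; apply.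
have markov_dec : (exists S : set (mpoly #|cell I| R),
    (forall f, S f -> separation_binomial e f) /\
    forall P : cell I -> R, distribution P ->
      (factors e P <-> forall f, S f -> eval_at P f = 0)) -> decomposable e.
  apply: by_obstruction => corner obs [S [Ssep SP]].
  have [P [dP mP nP]] := obstruction_not_markov R obs.
  by apply/nP/(SP P dP) => f /Ssep; exact: mP.
have groebner_dec : (exists (ord : rel (multinom #|cell I|)) (B : seq (mpoly #|cell I| R)),
    [/\ term_order ord, groebner_basis ord (toric_ideal R (design I e)) B
      & forall f, f \in B -> separation_binomial e f]) -> decomposable e.
  apply: by_obstruction => corner obs [ord [B [ordP gB Bsep]]].
  exact: (obstruction_not_groebner obs ordP gB Bsep).
(* Every arrow that leaves one of (b) to (e) first returns to decomposability by an obstruction. *)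
tfae.
- move=> dec; exists (@separation_binomial R V e I); split=> // P [P0 _].
  split=> [/(factors_markov)//|mP]; exact: markov_factors.
- move=> /markov_dec/(decomposable_peo e_sym e_irr)[rk peo].
  exists (degrevlex (@cell_rank V I rk)), (separation_binomials R e I); split.
  + apply: degrevlex_order; apply: cell_rank_inj; by case: peo.
  + exact: peo_groebner.
  + by move=> f /mem_separation_binomials.
- by move=> /groebner_dec; exact: decomposable_mle_rational.
- move=> rat; apply: decomposable_closed => //; move: rat.
  by apply: by_obstruction => corner obs; exact: (obstruction_not_rational obs).
- by apply: by_obstruction => corner obs; exact: (obstruction_not_closed obs).
Qed.
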